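(* For $\beta,N>0$ and $m\in\{0,1,2,\dots\}$ there exists $\kappa(m,\beta,N)>0$ such that for all $g\in RPW(\pi)$ with $\|g\|_{L^2}\le1$, the linear statistic $F_m(\tau)=\sum_{j=-m}^m(g(\tau_j)-g(j))$ satisfies $$\nu_N^\beta\Bigl\{q\in\Omega_N:F_m(\tau(q))-\int F_m\,d\nu_N^\beta>\varepsilon\Bigr\}\le e^{-\kappa(m,\beta,N)\varepsilon^2}\qquad(\varepsilon>0).$$
   Context: Let $\mathbf T=\mathbf R/2\pi\mathbf Z$ with normalized measure $dx/2\pi$, and for $N>0$ let $\Omega_N=\{\phi\in L^2(\mathbf T;\mathbf R):\int_{\mathbf T}\phi(x)^2\,dx/2\pi\le N\}$. Let $(\gamma_n)_{n\in\mathbf Z}$ be mutually independent standard Gaussian random variables and let $\gamma$ be the Gaussian probability measure on $L^2(\mathbf T;\mathbf R)$ which is the law of $\phi(x)=\gamma_0+\sum_{n=-\infty}^{-1}\gamma_n\frac{\sin nx}{n}+\sum_{n=1}^\infty\gamma_n\frac{\cos nx}{n}$. For $\beta\ge 0$ the KdV Gibbs measure is the Radon probability measure on $\Omega_N$ $$\nu_N^\beta(d\phi)=Z_N(\beta)^{-1}\,\mathbf 1_{\Omega_N}(\phi)\exp\Bigl(\frac{\beta}{6}\int_{\mathbf T}\phi(x)^3\frac{dx}{2\pi}\Bigr)\gamma(d\phi),$$ with $Z_N(\beta)$ the normalizing constant. For $q\in\Omega_N$ (extended $2\pi$-periodically), the periodic spectrum of $-f''+qf=\lambda f$ is the sequence,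 listed with multiplicity, $\lambda_0<\lambda_1\le\lambda_2<\lambda_3\le\lambda_4<\cdots$ of real $\lambda$ for which there is a nontrivial solution that is either $2\pi$-periodic or $2\pi$-antiperiodic. Define $\tau=\tau(q)=(\tau_j)_{j=-\infty}^\infty$ by $\tau_j=\sqrt{2(\lambda_{2j}+\lambda_{2j-1})}$ for $j\ge1$, $\tau_0=0$, and $\tau_{j}=-\tau_{-j}$ for $j\le-1$. (Finitely many $\tau_j$ may be purely imaginary; then $g(\tau_j)+g(\tau_{-j})$ is still real for the $g$ below.) $RPW(\pi)$ is the real Hilbert space of entire functions $g$ of exponential type with $\limsup_{y\to\pm\infty}\log|g(iy)|/|y|\le\pi$, $\int_{-\infty}^\infty|g(x)|^2dx<\infty$ and $\overline{g(z)}=g(\bar z)$, with the $L^2(\mathbf R)$ norm. The integral $\int F_m\,d\nu_N^\beta$ means $\int_{\Omega_N}F_m(\tau(q))\,\nu_N^\beta(dq)$. *)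

(* Defs.v *)
From HB Require Import structures.
From mathcomp Require Import all_boot all_order all_algebra.
From mathcomp Require Import complex.
From mathcomp Require Import all_classical all_reals all_analysis.
From mathcomp Require Import measurable_realfun.

Set Implicit Arguments.
Unset Strict Implicit.
Unset Printing Implicit Defensive.

Import Order.TTheory GRing.Theory Num.Theory.
Import numFieldNormedType.Exports.

Local Open Scope classical_set_scope.
Local Open Scope ring_scope.

Lemma twopi_gt0 (R : realType) : (0 : R) < 2 * pi.
Proof. by rewrite mulr_gt0// pi_gt0. Qed.

(** The circle is represented by its fundamental interval [[0, 2 pi]], carrying
    the normalized measure [dx / 2 pi]. *)
Definition circle_prob (R : realType) : probability (measurableTypeR R) R :=
  uniform_prob (twopi_gt0 R).

(** [L^2(T; R)]: almost-everywhere classes of square-integrable functions; an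
    element coerces to a representative, of which only the values on
    [[0, 2 pi]] matter. *)
Definition L2T (R : realType) : Type := LspaceType2 (circle_prob R).

Section L2T_zero.
Variable R : realType.
Local Notation Rm := (measurableTypeR R).

Let zero_class : {mfun_ (circle_prob R), Rm >-> Rm} :=
  (\pi_({mfun_ (circle_prob R), Rm >-> Rm})%qT [the {mfun Rm >-> Rm} of cst 0]).

Let zero_finite : finite_norm (circle_prob R) 2%:R%:E zero_class.
Proof.
have z0 : repr zero_class = cst 0 %[ae circle_prob R].
  have : (repr zero_class == [the {mfun Rm >-> Rm} of cst 0]
     %[mod {mfun_ (circle_prob R), Rm >-> Rm}])%qT.
    by rewrite reprK.
  by rewrite eqmodE => /asboolP.
rewrite /finite_norm unlock.
rewrite [X in (X `^ _)%E](_ : _ = 0%E); last first.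
  rewrite -[RHS](integral0 (circle_prob R) setT).
  apply: ae_eq_integral => //=.
    rewrite [X in measurable_fun _ X](_ : _ =
      EFin \o (fun x => `|zero_class x| `^ 2%:R)); last by [].
    apply/measurable_EFinP.
    apply: (measurableT_comp (measurable_powR _)).
    exact: measurableT_comp.
  apply: filterS z0 => x /(_ I)/= z0 _.
  by rewrite /aqEqMfun_to_fun z0 normr0 -[LHS]/((0 `^ 2%:R)%:E) powR0.
by rewrite -[X in (X < _)%E]/((0 `^ 2%:R^-1)%:E) ltry.
Qed.

HB.instance Definition _ := isFinLebesgue.Build _ _ R (circle_prob R) _
  (lee1n 2) zero_class zero_finite.

Definition L2T_zero : L2T R := (zero_class : LspaceType2 (circle_prob R)).

End L2T_zero.

HB.instance Definition _ (R : realType) := gen_eqMixin (L2T R).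
HB.instance Definition _ (R : realType) := gen_choiceMixin (L2T R).
HB.instance Definition _ (R : realType) := isPointed.Build (L2T R) (L2T_zero R).

Definition L2T_norm (R : realType) (f : R -> R) : \bar R :=
  ('N[circle_prob R]_2%:E[EFin \o f])%E.

Definition L2T_open (R : realType) : set (set (L2T R)) :=
  [set A | forall q : L2T R, A q -> exists2 r : R, 0 < r &
    forall p : L2T R, (L2T_norm (fun x => p x - q x)%R < r%:E)%E -> A p].

(** [L2T R] with its Borel sigma-algebra (generated by the norm-open sets) *)
Definition L2Tb (R : realType) := g_sigma_algebraType (@L2T_open R).
HB.instance Definition _ (R : realType) := Measurable.on (L2Tb R).

Definition Omega_ (R : realType) (N : R) : set (L2Tb R) :=
  [set q : L2Tb R | (\int[circle_prob R]_x (q x ^+ 2)%:E <= N%:E)%E].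

Definition mutually_independent (I : eqType) d (W : measurableType d)
    (R : realType) (P : probability W R) (X : I -> {RV P >-> R}) : Prop :=
  forall (J : seq I) (A : I -> set R),
    uniq J -> (forall i, measurable (A i)) ->
    P (\bigcap_(i in [set` J]) (X i @^-1` A i)) =
    (\big[*%E/1%E]_(i <- J) P (X i @^-1` A i))%E.

Definition standard_gaussian d (W : measurableType d)
    (R : realType) (P : probability W R) (X : {RV P >-> R}) : Prop :=
  forall A : set R, measurable A -> distribution P X A = normal_prob 0 1 A.

(** The symmetric partial sum of the random Fourier series, for [|n| <= K]; the
    sine terms are those with negative index [- n]. *)
Definition loop_partial (R : realType) (a : int -> R) (K : nat) (x : R) : R :=
  a 0 + \sum_(1 <= n < K.+1) a (- n%:Z) * (sin ((- n%:Z)%:~R * x) / (- n%:Z)%:~R)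
      + \sum_(1 <= n < K.+1) a n%:Z * (cos (n%:R * x) / n%:R).

(** [gamma] is the law of the [L^2]-valued random variable [phi] to which the
    random Fourier series converges in [L^2] almost surely. *)
Definition is_loop_law (R : realType) (gamma : probability (L2Tb R) R) : Prop :=
  exists (d : measure_display) (W : measurableType d) (P : probability W R)
         (a : int -> {RV P >-> R}) (phi : {RV P >-> L2Tb R}),
    [/\ mutually_independent a,
        forall n, standard_gaussian (a n),
        {ae P, forall w, L2T_norm (fun x => phi w x
            - loop_partial (fun n => a n w) K x) @[K --> \oo] --> 0%E} &
        forall A, measurable A -> gamma A = distribution P phi A].

Section gibbs.
Variables (R : realType) (gamma : probability (L2Tb R) R) (N beta : R).

(** The cubic integral is finite for [gamma]-almost every [q], the Fourier series
    being almost surely a continuous function; off that null set the value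
    given by the library's total integral is immaterial. *)
Definition gibbs_weight (q : L2Tb R) : R :=
  \1_(Omega_ N) q *
  expR (beta / 6 * \int[circle_prob R]_x (q x ^+ 3)).

Definition gibbs_Z : \bar R := (\int[gamma]_q (gibbs_weight q)%:E)%E.

Definition gibbs (A : set (L2Tb R)) : \bar R :=
  ((fine gibbs_Z)^-1%:E * \int[gamma]_(q in A) (gibbs_weight q)%:E)%E.

End gibbs.

Section spectrum.
Variable R : realType.
Implicit Types (q : L2T R) (t : R) (f : R -> R).

(** the [2 pi]-periodic extension of the restriction of [h] to [[0, 2 pi)] *)
Definition periodize (h : R -> R) (x : R) : R :=
  h (x - 2 * pi * (Num.floor (x / (2 * pi)))%:~R).

(** Since [q] is only in [L^2], [- f'' + q f = t f] is understood in the sense of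
    Caratheodory: [f] is differentiable, [f'] is absolutely continuous and
    [f'' = (q - t) f] almost everywhere, i.e. [f'] is an indefinite integral of
    [(q - t) f]. *)
Definition hill_solution q t f : Prop :=
  (forall x, derivable f x 1) /\
  forall x y, x <= y ->
    derive1 f y - derive1 f x =
    \int[lebesgue_measure]_(s in `[x, y]) ((periodize q s - t) * f s).

Definition spectral_function q t f : Prop :=
  hill_solution q t f /\
  ((forall x, f (x + 2 * pi) = f x) \/ (forall x, f (x + 2 * pi) = - f x)).

Definition lin_indep k (f : 'I_k -> R -> R) : Prop :=
  forall c : 'I_k -> R,
    (forall x, \sum_i c i * f i x = 0) -> forall i, c i = 0.

Definition has_spectral_functions q t k : Prop :=
  exists2 f : 'I_k -> R -> R, lin_indep f & forall i, spectral_function q t (f i).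

(** The only function which is both [2 pi]-periodic and [2 pi]-antiperiodic is
    zero, so [k] is the dimension of the space of periodic solutions plus that
    of the space of antiperiodic solutions. *)
Definition multiplicity q t k : Prop :=
  has_spectral_functions q t k /\ ~ has_spectral_functions q t k.+1.

(** [lam] lists the spectrum in increasing order, each [t] as many times as its
    multiplicity (zero times if [t] is not in the spectrum). This determines
    [lam]; that its inequalities alternate between [<] and [<=] is Hill's theory,
    not part of the definition. *)
Definition spectrum_listing q (lam : nat -> R) : Prop :=
  {homo lam : m n / (m <= n)%N >-> m <= n} /\
  forall t, exists2 k, multiplicity q t k & ([set n | lam n = t] #= `I_k)%card.

Definition periodic_spectrum q : nat -> R :=
  get [set lam : nat -> R | spectrum_listing q lam].

Definition tau_pos q (j : nat) : R[i] :=
  sqrtC (2 * (periodic_spectrum q (2 * j)%N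
              + periodic_spectrum q (2 * j - 1)%N))%:C%C.

Definition tau q (j : int) : R[i] :=
  match j with
  | Posz 0 => 0
  | Posz n.+1 => tau_pos q n.+1
  | Negz n => - tau_pos q n.+1
  end.

End spectrum.

Local Notation normc := ComplexField.Normc.normc.

Section paley_wiener.
Variable R : realType.
Implicit Type g : R[i] -> R[i].

(** holomorphic on the whole complex plane *)
Definition entire g : Prop := forall z, derivable (g : R[i]^o -> R[i]^o) z 1.

Definition exponential_type g : Prop :=
  exists A B : R, forall z, normc (g z) <= A * expR (B * normc z).

(** [log |g (i y)| / |y|], which is [-oo] when [g (i y) = 0] *)
Definition log_growth g (y : R) : \bar R :=
  (lne (normc (g (0 +i* y)%C))%:E * (`|y|^-1)%:E)%E.

Definition real_modulus g (x : R) : R := normc (g x%:C%C).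

Definition PW_norm g : \bar R :=
  ('N[@lebesgue_measure R]_2%:E[EFin \o real_modulus g])%E.

Definition RPW (b : R) : set (R[i] -> R[i]) :=
  [set g | [/\ entire g, exponential_type g,
     (limf_esup (log_growth g) +oo%R <= b%:E)%E
       /\ (limf_esup (log_growth g) -oo%R <= b%:E)%E,
     (\int[@lebesgue_measure R]_x (real_modulus g x ^+ 2)%:E < +oo)%E &
     forall z : R[i], (conjc (g z) = g (conjc z))%C]].

(** The sum over [- m <= j <= m] is a real number, because [tau] is odd, each
    [tau q j] is real or purely imaginary, and [g] commutes with conjugation;
    [Re] only casts it to [R]. *)
Definition linear_statistic g (m : nat) (q : L2T R) : R :=
  complex.Re (\sum_(i < (2 * m).+1)
    (g (tau q (i%:Z - m%:Z)) - g (i%:Z - m%:Z)%:~R)).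

End paley_wiener.

(* Main.v *)
(** On [Omega_ N] the statistic is bounded, uniformly in [q] and in [g], and a bounded
    function has a Gaussian tail under any probability measure.

    The values of [g]: a primitive of [g ^+ 2] is bounded on the real axis by the
    [L^2] norm, hence by [C e^{c |Im z|}] everywhere by Phragmen-Lindeloef, and
    Cauchy's estimate then bounds [g] on every horizontal strip.

    The eigenvalues: an eigenfunction with a very negative eigenvalue would exceed
    its maximum immediately after reaching it, so the spectrum is bounded below in
    terms of [N]. For large integers [j] the Volterra equation makes the solutions
    at frequency [k], [|k - j| <= 1/4], close to the free ones, and the discriminant
    attains 2 in modulus there, so that [k ^+ 2] is an eigenvalue; this gives
    sufficiently many eigenvalues to bound the [n]-th one from above. *)

Require Import Defs.
From mathcomp Require Import all_boot all_order all_algebra.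
From mathcomp Require Import complex.
From mathcomp Require Import all_classical all_reals all_analysis.
From mathcomp Require Import finmap measurable_realfun.
From mathcomp Require Import ring lra.

Set Implicit Arguments.
Unset Strict Implicit.
Unset Printing Implicit Defensive.

Import Order.TTheory GRing.Theory Num.Theory.
Import numFieldNormedType.Exports.

Local Open Scope classical_set_scope.
Local Open Scope ring_scope.

(** The weight, the statistic and the tail sets are not shown to be measurable: [periodic_spectrum]
    is a choice among listings. The tail bound therefore rests only on properties that the weighted
    set function has anyway: monotonicity, total mass at most 1, superadditivity on disjoint
    measurable sets, approximation from inside by measurable sets. The growth constants in the
    definition of exponential type vary with [g], whereas the final bound may not.
    Phragmen-Lindeloef discards them, leaving only the bound on the real axis and the exponent on
    the imaginary one. The square of [g] is used because it is absolutely integrable, so that its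
    primitive is bounded on the axis. The potential is only square-integrable, so an integral
    against it is merely Hoelder continuous of exponent 1/2, and second derivatives of solutions
    need not exist pointwise. Each differentiation freezes these integrals at the base point and
    checks that the error has order 3/2. The potential enters every constant through its energy
    alone, which makes the bounds uniform over [Omega_ N]. *)

Local Notation nc := ComplexField.Normc.normc.
Local Notation Re := (@complex.Re _).
Local Notation Im := (@complex.Im _).

(** * Gaussian tail of a bounded function *)

Section nonneg_lower_integral.
Local Open Scope ereal_scope.
Context d (T : measurableType d) (R : realType).
Import HBNNSimple.

Definition lower_integral (mu : set T -> \bar R) (f : T -> \bar R) : \bar R :=
  ereal_sup [set sintegral mu h |
    h in [set h : {nnsfun T >-> R} | forall x, (h x)%:E <= f x]].

(** True by definition and for every set function [mu]. [gibbs] is a bare set function, so its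
    integral means exactly this difference. *)
Lemma integral_lower (mu : set T -> \bar R) (D : set T) (f : T -> \bar R) :
  \int[mu]_(x in D) f x =
  lower_integral mu (f \_ D)^\+ - lower_integral mu (f \_ D)^\-.
Proof. by []. Qed.

Lemma le_lower_integral (mu : set T -> \bar R) (f g : T -> \bar R) :
  (forall x, f x <= g x) -> lower_integral mu f <= lower_integral mu g.
Proof.
move=> fg; apply: ereal_sup_le => _ [h hf <-]; exists h => // x.
exact: le_trans (hf x) (fg x).
Qed.

(** Only simple functions are added, so [f] and [g] may be arbitrary. The two suprema are taken one
    after the other, which uses the finiteness established first. *)
Lemma lower_integral_superadd (mu : {measure set T -> \bar R}) (f g h : T -> \bar R) :
  (forall x, 0 <= f x) -> (forall x, 0 <= g x) ->
  (forall x, f x + g x <= h x) ->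
  lower_integral mu f + lower_integral mu g <= lower_integral mu h.
Proof.
move=> f0 g0 fgh.
have pos k : (forall x, 0 <= k x) -> 0 <= lower_integral mu k.
  move=> k0; apply: ereal_sup_ubound; exists nnsfun0 => //=.
  exact: sintegral0.
have Lf : lower_integral mu f <= lower_integral mu h.
  by apply: le_lower_integral => x; apply: le_trans (fgh x); rewrite leeDl.
have Lg : lower_integral mu g <= lower_integral mu h.
  by apply: le_lower_integral => x; apply: le_trans (fgh x); rewrite leeDr.
have [->|hfin] := eqVneq (lower_integral mu h) +oo; first exact: leey.
have finf : lower_integral mu f \is a fin_num.
  by rewrite ge0_fin_numE ?pos// (le_lt_trans Lf)// ltey.
have fing : lower_integral mu g \is a fin_num.
  by rewrite ge0_fin_numE ?pos// (le_lt_trans Lg)// ltey.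
rewrite -leeBrDr//; apply: ge_ereal_sup => _ [u uf <-].
have ufin : sintegral mu u \is a fin_num.
  rewrite ge0_fin_numE ?sintegral_ge0//.
  by apply: le_lt_trans (_ : lower_integral mu f < _);
    [apply: ereal_sup_ubound; exists u | rewrite -ge0_fin_numE ?pos].
rewrite leeBrDr// addeC -leeBrDr//; apply: ge_ereal_sup => _ [v vg <-].
rewrite leeBrDr// addeC.
rewrite -sintegralD//; apply: ereal_sup_ubound; exists (add_nnsfun u v) => //= x.
by rewrite EFinD; apply: le_trans (fgh x); rewrite leeD ?uf ?vg.
Qed.

End nonneg_lower_integral.

(** * Tail bound for a superadditive set function *)

Section inner_superadditive.
Context d (T : measurableType d) (R : realType).
Import HBNNSimple.
Variable nu : set T -> \bar R.
Hypothesis nu_ge0 : forall A, (0 <= nu A)%E.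
Hypothesis nu_le : forall A B, A `<=` B -> (nu A <= nu B)%E.
Hypothesis nuT : (nu setT <= 1)%E.
Hypothesis nu_superadd : forall A B, measurable A -> measurable B ->
  A `&` B = set0 -> (nu A + nu B <= nu (A `|` B))%E.
Hypothesis nu_inner : forall A (x : R), (x%:E < nu A)%E ->
  exists B, [/\ measurable B, B `<=` A & (x%:E < nu B)%E].

Let nu_fin A : nu A \is a fin_num.
Proof.
rewrite ge0_fin_numE// (le_lt_trans (nu_le (@subsetT _ A)))//.
by rewrite (le_lt_trans nuT)// ltry.
Qed.

Let v A : R := fine (nu A).
Let nuE A : nu A = (v A)%:E. Proof. by rewrite /v fineK. Qed.
Let v_ge0 A : 0 <= v A. Proof. by rewrite -lee_fin -nuE. Qed.
Let v_le A B : A `<=` B -> v A <= v B.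
Proof. by move=> AB; rewrite -lee_fin -!nuE nu_le. Qed.
Let v_superadd A B : measurable A -> measurable B ->
  A `&` B = set0 -> v A + v B <= v (A `|` B).
Proof. by move=> mA mB AB; rewrite -lee_fin EFinD -!nuE nu_superadd. Qed.
Let vT A : v A <= 1.
Proof. by rewrite (le_trans (v_le (@subsetT _ A)))// -lee_fin -nuE. Qed.
Let v0 : v set0 = 0.
Proof.
have := @v_superadd set0 set0 measurable0 measurable0 (set0I _).
rewrite setU0 => h; apply/eqP; rewrite eq_le v_ge0 andbT.
by rewrite -subr_ge0 opprD addNKr oppr_ge0 in h.
Qed.

(** The measurability of the union belongs to the induction because [nu_superadd] asks for it at
    each step. *)
Let sum_fibers (k : {nnsfun T >-> R}) (P : pred R) (s : seq R) : uniq s ->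
  measurable (k @^-1` [set x | x \in s /\ P x]) /\
  \sum_(x <- s | P x) v (k @^-1` [set x]) <= v (k @^-1` [set x | x \in s /\ P x]).
Proof.
elim: s => [_|x s IH /= /andP[xs us]].
  have -> : k @^-1` [set x | x \in [::] /\ P x] = set0.
    by rewrite -subset0 => t [].
  by split; [exact: measurable0|rewrite big_nil v0].
have [mS hS] := IH us.
rewrite big_cons; case: ifPn => Px.
  have -> : k @^-1` [set x0 | x0 \in x :: s /\ P x0] =
      k @^-1` [set x] `|` k @^-1` [set x | x \in s /\ P x].
    apply/seteqP; split => t /=.
      by rewrite inE => -[/orP[/eqP ->|ts] Pt]; [left|right; split].
    by case=> [->|[ts Pt]]; split; rewrite // inE ?eqxx// ts orbT.
  have mx : measurable (k @^-1` [set x]) by exact: measurable_funPTI.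
  split; first exact: measurableU.
  apply: (le_trans _ (v_superadd mx mS _)); first exact: lerD.
  rewrite -subset0 => t [/= tx [ts _]].
  by move: xs; rewrite -tx ts.
have -> : k @^-1` [set x0 | x0 \in x :: s /\ P x0] =
    k @^-1` [set x | x \in s /\ P x].
  apply/seteqP; split => t /=.
    rewrite inE => -[/orP[/eqP tx Pt|ts Pt]]; last by split.
    by rewrite -tx Pt in Px.
  by move=> [ts Pt]; split; rewrite // inE ts orbT.
by [].
Qed.

(** Values above [c] are taken outside [B], hence on a set of mass [S2] at most [1 - v B]. The total
    mass being at most 1, the integral is at most [c (1 - S2) + M S2]. *)
Let sintegral_le (k : {nnsfun T >-> R}) (M c : R) (B : set T) :
  measurable B -> 0 <= c -> c <= M -> (forall x, k x <= M) ->
  (forall x, B x -> k x <= c) ->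
  (sintegral nu k <= (M - (M - c) * v B)%:E)%E.
Proof.
move=> mB c0 cM kM kc.
have -> : sintegral nu k =
    (\sum_(x <- finmap.enum_fset (fset_set (range k))) x * v (k @^-1` [set x]))%:E.
  rewrite /sintegral -(fsbig_widen (range k) setT)//=; last first.
    by move=> x [_ Nfx] /=; rewrite preimage10// nuE v0 mule0.
  by rewrite fsbig_finite//= -sumEFin; apply: eq_bigr => x _; rewrite nuE.
rewrite lee_fin.
set s := finmap.enum_fset _.
have us : uniq s by exact: finmap.fset_uniq.
set S1 := \sum_(x <- s | x <= c) v (k @^-1` [set x]).
set S2 := \sum_(x <- s | ~~ (x <= c)) v (k @^-1` [set x]).
have S12 : S1 + S2 <= 1.
  have [_ h] := @sum_fibers k predT s us.
  by move: h; rewrite (bigID (fun x => x <= c))/= => h; exact: le_trans h (vT _).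
have S2B : S2 <= 1 - v B.
  have [mS h] := @sum_fibers k (fun x => ~~ (x <= c)) s us.
  rewrite lerBrDr; apply: le_trans (_ : v _ + v B <= _); first by apply: lerD h _.
  apply: (le_trans (v_superadd mS mB _) (vT _)).
  rewrite -subset0 => t [/= [_ /negP tc] Bt].
  exact: tc (kc _ Bt).
have S20 : 0 <= S2 by exact: sumr_ge0.
have : \sum_(x <- s) x * v (k @^-1` [set x]) <= c * S1 + M * S2.
  rewrite (bigID (fun x => x <= c))/= /S1 /S2 !mulr_sumr lerD//.
    by apply: ler_sum => x xc; rewrite ler_wpM2r.
  rewrite big_seq_cond [leRHS]big_seq_cond.
  apply: ler_sum => x /andP[xs _]; rewrite ler_wpM2r//.
  by move: xs; rewrite /s in_fset_set//; first by move=> /set_mem[t _ <-].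
move=> /le_trans; apply.
have S1c : c * S1 <= c * (1 - S2) by rewrite ler_wpM2l// lerBrDr.
have : (M - c) * S2 <= (M - c) * (1 - v B) by rewrite ler_wpM2l// subr_ge0.
lra.
Qed.

Let fiber_ge0 (h : {nnsfun T >-> R}) (x : R) :
  (0 <= x%:E * nu (h @^-1` [set x]))%E.
Proof.
have [x0|x0] := leP 0 x; first by rewrite mule_ge0.
rewrite preimage10 ?nuE ?v0 ?mule0// => -[t _ tx].
by move: x0; rewrite -tx ltNge fun_ge0.
Qed.

Let sintegral_indic_ge (B : set T) (c : R) (mB : measurable B) : 0 <= c ->
  exists2 h : {nnsfun T >-> R}, (forall x, h x = c * \1_B x) &
    ((c * v B)%:E <= sintegral nu h)%E.
Proof.
move=> c0.
have [->|cn0] := eqVneq c 0.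
  exists nnsfun0; first by move=> x /=; rewrite mul0r.
  rewrite mul0r; apply: fsume_ge0 => x _; exact: (fiber_ge0 nnsfun0).
have [h hE] : exists h : {nnsfun T >-> R}, forall t, h t = c * \1_B t.
  by exists (scale_nnsfun (indic_nnsfun R mB) c0).
exists h => //.
rewrite /sintegral -(fsbig_widen (range h) setT)//=; last first.
  by move=> x [_ Nfx] /=; rewrite preimage10// nuE v0 mule0.
have BE : B = h @^-1` [set c].
  apply/seteqP; split => t /=; rewrite hE indicE.
    by move=> Bt; rewrite mem_set// mulr1.
  have [/set_mem//|_] := boolP (t \in B).
  by rewrite mulr0 => c0'; rewrite -c0' eqxx in cn0.
rewrite [in leLHS]BE; have [hc|hc] := pselect (range h c); last first.
  rewrite preimage10// v0 mulr0; apply: fsume_ge0 => x _.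
  exact: fiber_ge0.
rewrite (fsbigD1 c)//= nuE -[leLHS]adde0; apply: leeD => //.
by apply: fsume_ge0 => x _; exact: fiber_ge0.
Qed.

(* A function bounded by M satisfies nu A <= 2M/(2M+eps), which already beats
   exp(-eps^2/8M^2) for eps <= 2M, and A is empty for eps > 2M.  In the application
   F is not known to be measurable, whence the recourse to lower integrals. *)
Lemma bounded_tail (Omega : set T) (F : T -> R) (M eps mean : R) :
  0 < M -> 0 < eps -> (forall x, Omega x -> `|F x| <= M) ->
  mean = fine (\int[nu]_(x in Omega) (F x)%:E)%E ->
  (nu [set x | Omega x /\ (eps < F x - mean)%R] <=
    (expR (- (8 * M ^+ 2)^-1 * eps ^+ 2))%:E)%E.
Proof.
move=> M0 e0 FM mean_def.
set G := ((fun x => (F x)%:E) \_ Omega)%E.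
have GE x : G x = (if x \in Omega then F x else 0)%:E.
  by rewrite /G /patch; case: ifP.
have Gp x : (G^\+ x)%E = (if x \in Omega then Num.max (F x) 0 else 0)%:E.
  by rewrite funeposE GE; case: ifP => _; rewrite -EFin_max// maxxx.
have Gn x : (G^\- x)%E = (if x \in Omega then Num.max (- F x) 0 else 0)%:E.
  by rewrite funenegE GE; case: ifP => _; rewrite -EFinN -EFin_max// oppr0 maxxx.
have L0 f : (forall x, 0 <= f x)%E -> (0 <= lower_integral nu f)%E.
  move=> f0; have [h hE hge] := sintegral_indic_ge measurable0 (lexx 0).
  apply: le_trans (_ : sintegral nu h <= _)%E; first by rewrite mul0r in hge.
  by apply: ereal_sup_ubound; exists h => //= x; rewrite hE mul0r.
have Lup f (c : R) B : measurable B -> 0 <= c -> c <= M -> (forall x, f x <= M%:E)%E ->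
    (forall x, B x -> f x <= c%:E)%E ->
    (lower_integral nu f <= (M - (M - c) * v B)%:E)%E.
  move=> mB c0 cM fM fc; apply: ge_ereal_sup => _ [h hf <-].
  apply: sintegral_le => // x.
    by rewrite -lee_fin; exact: le_trans (hf x) (fM x).
  by move=> Bx; rewrite -lee_fin; exact: le_trans (hf x) (fc x Bx).
have GpM x : (G^\+ x <= M%:E)%E.
  rewrite Gp lee_fin; case: ifP => [/set_mem Ox|_]; last exact: ltW.
  by rewrite ge_max (ltW M0) andbT (le_trans (ler_norm _))// FM.
have GnM x : (G^\- x <= M%:E)%E.
  rewrite Gn lee_fin; case: ifP => [/set_mem Ox|_]; last exact: ltW.
  by rewrite ge_max (ltW M0) andbT (le_trans (ler_norm _))// normrN FM.
have Gp0 x : (0 <= G^\+ x)%E by exact: funepos_ge0.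
have Gn0 x : (0 <= G^\- x)%E by exact: funeneg_ge0.
have Lfin f : (forall x, 0 <= f x)%E -> (forall x, f x <= M%:E)%E ->
    lower_integral nu f \is a fin_num.
  move=> f0 fM; rewrite ge0_fin_numE ?L0//.
  apply: (le_lt_trans (Lup f M set0 measurable0 (ltW M0) (lexx _) fM _)) => //.
  exact: ltry.
have [Ip IpE] : exists Ip : R, lower_integral nu G^\+%E = Ip%:E.
  by exists (fine (lower_integral nu G^\+%E)); rewrite fineK ?Lfin.
have [In InE] : exists In : R, lower_integral nu G^\-%E = In%:E.
  by exists (fine (lower_integral nu G^\-%E)); rewrite fineK ?Lfin.
have meanE : mean = Ip - In by rewrite mean_def integral_lower IpE InE.
have Ip0 : 0 <= Ip by rewrite -lee_fin -IpE L0.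
have In0 : 0 <= In by rewrite -lee_fin -InE L0.
have mean_le : mean <= M.
  have : Ip <= M.
    rewrite -lee_fin -IpE.
    apply: le_trans (Lup _ M set0 measurable0 (ltW M0) (lexx _) GpM _) _ => //.
    by rewrite lee_fin subrr mul0r subr0.
  by rewrite meanE; lra.
have mean_ge : - M <= mean.
  have : In <= M.
    rewrite -lee_fin -InE.
    apply: le_trans (Lup _ M set0 measurable0 (ltW M0) (lexx _) GnM _) _ => //.
    by rewrite lee_fin subrr mul0r subr0.
  by rewrite meanE; lra.
set A := [set x | _].
(* The slack [dl] turns the negated goal into a strict inequality between a real number and [nu A],
   as inner approximation requires. *)
apply/lee_addgt0Pr => dl dl0.
rewrite leNgt; apply/negP => hlt.
have [B [mB BA]] : exists B, [/\ measurable B, B `<=` A &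
   ((expR (- (8 * M ^+ 2)^-1 * eps ^+ 2) + dl)%:E < nu B)%E] by exact: nu_inner.
rewrite nuE lte_fin => hB.
set b := v B in hB.
have b1 : b <= 1 by exact: vT.
have b0 : 0 < b by apply: lt_trans hB; rewrite addr_gt0 ?expR_gt0.
have [x0 Bx0] : exists x, B x.
  apply: contrapT => /forallNP nB; have : B = set0 by rewrite -subset0 => x /nB.
  by move=> B0; rewrite /b B0 v0 ltxx in b0.
have BF x : B x -> mean + eps <= F x.
  by move=> /BA [_]; rewrite ltrBrDl => /ltW.
have mM : mean + eps <= M.
  apply: (le_trans (BF _ Bx0)); apply: (le_trans (ler_norm _)).
  by apply: FM; have [] := BA _ Bx0.
(* [F] is at least [mean + eps] on [B] and at least [-M] elsewhere. The lower integral is not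
   additive, so the positive part is bounded from below and the negative part from above,
   separately. *)
have key : b * (mean + eps) - (1 - b) * M <= mean.
  have Ipge : Num.max (mean + eps) 0 * b <= Ip.
    have c0 : 0 <= Num.max (mean + eps) 0 by rewrite le_max lexx orbT.
    have [h hE hge] := sintegral_indic_ge mB c0.
    rewrite -lee_fin -IpE; apply: (le_trans hge).
    apply: ereal_sup_ubound; exists h => //= x.
    rewrite hE Gp indicE lee_fin.
    have [/set_mem Bx|_] := boolP (x \in B); last first.
      by rewrite mulr0; case: ifP => // _; rewrite le_max lexx orbT.
    have [Ox _] := BA _ Bx.
    by rewrite mem_set// mulr1 ge_max !le_max lexx orbT andbT BF.
  have Inle : In <= M - (M - Num.max (- (mean + eps)) 0) * b.
    have Bn x : B x -> (G^\- x <= (Num.max (- (mean + eps)) 0)%:E)%E.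
      move=> Bx; have [Ox _] := BA _ Bx.
      by rewrite Gn mem_set// lee_fin ge_max !le_max lexx orbT andbT lerN2 BF.
    rewrite -lee_fin -InE; apply: (Lup) => //; first by rewrite le_max lexx orbT.
    rewrite ge_max (ltW M0) andbT.
    have [/set_mem Bx|] := boolP (x0 \in B); last by rewrite mem_set.
    have [mean0|mean0] := leP 0 (mean + eps); first lra.
    lra.
  rewrite [X in _ <= X]meanE.
  move: Ipge Inle; have [h|] := boolP (0 <= mean + eps).
    rewrite (max_idPl h) (max_idPr _); last by rewrite oppr_le0.
    lra.
  rewrite -ltNge => h; rewrite (max_idPr (ltW h)) (max_idPl _); last by rewrite oppr_ge0 ltW.
  lra.
(* [key] says [b (mean + M + eps) <= mean + M]; since [b <= 1], the factor [mean + M] may be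
   increased to [2 M]. *)
have key2 : b * (eps + 2 * M) <= 2 * M by nra.
have key3 : eps <= 2 * M by lra.
(* In this scale [b <= 1 / (1 + y)] with [0 < y <= 1], and the exponent is [- y^2 / 2]; this is the
   origin of the 8. The contradiction is [(1 - y^2 / 2) (1 + y) >= 1]. *)
pose y := eps / (2 * M).
have yE : eps = 2 * M * y by rewrite /y; field; lra.
have y0 : 0 < y by rewrite /y divr_gt0//; lra.
have y1 : y <= 1 by rewrite /y ler_pdivrMr; lra.
have expE : - (8 * M ^+ 2)^-1 * eps ^+ 2 = - (y ^+ 2 / 2).
  by rewrite yE; field; lra.
move: hB; rewrite expE.
have := expR_ge1Dx (- (y ^+ 2 / 2)).
set E := expR _ => hE hB.
have hb : b * (1 + y) <= 1.
  rewrite -(@ler_pM2r _ (2 * M)); last lra.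
  rewrite mul1r; apply: le_trans key2; rewrite yE.
  by rewrite le_eqVlt; apply/orP; left; apply/eqP; ring.
have hE1 : 1 <= E * (1 + y).
  apply: le_trans (_ : (1 - y ^+ 2 / 2) * (1 + y) <= _).
    have -> : (1 - y ^+ 2 / 2) * (1 + y) = 1 + y * (1 - y / 2 - y ^+ 2 / 2) by field.
    have y2 : y ^+ 2 <= 1 by rewrite expr_le1// ltW.
    by rewrite lerDl; apply: mulr_ge0; [exact: ltW|lra].
  rewrite ler_wpM2r//; lra.
have Eb : E < b by apply: lt_trans hB; rewrite ltrDl.
have Eby : E * (1 + y) < b * (1 + y) by rewrite ltr_pM2r// addr_gt0.
by have := le_lt_trans hE1 (lt_le_trans Eby hb); rewrite ltxx.
Qed.

End inner_superadditive.

(** * Normalized densities *)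

Section weighted_measure.
Context d (T : measurableType d) (R : realType) (mu : {measure set T -> \bar R}).
Variable w : T -> R.
Hypothesis w_ge0 : forall x, 0 <= w x.
Import HBNNSimple.

Let nu (A : set T) : \bar R :=
  ((fine (\int[mu]_x (w x)%:E))^-1%:E * \int[mu]_(x in A) (w x)%:E)%E.

Let W A : T -> \bar R := ((fun x => (w x)%:E) \_ A)%E.

Let W_ge0 A x : (0 <= W A x)%E.
Proof. by rewrite /W /patch; case: ifP => _; rewrite ?lee_fin. Qed.

Let nuE A : nu A =
  ((fine (\int[mu]_x (w x)%:E))^-1%:E * lower_integral mu (W A))%E.
Proof.
by rewrite /nu /W; congr (_ * _)%E; rewrite ge0_integralE// => x _; rewrite lee_fin.
Qed.

Let z_ge0 : 0 <= (fine (\int[mu]_x (w x)%:E))^-1.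
Proof. by rewrite invr_ge0 fine_ge0// integral_ge0// => x _; rewrite lee_fin. Qed.

Lemma weighted_bounded_tail (Omega : set T) (F : T -> R) (M eps mean : R) :
  0 < M -> 0 < eps -> (forall x, Omega x -> `|F x| <= M) ->
  mean = fine (\int[nu]_(x in Omega) (F x)%:E)%E ->
  (nu [set x | Omega x /\ (eps < F x - mean)%R] <=
    (expR (- (8 * M ^+ 2)^-1 * eps ^+ 2))%:E)%E.
Proof.
apply: bounded_tail.
- by move=> A; apply: mule_ge0; rewrite ?lee_fin// integral_ge0// => x _; rewrite lee_fin.
- move=> A B AB; rewrite !nuE lee_wpmul2l ?lee_fin//.
  apply: le_lower_integral => x; rewrite /W /patch.
  case: ifPn => [/set_mem/AB Bx|_]; first by rewrite mem_set.
  by case: ifP => _; rewrite lee_fin.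
- rewrite /nu; set I := (\int[mu]_x _)%E.
  have I0 : (0 <= I)%E by apply: integral_ge0 => x _; rewrite lee_fin.
  (* An infinite total mass is sent to 0 by [fine], and the inverse of 0 is 0, so [nu] vanishes;
     likewise below for total mass 0. *)
  have [->|Iy] := eqVneq I +oo%E; first by rewrite /= invr0 mul0e lee_fin ler01.
  have If : I \is a fin_num by rewrite ge0_fin_numE// ltey.
  rewrite -[X in (_ * X)%E](fineK If) -EFinM lee_fin.
  have [->|z0] := eqVneq (fine I) 0; first by rewrite mulr0 ler01.
  by rewrite mulVf.
- move=> A B mA mB AB; rewrite !nuE -ge0_muleDr; last 2 first.
  - by apply: le_trans (le_lower_integral mu (W_ge0 A)); apply: ereal_sup_ubound;
      exists nnsfun0 => //; exact: sintegral0.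
  - by apply: le_trans (le_lower_integral mu (W_ge0 B)); apply: ereal_sup_ubound;
      exists nnsfun0 => //; exact: sintegral0.
  rewrite lee_wpmul2l ?lee_fin//; apply: lower_integral_superadd => // x.
  rewrite /W /patch in_setU.
  have [/set_mem Ax|_] := boolP (x \in A).
    have [/set_mem Bx|_] /= := boolP (x \in B); last by rewrite adde0.
    by have : (A `&` B) x by []; rewrite AB.
  by rewrite /= add0e.
- move=> A x; rewrite nuE.
  set z := (fine _)^-1; have z0 : 0 <= z by exact: z_ge0.
  have [x0|x0] := ltP x 0.
    move=> _; exists set0; split => //.
    apply: lt_le_trans (_ : 0 <= _)%E; first by rewrite lte_fin.
    by apply: mule_ge0; rewrite ?lee_fin// integral_ge0// => y _; rewrite lee_fin.
  move: z0; rewrite le_eqVlt => /predU1P[<-|z0].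
    by rewrite mul0e lte_fin ltNge x0.
  rewrite muleC -lte_pdivrMr// => /ereal_sup_gt[_ [h hW <-] xh].
  (* The positivity set of a simple function [h] below the weight on [A] is measurable, lies in [A],
     and still carries all of [h]. *)
  exists (h @^-1` [set r | 0 < r]); split.
  - by apply: measurable_funPTI => //; rewrite -set_itvoy; exact: measurable_itv.
  - move=> y /= hy; apply: contrapT => Ay; have := hW y.
    by rewrite /W /patch memNset// lee_fin leNgt hy.
  - rewrite nuE -/z muleC -lte_pdivrMr//; apply: (lt_le_trans xh).
    apply: ereal_sup_ubound; exists h => // y.
    rewrite /W /patch; have [/set_mem/= hy|hy] := boolP (y \in _).
      apply: (le_trans (hW y)); rewrite /W /patch.
      by case: ifP => _; rewrite lee_fin.
    rewrite lee_fin leNgt; apply/negP => hy'.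
    by rewrite mem_set in hy.
Qed.

End weighted_measure.

(** * Complex differentiation and Phragmen-Lindeloef *)

Section complex_modulus.
Variable R : realType.
Implicit Types z w : R[i].

Lemma complex_surj z : exists x y : R, z = (x +i* y)%C.
Proof. by case: z => x y; exists x, y. Qed.

Lemma nc_complex (x y : R) : nc (x +i* y)%C = Num.sqrt (x ^+ 2 + y ^+ 2).
Proof. by []. Qed.

Lemma nc_ge0 z : 0 <= nc z.
Proof. by case: z => x y; rewrite nc_complex sqrtr_ge0. Qed.

Lemma nc0 : nc (0 : R[i]) = 0. Proof. exact: ComplexField.Normc.normc0. Qed.
Lemma nc1 : nc (1 : R[i]) = 1. Proof. exact: ComplexField.Normc.normc1. Qed.

Lemma nc_eq0 z : (nc z == 0) = (z == 0).
Proof.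
apply/eqP/eqP => [|->]; [exact: ComplexField.Normc.eq0_normc|exact: nc0].
Qed.

Lemma nc_gt0 z : (0 < nc z) = (z != 0).
Proof. by rewrite lt_def nc_ge0 andbT nc_eq0. Qed.

Lemma ncM z w : nc (z * w) = nc z * nc w.
Proof. exact: ComplexField.Normc.normcM. Qed.

Lemma ncV z : nc z^-1 = (nc z)^-1.
Proof. exact: ComplexField.Normc.normcV. Qed.

Lemma ncX z n : nc (z ^+ n) = nc z ^+ n.
Proof. by elim: n => [|n IH]; rewrite ?expr0 ?nc1// !exprS ncM IH. Qed.

Lemma ncN z : nc (- z) = nc z. Proof. exact: normcN. Qed.
Lemma ncD z w : nc (z + w) <= nc z + nc w. Proof. exact: le_normcD. Qed.
Lemma ncB z w : nc (z - w) <= nc z + nc w.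
Proof. by rewrite -(ncN w) ncD. Qed.
Lemma ncBC z w : nc (z - w) = nc (w - z).
Proof. by rewrite -ncN opprB. Qed.

Lemma ler_ncB z w : nc z - nc w <= nc (z - w).
Proof. by rewrite lerBlDr -{1}(subrK w z) ncD. Qed.

Lemma ncR (x : R) : nc x%:C%C = `|x|.
Proof. by rewrite nc_complex expr0n addr0 sqrtr_sqr. Qed.

Lemma nc_i : nc ('i%C : R[i]) = 1.
Proof. by rewrite nc_complex expr0n expr1n add0r sqrtr1. Qed.

Lemma nc_Re z : `|Re z| <= nc z.
Proof.
case: z => x y; rewrite nc_complex -sqrtr_sqr ler_sqrt ?addr_ge0 ?sqr_ge0//.
by rewrite lerDl sqr_ge0.
Qed.

Lemma nc_Im z : `|Im z| <= nc z.
Proof.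
case: z => x y; rewrite nc_complex -sqrtr_sqr ler_sqrt ?addr_ge0 ?sqr_ge0//.
by rewrite lerDr sqr_ge0.
Qed.

Lemma nc_le z : nc z <= `|Re z| + `|Im z|.
Proof.
case: z => x y /=.
rewrite -[leRHS]ger0_norm ?addr_ge0// -sqrtr_sqr ler_sqrt ?sqr_ge0//.
by rewrite sqrrD !real_normK ?num_real// lerD2r lerDl mulrn_wge0// mulr_ge0.
Qed.

Lemma nc_sqr z : nc z ^+ 2 = Re z ^+ 2 + Im z ^+ 2.
Proof. by case: z => x y; rewrite nc_complex sqr_sqrtr// addr_ge0 ?sqr_ge0. Qed.

Lemma cRM (x y : R) : (x * y)%:C%C = x%:C%C * y%:C%C.
Proof. exact: rmorphM. Qed.
Lemma cRD (x y : R) : (x + y)%:C%C = x%:C%C + y%:C%C.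
Proof. exact: rmorphD. Qed.
Lemma cRB (x y : R) : (x - y)%:C%C = x%:C%C - y%:C%C.
Proof. exact: rmorphB. Qed.

Lemma complex_split (x y : R) : (x +i* y)%C = x%:C%C + 'i%C * y%:C%C.
Proof. exact: (complexE (x +i* y)%C). Qed.

Lemma ReD z w : Re (z + w) = Re z + Re w. Proof. by case: z; case: w. Qed.
Lemma ImD z w : Im (z + w) = Im z + Im w. Proof. by case: z; case: w. Qed.
Lemma ReN z : Re (- z) = - Re z. Proof. by case: z. Qed.
Lemma ImN z : Im (- z) = - Im z. Proof. by case: z. Qed.

End complex_modulus.

(** * Complex derivatives *)

Section complex_derivative.
Variable R : realType.
Implicit Types (f g phi : R[i] -> R[i]) (z w d : R[i]).

Definition ccont f z := forall e : R, 0 < e -> exists2 r : R, 0 < r &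
  forall w, nc (w - z) < r -> nc (f w - f z) <= e.

Lemma ccont_cst d z : ccont (fun=> d) z.
Proof. by move=> e e0; exists 1 => // w _; rewrite subrr nc0 ltW. Qed.

Lemma ccont_id z : ccont id z.
Proof. by move=> e e0; exists e => // w /ltW. Qed.

Lemma ccontD f g z : ccont f z -> ccont g z -> ccont (fun w => f w + g w) z.
Proof.
move=> cf cg e e0; have e20 : 0 < e / 2 by rewrite divr_gt0.
have [r r0 hr] := cf _ e20; have [s s0 hs] := cg _ e20.
exists (Num.min r s) => [|w]; first by rewrite lt_min r0.
rewrite lt_min => /andP[/hr wr /hs ws].
rewrite opprD addrACA (le_trans (ncD _ _))// [leRHS]splitr lerD//.
Qed.

Lemma ccont_bounded f z : ccont f z -> exists M : R, exists2 r : R, 0 < r &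
  0 < M /\ forall w, nc (w - z) < r -> nc (f w) <= M.
Proof.
move=> /(_ _ ltr01)[r r0 hr]; exists (nc (f z) + 1), r => //.
split; first by rewrite ltr_wpDl ?nc_ge0.
move=> w /hr h; rewrite -(subrK (f z) (f w)).
by rewrite (le_trans (ncD _ _))// addrC lerD2l.
Qed.

Lemma ccontM f g z : ccont f z -> ccont g z -> ccont (fun w => f w * g w) z.
Proof.
move=> cf cg e e0; have [M [r0 r00 [M0 hM]]] := ccont_bounded cf.
set K := nc (g z) + 1; have K0 : 0 < K by rewrite ltr_wpDl ?nc_ge0.
have [r r1 hr] := cf _ (divr_gt0 (divr_gt0 e0 (ltr0n _ 2)) K0).
have [s s0 hs] := cg _ (divr_gt0 (divr_gt0 e0 (ltr0n _ 2)) M0).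
exists (Num.min r0 (Num.min r s)) => [|w]; first by rewrite !lt_min r00 r1.
rewrite !lt_min => /and3P[/hM wM /hr wr /hs ws].
have -> : f w * g w - f z * g z = f w * (g w - g z) + (f w - f z) * g z by ring.
rewrite (le_trans (ncD _ _))// !ncM [leRHS]splitr lerD//.
  apply: le_trans (_ : M * (e / 2 / M) <= _).
    by rewrite ler_pM ?nc_ge0.
  by rewrite mulrC divfK ?gt_eqF.
apply: le_trans (_ : (e / 2 / K) * K <= _).
  by rewrite ler_pM ?nc_ge0// lerDl.
by rewrite divfK ?gt_eqF.
Qed.

Lemma ccont_comp f g z : ccont g z -> ccont f (g z) -> ccont (fun w => f (g w)) z.
Proof.
move=> cg cf e /cf[r r0 hr]; have r20 : 0 < r / 2 by rewrite divr_gt0.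
have [s s0 hs] := cg _ r20.
exists s => // w /hs h; apply: hr; apply: le_lt_trans h _.
by rewrite ltr_pdivrMr// ltr_pMr// ltr1n.
Qed.

Lemma ccont_inv z : z != 0 -> ccont (fun w => w^-1) z.
Proof.
move=> z0 e e0; have nz : 0 < nc z by rewrite nc_gt0.
have r0 : 0 < nc z / 2 by rewrite divr_gt0.
have s0 : 0 < e * (nc z ^+ 2 / 2) by rewrite !mulr_gt0.
exists (Num.min (nc z / 2) (e * (nc z ^+ 2 / 2))) => [|w].
  by rewrite lt_min r0.
rewrite lt_min => /andP[h1 h2].
have nw : nc z / 2 <= nc w.
  by have := ler_ncB z w; rewrite ncBC; lra.
have w0 : w != 0 by rewrite -nc_gt0; apply: lt_le_trans nw.
have -> : w^-1 - z^-1 = (z - w) * (w^-1 * z^-1) by field; rewrite w0 z0.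
rewrite !ncM !ncV ncBC.
apply: le_trans (_ : (e * (nc z ^+ 2 / 2)) * ((nc z / 2)^-1 * (nc z)^-1) <= _).
  apply: ler_pM; rewrite ?nc_ge0 ?mulr_ge0 ?invr_ge0 ?nc_ge0 ?(ltW h2)//.
  rewrite ler_wpM2r ?invr_ge0 ?nc_ge0// lef_pV2// posrE//.
  exact: lt_le_trans nw.
rewrite [leLHS](_ : _ = e)//; field; exact: lt0r_neq0.
Qed.

(** Caratheodory's form of the derivative: with a continuous slope function, the product and chain
    rules reduce to algebraic identities. *)
Definition cdiff f z d := exists phi : R[i] -> R[i],
  [/\ ccont phi z, phi z = d & forall w, f w = f z + phi w * (w - z)].

Lemma cdiffP f z d : cdiff f z d <-> forall e : R, 0 < e -> exists2 r : R, 0 < r &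
  forall w, nc (w - z) < r -> nc (f w - f z - d * (w - z)) <= e * nc (w - z).
Proof.
split=> [[phi [cphi <- fE]] e e0|h].
  have [r r0 hr] := cphi _ e0; exists r => // w /hr.
  rewrite fE [_ + _ * _ - _]addrC addKr -mulrBl ncM => h.
  by rewrite ler_wpM2r ?nc_ge0.
exists (fun w => if w == z then d else (f w - f z) / (w - z)); split.
- move=> e e0; have [r r0 hr] := h _ e0; exists r => // w wr.
  rewrite eqxx; case: eqVneq => [_|wz]; first by rewrite subrr nc0 ltW.
  have wz0 : w - z != 0 by rewrite subr_eq0.
  have -> : (f w - f z) / (w - z) - d = (f w - f z - d * (w - z)) / (w - z).
    by field.
  by rewrite ncM ncV ler_pdivrMr ?nc_gt0// hr.
- by rewrite eqxx.
- move=> w; case: eqVneq => [->|wz]; first by rewrite subrr mulr0 addr0.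
  by rewrite divfK ?subr_eq0// addrC subrK.
Qed.

Lemma cdiff_ccont f z d : cdiff f z d -> ccont f z.
Proof.
case=> phi [cphi _ fE].
have -> : f = (fun w => f z + phi w * (w - z)) by apply/funext => w; exact: fE.
apply: ccontD; first exact: ccont_cst.
apply: ccontM => //; apply: ccontD; [exact: ccont_id|exact: ccont_cst].
Qed.

Lemma cdiff_cst a z : cdiff (fun=> a) z 0.
Proof.
exists (fun=> 0); split; [exact: ccont_cst|by []|].
by move=> w; rewrite mul0r addr0.
Qed.

Lemma cdiff_id z : cdiff id z 1.
Proof.
exists (fun=> 1); split; [exact: ccont_cst|by []|].
by move=> w; rewrite mul1r addrC subrK.
Qed.

Lemma cdiffD f g z d e : cdiff f z d -> cdiff g z e ->
  cdiff (fun w => f w + g w) z (d + e).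
Proof.
move=> [p [cp <- fE]] [q [cq <- gE]]; exists (fun w => p w + q w).
by split; [exact: ccontD|by []|move=> w; rewrite fE gE; ring].
Qed.

Lemma cdiffM f g z d e : cdiff f z d -> cdiff g z e ->
  cdiff (fun w => f w * g w) z (d * g z + f z * e).
Proof.
move=> df dg; have cg := cdiff_ccont dg; have cf := cdiff_ccont df.
move: df dg => [p [cp <- fE]] [q [cq <- gE]].
exists (fun w => p w * g w + f z * q w); split=> //.
  by apply: ccontD; apply: ccontM => //; exact: ccont_cst.
by move=> w; rewrite [in LHS]fE mulrDl (gE w); ring.
Qed.

Lemma cdiff_comp f g z d e : cdiff g z e -> cdiff f (g z) d ->
  cdiff (fun w => f (g w)) z (d * e).
Proof.
move=> dg; have cg := cdiff_ccont dg; move: dg => [q [cq <- gE]] [p [cp <- fE]].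
exists (fun w => p (g w) * q w); split=> //.
  by apply: ccontM => //; apply: ccont_comp.
by move=> w; rewrite [in LHS]fE (_ : g w - g z = q w * (w - z)) ?mulrA// gE; ring.
Qed.

Lemma cdiff_inv z : z != 0 -> cdiff (fun w => w^-1) z (- z ^- 2).
Proof.
(* The inverse of 0 is 0 by convention, so the slope identity at [w = 0] forces the value
   [z ^- 2]. *)
move=> z0; exists (fun w => if w == 0 then z ^- 2 else - (w^-1 * z^-1)); split.
- have c : ccont (fun w => - (w^-1 * z^-1)) z.
    have -> : (fun w => - (w^-1 * z^-1)) = (fun w => w^-1 * - z^-1).
      by apply/funext => w; rewrite mulrN.
    by apply: ccontM; [exact: ccont_inv|exact: ccont_cst].
  move=> e /c[r r0 hr]; exists (Num.min r (nc z)) => [|w].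
    by rewrite lt_min r0 nc_gt0.
  rewrite lt_min (negPf z0) => /andP[wr wz]; case: eqVneq => [w0|_]; last exact: hr.
  by move: wz; rewrite w0 sub0r ncN ltxx.
- by rewrite (negPf z0) expr2 invfM.
- move=> w; case: eqVneq => [->|w0]; last by field; rewrite ?w0 ?z0.
  by rewrite invr0; field.
Qed.

End complex_derivative.

(** * Functions of a real parameter and their primitives *)

Section real_parameter.
Variable R : realType.

Lemma is_deriveP (f : R -> R) (x d : R) : is_derive x 1 f d <->
  forall e : R, 0 < e -> exists2 r : R, 0 < r &
    forall h, `|h| < r -> `|f (x + h) - f x - d * h| <= e * `|h|.
Proof.
split=> [[df dE] e e0|hf].
  have /cvgrPdist_le/(_ e e0) := df.
  rewrite -/('D_1 f x) dE => -[r /= r0 hr]; exists r => // h hh.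
  have [->|h0] := eqVneq h 0; first by rewrite addr0 subrr mulr0 subr0 normr0 mulr0.
  have := hr h; rewrite /= sub0r normrN => /(_ hh h0).
  rewrite [h *: 1]mulr1 [_ *: _]mulrC => hle.
  have -> : f (x + h) - f x - d * h = - (d - (f (h + x) - f x) / h) * h.
    by rewrite [h + x]addrC; field.
  by rewrite normrM normrN ler_wpM2r.
have cv : (fun h => h^-1 *: ((f \o shift x) (h *: 1) - f x)) @ 0^' --> d.
  apply/cvgrPdist_le => e e0; have [r r0 hr] := hf _ e0.
  exists r => //= h. rewrite /= sub0r normrN => hh h0.
  rewrite [h *: 1]mulr1 [_ *: _]mulrC /=.
  have -> : d - (f (h + x) - f x) / h = - (f (x + h) - f x - d * h) / h.
    by rewrite [h + x]addrC; field.
  by rewrite normrM normrN normfV ler_pdivrMr ?normr_gt0// hr.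
by split; [apply/cvg_ex; exists d|apply/cvg_lim].
Qed.

Lemma continuous_is_derive (f df : R -> R) :
  (forall x : R, is_derive x 1 f (df x)) -> continuous f.
Proof.
move=> dfx x; apply/differentiable_continuous/derivable1_diffP.
exact: (@ex_derive _ _ _ _ _ _ _ (dfx x)).
Qed.

Lemma ReMr (z : R[i]) (h : R) : Re (z * h%:C%C) = Re z * h.
Proof. by case: z => a b; rewrite /= mulr0 subr0. Qed.

Lemma ImMr (z : R[i]) (h : R) : Im (z * h%:C%C) = Im z * h.
Proof. by case: z => a b; rewrite /= mulr0 add0r. Qed.

Definition rdiff (F : R -> R[i]) (x : R) (d : R[i]) :=
  forall e : R, 0 < e -> exists2 r : R, 0 < r &
    forall h, `|h| < r -> nc (F (x + h) - F x - d * h%:C%C) <= e * `|h|.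

Lemma rdiff_Re (F : R -> R[i]) x d : rdiff F x d ->
  is_derive x 1 (fun t => Re (F t)) (Re d).
Proof.
move=> hF; apply/is_deriveP => e /hF[r r0 hr]; exists r => // h /hr.
apply: le_trans; apply: le_trans (nc_Re _).
by rewrite !ReD !ReN ReMr.
Qed.

Lemma rdiff_Im (F : R -> R[i]) x d : rdiff F x d ->
  is_derive x 1 (fun t => Im (F t)) (Im d).
Proof.
move=> hF; apply/is_deriveP => e /hF[r r0 hr]; exists r => // h /hr.
apply: le_trans; apply: le_trans (nc_Im _).
by rewrite !ImD !ImN ImMr.
Qed.

Lemma rdiff_pair (F : R -> R[i]) (x : R) (d : R[i]) : is_derive x 1 (fun t => Re (F t)) (Re d) ->
  is_derive x 1 (fun t => Im (F t)) (Im d) -> rdiff F x d.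
Proof.
move=> /is_deriveP hr /is_deriveP hi e e0.
have e20 : 0 < e / 2 by rewrite divr_gt0.
have [r r0 {}hr] := hr _ e20; have [s s0 {}hi] := hi _ e20.
exists (Num.min r s) => [|h]; first by rewrite lt_min r0.
rewrite lt_min => /andP[/hr h1 /hi h2]; apply: (le_trans (nc_le _)).
rewrite !ReD !ReN !ImD !ImN.
rewrite ReMr ImMr.
by rewrite [e in leRHS]splitr mulrDl lerD.
Qed.

Lemma rdiff_line (f : R[i] -> R[i]) (a b d : R[i]) (x : R) :
  cdiff f (a + b * x%:C%C) d -> rdiff (fun t => f (a + b * t%:C%C)) x (d * b).
Proof.
move=> /cdiffP hf e e0.
have K0 : 0 < nc b + 1 by rewrite ltr_wpDl ?nc_ge0.
have [r r0 hr] := hf _ (divr_gt0 e0 K0).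
exists (r / (nc b + 1)) => [|h]; first by rewrite divr_gt0.
rewrite ltr_pdivlMr// => hh.
have := hr (a + b * (x + h)%:C%C).
have -> : a + b * (x + h)%:C%C - (a + b * x%:C%C) = b * h%:C%C.
  by rewrite cRD; ring.
rewrite ncM ncR -[d * b * _]mulrA => /(_ _)/le_trans; apply.
  by apply: le_lt_trans hh; rewrite mulrC ler_wpM2l// lerDl.
rewrite mulrA ler_wpM2r// -mulrA ler_piMr ?(ltW e0)// mulrC ler_pdivrMr// mul1r.
by rewrite lerDl.
Qed.

Lemma rdiffB (F G : R -> R[i]) x d e : rdiff F x d -> rdiff G x e ->
  rdiff (fun t => F t - G t) x (d - e).
Proof.
move=> hF hG c c0; have c20 : 0 < c / 2 by rewrite divr_gt0.
have [r r0 hr] := hF _ c20; have [s s0 hs] := hG _ c20.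
exists (Num.min r s) => [|h]; first by rewrite lt_min r0.
rewrite lt_min => /andP[/hr h1 /hs h2].
have -> : F (x + h) - G (x + h) - (F x - G x) - (d - e) * h%:C%C =
  (F (x + h) - F x - d * h%:C%C) - (G (x + h) - G x - e * h%:C%C) by ring.
by rewrite (le_trans (ncB _ _))// [c in leRHS]splitr mulrDl lerD.
Qed.

Lemma real_mean_value (f df : R -> R) (a b M : R) :
  (forall x : R, Num.min a b <= x <= Num.max a b -> is_derive x 1 f (df x)) ->
  (forall x, Num.min a b <= x <= Num.max a b -> `|df x| <= M) ->
  `|f b - f a| <= M * `|b - a|.
Proof.
wlog ab : a b / a <= b => [wl|].
  have /orP[|ba] := le_total a b; first exact: wl.
  by rewrite (minC a) (maxC a) (distrC (f b)) (distrC b); exact: wl.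
rewrite (min_idPl ab) (max_idPr ab) => hf hM.
have hf' x : x \in `[a, b] -> is_derive x 1 f (df x).
  by rewrite in_itv/= => /hf.
have [|c cab ->] := @MVT_segment _ f df a b ab (fun x hx => hf' x (subset_itv_oo_cc hx)).
  apply: derivable_within_continuous => x /hf' h.
  exact: (@ex_derive _ _ _ _ _ _ _ h).
by rewrite normrM ler_wpM2r// hM.
Qed.

(** The factor 2 comes from applying the real mean value theorem to the real and imaginary parts
    separately. *)
Lemma mean_value_ineq (F dF : R -> R[i]) (a b M : R) :
  (forall x, Num.min a b <= x <= Num.max a b -> rdiff F x (dF x)) ->
  (forall x, Num.min a b <= x <= Num.max a b -> nc (dF x) <= M) ->
  nc (F b - F a) <= 2 * M * `|b - a|.
Proof.
move=> hF hM; apply: (le_trans (nc_le _)); rewrite ReD ImD ReN ImN.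
rewrite -mulrA mulrDl !mul1r; apply: lerD.
  apply: (@real_mean_value (fun t => Re (F t)) (fun t => Re (dF t))) => [x /hF|x /hM].
    exact: rdiff_Re.
  by apply: le_trans; exact: nc_Re.
apply: (@real_mean_value (fun t => Im (F t)) (fun t => Im (dF t))) => [x /hF|x /hM].
  exact: rdiff_Im.
by apply: le_trans; exact: nc_Im.
Qed.

Lemma continuous_integrable (f : R -> R) (a b : R) : continuous f ->
  (@lebesgue_measure R).-integrable `[a, b] (EFin \o f).
Proof.
move=> cf; apply: continuous_compact_integrable; first exact: segment_compact.
exact: continuous_subspaceT.
Qed.

(** The fundamental theorem gives a primitive [G a] only to the right of [a]. Different [a] give
    primitives that differ by a constant, so normalizing at 0 and letting [a = -|x| - 1], below both
    [x] and 0, makes them fit together. *)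
Lemma continuous_primitive (f : R -> R) : continuous f ->
  exists F : R -> R, forall x : R, is_derive x 1 F (f x).
Proof.
move=> cf.
pose G (a x : R) : R := \int[lebesgue_measure]_(t in `[a, x]) f t.
have dG (a x : R) : a < x -> is_derive x 1 (G a) (f x).
  move=> ax; have x1 : x < x + 1 by rewrite ltrDl.
  have [d dE] := continuous_FTC1_closed x1 (continuous_integrable a (x + 1) cf) ax (@cf x).
  by apply: DeriveDef; [exact: d|rewrite -derive1E; exact: dE].
have GE a b x y : a < x -> a < y -> b < x -> b < y -> G a x - G a y = G b x - G b y.
  move=> ax ay bx bly.
  wlog xy : x y ax ay bx bly / x <= y.
    move=> wl; have [|/ltW] := leP x y; first exact: wl.
    move=> yx; apply/oppr_inj; rewrite !opprB; exact: wl.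
  pose D t := G a t - G b t.
  have dD t : t \in `[x, y] -> is_derive t 1 D 0.
    rewrite in_itv/= => /andP[xt ty]; rewrite -(subrr (f t)).
    by apply: is_deriveB; apply: dG; apply: lt_le_trans xt.
  have [|c _] := @MVT_segment _ D (fun=> 0) x y xy (fun t ht => dD t (subset_itv_oo_cc ht)).
    apply: derivable_within_continuous => t /dD h.
    exact: (@ex_derive _ _ _ _ _ _ _ h).
  by rewrite mul0r /D => /eqP; rewrite subr_eq0 => /eqP; lra.
pose n (x : R) := `|x| + 1.
exists (fun x => G (- n x) x - G (- n x) 0) => x.
have nn : n x >= `|x| + 1 by [].
apply/is_deriveP => e e0.
have x1 : - (n x + 1) < x by rewrite /n; have := ler_norm (- x); rewrite normrN; lra.
have /is_deriveP/(_ e e0)[r r0 hr] := dG _ _ x1.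
exists (Num.min r 1) => [|h]; first by rewrite lt_min r0 ltr01.
rewrite lt_min => /andP[hr1 h1].
have key t : `|t - x| < 1 -> G (- n t) t - G (- n t) 0 =
    G (- (n x + 1)) t - G (- (n x + 1)) 0.
  move=> tx; apply: GE; rewrite /n.
  - by have := ler_norm (- t); rewrite normrN; lra.
  - by have := normr_ge0 t; lra.
  - have := ler_norm (x - t); have := ler_norm (- x).
    by rewrite normrN distrC => ? ?; lra.
  - by have := normr_ge0 x; lra.
rewrite key; last by rewrite [x + h]addrC addrK.
rewrite (key x); last by rewrite subrr normr0.
rewrite [X in `|X| <= _](_ : _ = G (- (n x + 1)) (x + h) - G (- (n x + 1)) x - f x * h); last ring.
exact: hr.
Qed.

Definition rcont (F : R -> R[i]) := forall x (e : R), 0 < e -> exists2 r : R, 0 < r &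
  forall y, `|y - x| < r -> nc (F y - F x) <= e.

Lemma rcont_part (F : R -> R[i]) (p : R[i] -> R) :
  (forall z w, p (z - w) = p z - p w) -> (forall z, `|p z| <= nc z) ->
  rcont F -> continuous (fun t => p (F t)).
Proof.
move=> pB pn cF x; apply/cvgrPdist_le => e e0.
have [r r0 hr] := cF x e e0; exists r => // y xy.
have /hr : `|y - x| < r by rewrite distrC.
by apply: le_trans; rewrite -pB; apply: le_trans (pn _) _; rewrite ncBC.
Qed.

Lemma rcont_primitive (f : R -> R[i]) : rcont f ->
  exists F : R -> R[i], forall x, rdiff F x (f x).
Proof.
move=> cf.
have [F1 h1] : exists F : R -> R, forall x : R, is_derive x 1 F (Re (f x)).
  apply: continuous_primitive; apply: (@rcont_part f Re) => // [z w|z].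
    by rewrite ReD ReN.
  exact: nc_Re.
have [F2 h2] : exists F : R -> R, forall x : R, is_derive x 1 F (Im (f x)).
  apply: continuous_primitive; apply: (@rcont_part f Im) => // [z w|z].
    by rewrite ImD ImN.
  exact: nc_Im.
by exists (fun x => (F1 x +i* F2 x)%C) => x; apply: rdiff_pair.
Qed.

(** Stands for the integral of [f] along the line: only differences of its values are meaningful,
    the additive constant being an arbitrary choice. *)
Definition prim (f : R -> R[i]) : R -> R[i] :=
  xget (fun=> 0) [set F | forall x, rdiff F x (f x)].

Lemma primP (f : R -> R[i]) : rcont f -> forall x, rdiff (prim f) x (f x).
Proof.
move=> /rcont_primitive; rewrite /prim; set P := [set F | _] => exP.
exact: (@xgetPex _ (fun=> 0) P exP).
Qed.

Lemma prim_approx (f g : R -> R[i]) (G : R -> R[i]) (a b M : R) :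
  rcont f -> (forall x, rdiff G x (g x)) ->
  (forall x, Num.min a b <= x <= Num.max a b -> nc (f x - g x) <= M) ->
  nc (prim f b - prim f a - (G b - G a)) <= 2 * M * `|b - a|.
Proof.
move=> cf hG hM.
have -> : prim f b - prim f a - (G b - G a) = (prim f b - G b) - (prim f a - G a).
  by ring.
apply: (@mean_value_ineq (fun t => prim f t - G t) (fun t => f t - g t)) => // x _.
by apply: rdiffB => //; exact: primP.
Qed.

End real_parameter.

(** * Goursat's lemma and primitives of entire functions *)

Section goursat.
Variable R : realType.

Lemma exists_half_pow (r : R) : 0 < r -> exists n, (2 ^+ n)^-1 < r.
Proof.
move=> r0; exists (Num.truncn r^-1).+1.
rewrite invf_plt ?posrE ?exprn_gt0//.
apply: lt_le_trans (truncnS_gt _) _; rewrite -natrX ler_nat.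
exact/ltnW/ltn_expl.
Qed.

Lemma nested_intervals (a s : nat -> R) : (forall n, 0 <= s n) ->
  (forall n, a n <= a n.+1 /\ a n.+1 + s n.+1 <= a n + s n) ->
  exists x, forall n, a n <= x <= a n + s n.
Proof.
move=> s0 ha.
have a_nd : {homo a : m n / (m <= n)%N >-> m <= n}.
  by apply: homo_leq => [//|???|n]; [exact: le_trans|exact: (ha n).1].
have as_ni : {homo (fun n => a n + s n) : m n / (m <= n)%N >-> n <= m}.
  by apply: homo_leq => [//|y x z xy yz|n]; [exact: le_trans yz xy|exact: (ha n).2].
have amn m n : a m <= a n + s n.
  have [mn|nm] := leqP m n.
    by apply: le_trans (a_nd _ _ mn) _; rewrite lerDl.
  by apply: le_trans (as_ni _ _ (ltnW nm)); rewrite lerDl.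
exists (sup (range a)) => n; apply/andP; split.
  apply: ub_le_sup; last by exists n.
  by exists (a 0%N + s 0%N) => _ [m _ <-].
by apply: ge_sup; [exists (a 0%N), 0%N|move=> _ [m _ <-]].
Qed.

(** Some quarter of each square carries at least a quarter of [|Psi|]. Repeating the choice gives
    squares of side [s] shrinking to a point with [|Psi| >= c s^2], which the local estimate with
    [e = c / 2] excludes. *)
Lemma square_bisect (Psi : R -> R -> R -> R[i]) :
  (forall a b s, Psi a b s = Psi a b (s / 2) + Psi (a + s / 2) b (s / 2) +
     Psi a (b + s / 2) (s / 2) + Psi (a + s / 2) (b + s / 2) (s / 2)) ->
  (forall a b e, 0 < e -> exists2 r : R, 0 < r & forall x y s, 0 < s -> s < r ->
     x <= a <= x + s -> y <= b <= y + s -> nc (Psi x y s) <= e * s ^+ 2) ->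
  Psi 0 0 1 = 0.
Proof.
move=> Psi_add Psi_loc; apply/eqP/contraT; rewrite -nc_gt0 => c0.
set c := nc _ in c0.
pose big (p : R * R) s v := v / 4 <= nc (Psi p.1 p.2 s).
pose step (p : R * R) s : R * R :=
  let v := nc (Psi p.1 p.2 s) in
  if big p (s / 2) v then p else
  if big (p.1 + s / 2, p.2) (s / 2) v then (p.1 + s / 2, p.2) else
  if big (p.1, p.2 + s / 2) (s / 2) v then (p.1, p.2 + s / 2) else
  (p.1 + s / 2, p.2 + s / 2).
have stepP p s : big (step p s) (s / 2) (nc (Psi p.1 p.2 s)).
  rewrite /step; case: ifPn => //; rewrite /big -ltNge => h1.
  case: ifPn => //; rewrite -ltNge => h2; case: ifPn => //; rewrite -ltNge => h3.
  rewrite leNgt; apply/negP => h4; move: h1 h2 h3 h4 => /=.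
  have := Psi_add p.1 p.2 s => PE.
  have := ncD (Psi p.1 p.2 (s / 2) + Psi (p.1 + s / 2) p.2 (s / 2) +
     Psi p.1 (p.2 + s / 2) (s / 2)) (Psi (p.1 + s / 2) (p.2 + s / 2) (s / 2)).
  have := ncD (Psi p.1 p.2 (s / 2) + Psi (p.1 + s / 2) p.2 (s / 2))
     (Psi p.1 (p.2 + s / 2) (s / 2)).
  have := ncD (Psi p.1 p.2 (s / 2)) (Psi (p.1 + s / 2) p.2 (s / 2)).
  rewrite -PE; lra.
have step1 p s : 0 <= s -> p.1 <= (step p s).1 /\ (step p s).1 + s / 2 <= p.1 + s.
  by move=> s0; rewrite /step; do ?case: ifPn => _ /=; split; lra.
have step2 p s : 0 <= s -> p.2 <= (step p s).2 /\ (step p s).2 + s / 2 <= p.2 + s.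
  by move=> s0; rewrite /step; do ?case: ifPn => _ /=; split; lra.
pose s n : R := (2 ^+ n)^-1.
have s_gt0 n : 0 < s n by rewrite invr_gt0 exprn_gt0.
have sS n : s n.+1 = s n / 2 by rewrite /s exprS invfM mulrC.
pose p := fix p n := if n is k.+1 then step (p k) (s k) else (0, 0).
have pbig n : c * s n ^+ 2 <= nc (Psi (p n).1 (p n).2 (s n)).
  elim: n => [|n IH] /=.
    by rewrite /s expr0 invr1 expr1n mulr1.
  rewrite sS; apply: le_trans (stepP _ _).
  by move: IH; rewrite expr_div_n; lra.
have [x xP] : exists x, forall n, (p n).1 <= x <= (p n).1 + s n.
  by apply: nested_intervals => n; [exact: ltW|rewrite sS]; apply: step1; exact: ltW.
have [y yP] : exists y, forall n, (p n).2 <= y <= (p n).2 + s n.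
  by apply: nested_intervals => n; [exact: ltW|rewrite sS]; apply: step2; exact: ltW.
have [r r0 hr] := Psi_loc x y _ (divr_gt0 c0 (ltr0n _ 2)).
have [n nr] := exists_half_pow r0.
have := le_trans (pbig n) (hr _ _ _ (s_gt0 n) nr (xP n) (yP n)).
rewrite ler_pM2r ?exprn_gt0// => h; exfalso; lra.
Qed.

Lemma ccont_line (f : R[i] -> R[i]) a b : (forall z, ccont f z) ->
  rcont (fun t => f (a + b * t%:C%C)).
Proof.
move=> cf x e e0; have [r r0 hr] := cf (a + b * x%:C%C) e e0.
have K0 : 0 < nc b + 1 by rewrite ltr_wpDl ?nc_ge0.
exists (r / (nc b + 1)) => [|y]; first by rewrite divr_gt0.
rewrite ltr_pdivlMr// => yx; apply: hr.
have -> : a + b * y%:C%C - (a + b * x%:C%C) = b * (y - x)%:C%C by rewrite cRB; ring.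
by rewrite ncM ncR; apply: le_lt_trans yx; rewrite mulrC ler_wpM2l// lerDl.
Qed.

(** [b] is a unit direction, and [b] times an increment of [prim] is the integral of [f] along a
    segment. It is compared with that of a model [g] having the explicit primitive [G]. *)
Lemma line_approx (f g G : R[i] -> R[i]) (a b : R[i]) (p q M : R) :
  (forall z, ccont f z) -> (forall z, cdiff G z (g z)) -> nc b = 1 ->
  (forall t, Num.min p q <= t <= Num.max p q ->
     nc (f (a + b * t%:C%C) - g (a + b * t%:C%C)) <= M) ->
  nc (b * (prim (fun t => f (a + b * t%:C%C)) q - prim (fun t => f (a + b * t%:C%C)) p)
      - (G (a + b * q%:C%C) - G (a + b * p%:C%C))) <= 2 * M * `|q - p|.
Proof.
move=> cf hG b1 hM.
have b0 : b != 0 by rewrite -nc_gt0 b1.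
have dG x : rdiff (fun t => b^-1 * G (a + b * t%:C%C)) x (g (a + b * x%:C%C)).
  have := @rdiff_line _ (fun z => b^-1 * G z) a b _ x
    (cdiffM (cdiff_cst _ _) (hG (a + b * x%:C%C))).
  by rewrite mul0r add0r mulrAC mulVf// mul1r.
have := prim_approx (@ccont_line f a b cf) dG hM.
rewrite -[leLHS]mul1r -[X in X * nc _]b1 -ncM; apply: le_trans.
rewrite le_eqVlt; apply/orP; left; apply/eqP; congr nc.
by field.
Qed.

Lemma between_dist (p q t u : R) : Num.min p q <= t <= Num.max p q ->
  Num.min p q <= u <= Num.max p q -> `|t - u| <= `|q - p|.
Proof.
wlog pq : p q / p <= q => [wl|].
  have /orP[|qp] := le_total p q; first exact: wl.
  by rewrite (minC p) (maxC p) (distrC q); exact: wl.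
rewrite (min_idPl pq) (max_idPr pq) => /andP[pt tq] /andP[pu uq].
by rewrite [leRHS]ger0_norm ?subr_ge0// ler_norml; apply/andP; split; lra.
Qed.

Lemma between_affine (x w a s c : R) : a <= c <= a + s ->
  Num.min (x + w * a) (x + w * (a + s)) <= x + w * c
    <= Num.max (x + w * a) (x + w * (a + s)).
Proof.
move=> /andP[ac cs]; have [w0|w0] := leP 0 w; rewrite ge_min le_max !lerD2l.
  by apply/andP; split; apply/orP; [left|right]; exact: ler_wpM2l.
by apply/andP; split; apply/orP; [right|left]; apply: ler_wnM2l => //; exact: ltW.
Qed.

Lemma ncD4 (a b c d : R[i]) (p q r s : R) : nc a <= p -> nc b <= q ->
  nc c <= r -> nc d <= s -> nc (d + b - (c + a)) <= p + q + r + s.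
Proof.
move=> ap bq cr ds.
have := ncB (d + b) (c + a); have := ncD d b; have := ncD c a; lra.
Qed.

Section entire_function.
Variable f : R[i] -> R[i].
Hypothesis f_diff : forall z, exists d, cdiff f z d.

Let f_cont z : ccont f z.
Proof. by have [d /cdiff_ccont] := f_diff z. Qed.

Let H (y : R) := prim (fun t => f ('i%C * y%:C%C + 1 * t%:C%C)).
Let V (x : R) := prim (fun t => f (x%:C%C + 'i%C * t%:C%C)).

(** The counterclockwise integral of [f] around the rectangle, from horizontal primitives [H y] and
    vertical primitives [V x]. *)
Let boundary (x0 x1 y0 y1 : R) : R[i] :=
  (H y0 x1 - H y0 x0) + 'i%C * (V x1 y1 - V x1 y0)
  - (H y1 x1 - H y1 x0) - 'i%C * (V x0 y1 - V x0 y0).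

(** The boundary integral of [g] vanishes because [g] has a primitive, so only [f - g]
    contributes. *)
Let boundary_approx (g G : R[i] -> R[i]) (x0 x1 y0 y1 M : R) :
  (forall z, cdiff G z (g z)) ->
  (forall x y, Num.min x0 x1 <= x <= Num.max x0 x1 ->
     Num.min y0 y1 <= y <= Num.max y0 y1 ->
     nc (f (x%:C%C + 'i%C * y%:C%C) - g (x%:C%C + 'i%C * y%:C%C)) <= M) ->
  nc (boundary x0 x1 y0 y1) <= 4 * M * (`|x1 - x0| + `|y1 - y0|).
Proof.
move=> hG hM.
have minmax (p q : R) : (Num.min p q <= p <= Num.max p q) /\ (Num.min p q <= q <= Num.max p q).
  by split; rewrite ge_min le_max !lexx ?orbT.
have hH y : Num.min y0 y1 <= y <= Num.max y0 y1 ->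
    nc (1 * (H y x1 - H y x0) - (G ('i%C * y%:C%C + 1 * x1%:C%C) - G ('i%C * y%:C%C + 1 * x0%:C%C)))
      <= 2 * M * `|x1 - x0|.
  move=> hy; apply: line_approx => //; first exact: nc1.
  by move=> t ht; rewrite mul1r ['i%C * _ + _]addrC; exact: hM.
have hV x : Num.min x0 x1 <= x <= Num.max x0 x1 ->
    nc ('i%C * (V x y1 - V x y0) - (G (x%:C%C + 'i%C * y1%:C%C) - G (x%:C%C + 'i%C * y0%:C%C)))
      <= 2 * M * `|y1 - y0|.
  by move=> hx; apply: line_approx => //; [exact: nc_i|move=> t ht; exact: hM].
have := hH _ (minmax y0 y1).1; have := hH _ (minmax y0 y1).2.
have := hV _ (minmax x0 x1).1; have := hV _ (minmax x0 x1).2.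
rewrite !mul1r ![('i%C * _ + _)]addrC.
move=> hA hB hC hD.
have := ncD4 hB hA hC hD; set S := (X in nc X <= _).
have -> : S = boundary x0 x1 y0 y1 by rewrite /S /boundary; ring.
by move=> /le_trans; apply; lra.
Qed.

(** The rectangle is the affine image of the unit square, with signed width and height, so its
    corners need not be ordered. Near a point [f] is affine up to a small error, and affine
    functions have primitives. *)
Let goursat x0 x1 y0 y1 : boundary x0 x1 y0 y1 = 0.
Proof.
have [w wE] : exists w, w = x1 - x0 by exists (x1 - x0).
have [h hE] : exists h, h = y1 - y0 by exists (y1 - y0).
pose Psi a b s := boundary (x0 + w * a) (x0 + w * (a + s)) (y0 + h * b) (y0 + h * (b + s)).
have <- : Psi 0 0 1 = boundary x0 x1 y0 y1.
  by rewrite /Psi !mulr0 !add0r !addr0 !mulr1 wE hE ![_ + (_ - _)]addrC !subrK.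
apply: square_bisect => [a b s|a b e e0].
  rewrite /Psi /boundary.
  have E c : c + s / 2 + s / 2 = c + s by rewrite -addrA -splitr.
  by rewrite !E; ring.
pose z0 := (x0 + w * a)%:C%C + 'i%C * (y0 + h * b)%:C%C.
have [d /cdiffP hd] := f_diff z0.
pose L := `|w| + `|h| + 1.
have L0 : 0 < L by rewrite /L ltr_wpDl// addr_ge0.
(* [boundary_approx] costs 4 times the error [e / (4 L^2) * (L s)] times the side lengths, which add
   up to at most [L s]; the result is at most [e s^2]. *)
have e'0 : 0 < e / (4 * L ^+ 2) by rewrite divr_gt0// mulr_gt0// exprn_gt0.
have [r r0 hr] := hd _ e'0.
exists (r / L) => [|x y s s0]; first by rewrite divr_gt0.
rewrite ltr_pdivlMr// => sr xa yb.
have xw : `|x0 + w * (x + s) - (x0 + w * x)| = `|w| * s.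
  by rewrite opprD addrACA subrr add0r -mulrBr [x + s]addrC addrK normrM (gtr0_norm s0).
have yh : `|y0 + h * (y + s) - (y0 + h * y)| = `|h| * s.
  by rewrite opprD addrACA subrr add0r -mulrBr [y + s]addrC addrK normrM (gtr0_norm s0).
apply: le_trans (@boundary_approx (fun z => f z0 + d * (z - z0))
  (fun z => f z0 * z + (d / 2) * ((z - z0) * (z - z0))) _ _ _ _
  (e / (4 * L ^+ 2) * (L * s)) _ _) _.
- move=> z.
  have -> : f z0 + d * (z - z0) = (0 * z + f z0 * 1) +
      (0 * ((z - z0) * (z - z0)) + (d / 2) * ((1 + 0) * (z - z0) + (z - z0) * (1 + 0))).
    by field.
  apply: cdiffD; apply: cdiffM; [exact: cdiff_cst|exact: cdiff_id|exact: cdiff_cst|].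
  by apply: cdiffM; apply: cdiffD; [exact: cdiff_id|exact: cdiff_cst
    |exact: cdiff_id|exact: cdiff_cst].
- move=> t u ht hu.
  have dt := between_dist ht (between_affine x0 w xa).
  have du := between_dist hu (between_affine y0 h yb).
  rewrite xw in dt; rewrite yh in du.
  have nz : nc (t%:C%C + 'i%C * u%:C%C - z0) <= L * s.
    have -> : t%:C%C + 'i%C * u%:C%C - z0 =
      (t - (x0 + w * a))%:C%C + 'i%C * (u - (y0 + h * b))%:C%C.
      by rewrite /z0 !cRB; ring.
    apply: le_trans (ncD _ _) _; rewrite ncM nc_i mul1r !ncR /L !mulrDl mul1r.
    by apply: le_trans (lerD dt du) _; rewrite lerDl ltW.
  rewrite opprD addrA; apply: le_trans (hr _ _) _.
    by apply: le_lt_trans nz _; rewrite mulrC.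
  by rewrite ler_wpM2l// ltW.
- rewrite xw yh -mulrDl.
  have -> : 4 * (e / (4 * L ^+ 2) * (L * s)) * ((`|w| + `|h|) * s) =
      e * s ^+ 2 * ((`|w| + `|h|) / L) by field; rewrite gt_eqF.
  apply: ler_piMr; first by rewrite mulr_ge0 ?sqr_ge0// ltW.
  by rewrite ler_pdivrMr// mul1r /L lerDl.
Qed.

(* The antiderivative integrates along the real axis, then vertically; by
   Goursat its increments can be computed along the other two sides instead. *)
Lemma entire_primitive : exists Q : R[i] -> R[i], forall z, cdiff Q z (f z).
Proof.
pose Q z := (H 0 (Re z) - H 0 0) + 'i%C * (V (Re z) (Im z) - V (Re z) 0).
exists Q => z; apply/cdiffP => e e0.
(* Two sides contribute [2 * (e / 4)] each, relative to lengths at most [|w - z|]. *)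
have e40 : 0 < e / 4 by rewrite divr_gt0.
have [r r0 hr] := f_cont z e40.
exists (r / 2) => [|w wz]; first by rewrite divr_gt0.
pose x := Re z; pose y := Im z; pose x' := Re w; pose y' := Im w.
have zE : z = x%:C%C + 'i%C * y%:C%C by rewrite -complexE.
have wE : w = x'%:C%C + 'i%C * y'%:C%C by rewrite -complexE.
have dx : `|x' - x| <= nc (w - z).
  by rewrite /x' /x -ReN -ReD nc_Re.
have dy : `|y' - y| <= nc (w - z).
  by rewrite /y' /y -ImN -ImD nc_Im.
have QE : Q w - Q z = 1 * (H y x' - H y x) + 'i%C * (V x' y' - V x' y).
  rewrite -[RHS]addr0 -(goursat x x' 0 y) /Q /boundary -/x -/y -/x' -/y'; ring.
have dG u : cdiff (fun v => f z * v) u (f z).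
  by have := cdiffM (cdiff_cst (f z) u) (cdiff_id u); rewrite mul0r add0r mulr1.
have near t u : `|t - x| <= nc (w - z) -> `|u - y| <= nc (w - z) ->
    nc (f (t%:C%C + 'i%C * u%:C%C) - f z) <= e / 4.
  move=> tx uy; apply: hr.
  have -> : t%:C%C + 'i%C * u%:C%C - z = (t - x)%:C%C + 'i%C * (u - y)%:C%C.
    by rewrite [in LHS]zE !cRB; ring.
  apply: le_lt_trans (ncD _ _) _; rewrite ncM nc_i mul1r !ncR; lra.
have minmax (p q : R) : Num.min p q <= p <= Num.max p q.
  by rewrite ge_min le_max !lexx.
have h1 : nc (1 * (H y x' - H y x) - (f z * ('i%C * y%:C%C + 1 * x'%:C%C)
    - f z * ('i%C * y%:C%C + 1 * x%:C%C))) <= 2 * (e / 4) * `|x' - x|.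
  apply: (@line_approx f (fun=> f z) (fun v => f z * v)) => //; first exact: nc1.
  move=> t ht; rewrite mul1r ['i%C * _ + _]addrC; apply: near; last by rewrite subrr normr0 nc_ge0.
  by apply: le_trans dx; apply: between_dist ht (minmax _ _).
have h2 : nc ('i%C * (V x' y' - V x' y) - (f z * (x'%:C%C + 'i%C * y'%:C%C)
    - f z * (x'%:C%C + 'i%C * y%:C%C))) <= 2 * (e / 4) * `|y' - y|.
  apply: (@line_approx f (fun=> f z) (fun v => f z * v)) => //; first exact: nc_i.
  move=> t ht; apply: near => //.
  by apply: le_trans dy; apply: between_dist ht (minmax _ _).
have -> : Q w - Q z - f z * (w - z) =
  (1 * (H y x' - H y x) - (f z * ('i%C * y%:C%C + 1 * x'%:C%C)
    - f z * ('i%C * y%:C%C + 1 * x%:C%C))) +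
  ('i%C * (V x' y' - V x' y) - (f z * (x'%:C%C + 'i%C * y'%:C%C)
    - f z * (x'%:C%C + 'i%C * y%:C%C))).
  have -> : w - z = (x'%:C%C + 'i%C * y'%:C%C) - (x%:C%C + 'i%C * y%:C%C).
    by congr (_ - _).
  by rewrite QE; ring.
apply: le_trans (ncD _ _) _; apply: le_trans (lerD h1 h2) _.
have : e * `|x' - x| <= e * nc (w - z) by rewrite ler_wpM2l// ltW.
have : e * `|y' - y| <= e * nc (w - z) by rewrite ler_wpM2l// ltW.
lra.
Qed.

End entire_function.
End goursat.

(** * The complex exponential *)

Section complex_exponential.
Variable R : realType.

Definition cexp (z : R[i]) : R[i] := (expR (Re z))%:C%C * (cos (Im z) +i* sin (Im z))%C.

Lemma cexpD z w : cexp (z + w) = cexp z * cexp w.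
Proof.
rewrite /cexp ReD ImD expRD cosD sinD cRM.
have -> : ((cos (Im z) * cos (Im w) - sin (Im z) * sin (Im w)) +i*
   (sin (Im z) * cos (Im w) + cos (Im z) * sin (Im w)))%C =
   (cos (Im z) +i* sin (Im z))%C * (cos (Im w) +i* sin (Im w))%C.
  by simpc; congr (_ +i* _)%C; ring.
by ring.
Qed.

Lemma nc_cexp z : nc (cexp z) = expR (Re z).
Proof.
rewrite /cexp ncM ncR ger0_norm ?expR_ge0// nc_complex cos2Dsin2 sqrtr1.
by rewrite mulr1.
Qed.

(** The functional equation reduces everything to the point 0, where the real derivatives of exp,
    cos and sin suffice. *)
Lemma cdiff_cexp z : cdiff cexp z (cexp z).
Proof.
have d0 : cdiff cexp 0 1.
  (* The error splits into [(expR a - 1 - a) T], [(1 + a)] times the error of cos and sin, and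
     [i a b]; these cost 1, 4 and 1 units of [(e / 6) |w|]. *)
  apply/cdiffP => e e0; have e40 : 0 < Num.min 1 (e / 6).
    by rewrite lt_min ltr01 divr_gt0.
  have /is_deriveP/(_ _ e40)[r1 r10 h1] := is_derive_expR (0 : R).
  have /is_deriveP/(_ _ e40)[r2 r20 h2] := is_derive_cos (0 : R).
  have /is_deriveP/(_ _ e40)[r3 r30 h3] := is_derive_sin (0 : R).
  move: h1 h2 h3; rewrite expR0 cos0 sin0 => h1 h2 h3.
  exists (Num.min (Num.min 1 (e / 6)) (Num.min r1 (Num.min r2 r3))) => [|w].
    by rewrite !lt_min ltr01 divr_gt0// r10 r20.
  rewrite subr0 mul1r !lt_min -!andbA => /and5P[w1 we wr1 wr2 wr3].
  have [a [b wE]] : exists a b, w = (a +i* b)%C by exact: complex_surj.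
  have ha : `|a| <= nc w by rewrite (_ : a = Re w) ?nc_Re// wE.
  have hb : `|b| <= nc w by rewrite (_ : b = Im w) ?nc_Im// wE.
  have {}h1 := h1 a (le_lt_trans ha wr1).
  have {}h2 := h2 b (le_lt_trans hb wr2).
  have {}h3 := h3 b (le_lt_trans hb wr3).
  rewrite !add0r ?oppr0 ?mul0r ?mul1r ?subr0 ?addr0 in h1 h2 h3.
  pose T : R[i] := (cos b +i* sin b)%C.
  have cE : cexp 0 = 1 by rewrite /cexp /= expR0 cos0 sin0 mul1r.
  have -> : cexp w - cexp 0 - w = (expR a - 1 - a)%:C%C * T +
      (1 + a)%:C%C * ((cos b - 1) +i* (sin b - b))%C + (a * b)%:C%C * 'i%C.
    rewrite cE wE /cexp /= -/T.
    have -> : ((cos b - 1) +i* (sin b - b))%C = T - 1 - 'i%C * b%:C%C.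
      by rewrite /T; simpc; congr (_ +i* _)%C; ring.
    rewrite (complex_split a b) !cRB !cRD !cRM; ring.
  have T1 : nc T = 1 by rewrite nc_complex cos2Dsin2 sqrtr1.
  apply: le_trans (ncD _ _) _; apply: le_trans (lerD (ncD _ _) (lexx _)) _.
  rewrite !ncM !ncR T1 nc_i !mulr1 normrM.
  have c1 := nc_le ((cos b - 1) +i* (sin b - b))%C; rewrite /= in c1.
  have m : Num.min 1 (e / 6) <= e / 6 by rewrite ge_min lexx orbT.
  have hw := nc_ge0 w; have e50 : 0 <= e / 6 by rewrite ltW// divr_gt0.
  have a1 : `|1 + a| <= 2.
    by apply: le_trans (ler_normD _ _) _; rewrite normr1; lra.
  have i1 : `|expR a - 1 - a| <= e / 6 * nc w.
    by apply: le_trans h1 _; apply: ler_pM => //; rewrite le_min ler01.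
  have i2 : `|cos b - 1| <= e / 6 * nc w.
    by apply: le_trans h2 _; apply: ler_pM => //; rewrite le_min ler01.
  have i3 : `|sin b - b| <= e / 6 * nc w.
    by apply: le_trans h3 _; apply: ler_pM => //; rewrite le_min ler01.
  have i4 : `|a| * `|b| <= e / 6 * nc w.
    by apply: ler_pM => //; apply: le_trans ha (ltW _).
  have i5 : `|1 + a| * nc ((cos b - 1) +i* (sin b - b))%C <= 2 * (e / 6 * nc w + e / 6 * nc w).
    by apply: ler_pM => //; rewrite ?nc_ge0//; apply: le_trans c1 _; exact: lerD.
  apply: le_trans (lerD (lerD i1 i5) i4) _.
  by rewrite le_eqVlt; apply/orP; left; apply/eqP; field.
have -> : cexp = fun w => cexp z * cexp (w - z).
  by apply/funext => w; rewrite -cexpD addrC subrK.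
have d1 : cdiff (fun w => cexp (w - z)) z (1 * (1 + 0)).
  apply: cdiff_comp; first by apply: cdiffD; [exact: cdiff_id|exact: cdiff_cst].
  by rewrite subrr.
have := cdiffM (cdiff_cst (cexp z) z) d1.
rewrite mul0r add0r addr0 !mulr1 subrr.
have -> : cexp 0 = 1 by rewrite /cexp /= expR0 cos0 sin0 mul1r.
by rewrite mulr1.
Qed.

End complex_exponential.

(** * Twice differentiable functions *)

Section twice_differentiable.
Variable R : realType.
Implicit Types (U : R[i] -> Prop) (f g : R[i] -> R[i]).

(** Two derivatives are what the Taylor expansion in [maximum_principle] consumes. A primitive of an
    entire function has both of them: the function and its derivative. *)
Definition cdiff2 U f := exists f1 f2 : R[i] -> R[i],
  forall z, U z -> cdiff f z (f1 z) /\ cdiff f1 z (f2 z).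

Lemma cdiff2_cst U a : cdiff2 U (fun=> a).
Proof. by exists (fun=> 0), (fun=> 0) => z _; split; exact: cdiff_cst. Qed.

Lemma cdiff2_id U : cdiff2 U id.
Proof.
by exists (fun=> 1), (fun=> 0) => z _; split; [exact: cdiff_id|exact: cdiff_cst].
Qed.

Lemma cdiff2D U f g : cdiff2 U f -> cdiff2 U g -> cdiff2 U (fun z => f z + g z).
Proof.
move=> [f1 [f2 hf]] [g1 [g2 hg]].
exists (fun z => f1 z + g1 z), (fun z => f2 z + g2 z) => z Uz.
by have [? ?] := hf z Uz; have [? ?] := hg z Uz; split; exact: cdiffD.
Qed.

Lemma cdiff2M U f g : cdiff2 U f -> cdiff2 U g -> cdiff2 U (fun z => f z * g z).
Proof.
move=> [f1 [f2 hf]] [g1 [g2 hg]].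
exists (fun z => f1 z * g z + f z * g1 z),
  (fun z => (f2 z * g z + f1 z * g1 z) + (f1 z * g1 z + f z * g2 z)) => z Uz.
have [? ?] := hf z Uz; have [? ?] := hg z Uz.
by split; [exact: cdiffM|apply: cdiffD; exact: cdiffM].
Qed.

Lemma cdiff2X U f n : cdiff2 U f -> cdiff2 U (fun z => f z ^+ n).
Proof.
move=> hf; elim: n => [|n IH].
  by under eq_fun do rewrite expr0; exact: cdiff2_cst.
by under eq_fun do rewrite exprS; exact: cdiff2M.
Qed.

Lemma cdiff2_comp U f g : cdiff2 (fun=> True) f -> cdiff2 U g ->
  cdiff2 U (fun z => f (g z)).
Proof.
move=> [f1 [f2 hf]] [g1 [g2 hg]].
exists (fun z => f1 (g z) * g1 z),
  (fun z => f2 (g z) * g1 z * g1 z + f1 (g z) * g2 z) => z Uz.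
have [? ?] := hf (g z) I; have [? ?] := hg z Uz.
by split; [exact: cdiff_comp|apply: cdiffM => //; exact: cdiff_comp].
Qed.

Lemma cdiff2_inv U : (forall z, U z -> z != 0) -> cdiff2 U (fun z => z^-1).
Proof.
move=> U0; exists (fun z => -1 * (z^-1 * z^-1)),
  (fun z => 0 * (z^-1 * z^-1) + -1 * (- z ^- 2 * z^-1 + z^-1 * - z ^- 2)) => z /U0 z0.
split.
  have := cdiff_inv z0; rewrite (_ : - z ^- 2 = -1 * (z^-1 * z^-1))//.
  by rewrite mulN1r expr2 invfM.
by apply: cdiffM; [exact: cdiff_cst|apply: cdiffM; exact: cdiff_inv].
Qed.

Lemma cdiff2_cexp : cdiff2 (fun=> True) (@cexp R).
Proof. by exists (@cexp R), (@cexp R) => z _; split; exact: cdiff_cexp. Qed.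

Lemma cdiff2_ccont U f z : cdiff2 U f -> U z -> ccont f z.
Proof. by move=> [f1 [f2 hf]] /hf[/cdiff_ccont]. Qed.

(** The remainder [T] has derivative [f1 w - f1 z - f2 z (w - z)], which is at most
    [(e / 2) |w - z|] near [z]; the mean value inequality on the segment doubles the constant. *)
Lemma cdiff2_taylor U f z (rho : R) : cdiff2 U f -> 0 < rho ->
  (forall w, nc (w - z) < rho -> U w) ->
  exists a b : R[i], forall e : R, 0 < e -> exists2 r : R, 0 < r &
    forall h, nc h < r -> nc (f (z + h) - (f z + a * h + b * h ^+ 2)) <= e * nc h ^+ 2.
Proof.
move=> [f1 [f2 hf]] rho0 hU; exists (f1 z), (f2 z / 2) => e e0.
have Uz : U z by apply: hU; rewrite subrr nc0.
have [_ /cdiffP hf2] := hf z Uz.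
have [r r0 hr] := hf2 _ (divr_gt0 e0 (ltr0n R 2)).
exists (Num.min r rho) => [|h]; first by rewrite lt_min r0.
rewrite lt_min => /andP[hr1 hrho].
have th (t : R) : Num.min 0 1 <= t <= Num.max 0 1 -> nc (h * t%:C%C) <= nc h.
  rewrite (min_idPl ler01) (max_idPr ler01) => /andP[t0 t1].
  by rewrite ncM ncR ler_piMr ?nc_ge0// ger0_norm.
pose T w := f w - (f1 z * (w - z) + f2 z / 2 * ((w - z) * (w - z))).
have dT w : U w -> cdiff T w (f1 w - (f1 z + f2 z * (w - z))).
  move=> Uw; rewrite /T.
  have lin : cdiff (fun w => w - z) w (1 + 0).
    by apply: cdiffD; [exact: cdiff_id|exact: cdiff_cst].
  have -> : f1 w - (f1 z + f2 z * (w - z)) =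
      f1 w + (0 * (f1 z * (w - z) + f2 z / 2 * ((w - z) * (w - z))) + -1 *
        ((0 * (w - z) + f1 z * (1 + 0)) + (0 * ((w - z) * (w - z)) +
          f2 z / 2 * ((1 + 0) * (w - z) + (w - z) * (1 + 0))))) by field.
  under eq_fun do rewrite -mulN1r.
  apply: cdiffD; first by have [] := hf w Uw.
  apply: cdiffM; first exact: cdiff_cst.
  apply: cdiffD; apply: cdiffM => //; [exact: cdiff_cst|exact: cdiff_cst|].
  exact: cdiffM.
have := @mean_value_ineq R (fun t => T (z + h * t%:C%C))
  (fun t => (f1 (z + h * t%:C%C) - (f1 z + f2 z * (z + h * t%:C%C - z))) * h) 0 1
  (e / 2 * nc h ^+ 2).
rewrite subr0 normr1 !mulr1 mulr0 addr0 => /(_ _ _)/=.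
have -> : T (z + h) - T z = f (z + h) - (f z + f1 z * h + f2 z / 2 * h ^+ 2).
  by rewrite /T [z + h - z]addrC addKr; ring.
have -> : 2 * (e / 2 * nc h ^+ 2) = e * nc h ^+ 2 by field.
apply=> t ht.
  apply: rdiff_line; apply: dT; apply: hU; rewrite addrC addKr.
  exact: le_lt_trans (th t ht) _.
have -> : z + h * t%:C%C - z = h * t%:C%C by rewrite addrC addKr.
rewrite ncM opprD addrA expr2 [leRHS]mulrA ler_wpM2r ?nc_ge0//.
have := hr (z + h * t%:C%C); have -> : z + h * t%:C%C - z = h * t%:C%C.
  by rewrite addrC addKr.
move=> /(_ (le_lt_trans (th t ht) hr1))/le_trans; apply.
by rewrite ler_wpM2l ?th// ltW// divr_gt0.
Qed.

End twice_differentiable.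

(** * The maximum principle *)

Section maximum_principle.
Variable R : realType.

Definition ucont (u : R[i] -> R) := forall z (e : R), 0 < e -> exists2 r : R, 0 < r &
  forall w, nc (w - z) < r -> `|u w - u z| <= e.

(** The one consequence of compactness that the maximum principle uses. *)
Definition evt_set (K : set R[i]) := forall u : R[i] -> R, ucont u ->
  exists2 z, K z & forall w, K w -> u w <= u z.

(** One shape for both applications: [al = be = 0] aside, [al = 0] gives a truncated sector and
    [be = 0] a rectangle. *)
Definition trapezoid (a b al be : R) : set R[i] :=
  [set z | a <= Re z <= b /\ `|Im z| <= al + be * Re z].

(** The set is the image under [phi] of a rectangle, whose vertical sections are stretched to the
    local height; a section of height 0 collapses to one point. *)
Lemma trapezoid_evt (a b al be : R) : a <= b ->
  (forall s, a <= s <= b -> 0 <= al + be * s) -> evt_set (trapezoid a b al be).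
Proof.
move=> ab nn u cu.
pose phi (p : R * R) : R[i] := (p.1 +i* ((al + be * p.1) * p.2))%C.
have cphi : continuous (fun p => u (phi p)).
  move=> p; apply/cvgrPdist_le => e e0.
  have [r r0 hr] := cu (phi p) e e0.
  have c2 : {for p, continuous (fun p : R * R => (al + be * p.1) * p.2)}.
    apply: continuousM; last exact: cvg_snd.
    apply: continuousD; first exact: cvg_cst.
    apply: continuousM; first exact: cvg_cst.
    exact: cvg_fst.
  have r20 : 0 < r / 2 by rewrite divr_gt0.
  have /cvgrPdist_lt/(_ _ r20) h2 := c2.
  have c1 : {for p, continuous (@fst R R)} by exact: cvg_fst.
  have /cvgrPdist_lt/(_ _ r20) h1 := c1.
  near=> q; rewrite distrC; apply: hr.
  apply: le_lt_trans (nc_le _) _; rewrite [ltRHS]splitr; apply: ltrD.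
    by rewrite /= distrC; near: q.
  by rewrite /= distrC; near: q.
have cK : compact (`[a, b] `*` `[-1 : R, 1]) by apply: compact_setX; exact: segment_compact.
have [||p /set_mem[/= p1 p2] pmax] :=
  @compact_EVT_max _ R (fun p => u (phi p)) _ _ cK.
- exists (a, 0) => /=; rewrite !in_itv/= lexx ab; split => //.
  by rewrite lerN10 ler01.
- exact: continuous_subspaceT.
rewrite !in_itv/= in p1 p2.
exists (phi p).
  split=> //=; rewrite normrM ger0_norm ?nn// ler_piMr ?nn//.
  by rewrite ler_norml.
move=> w [wab wim].
have [w0|w0] := eqVneq (al + be * Re w) 0.
  have wE : w = phi (Re w, 0).
    move: wim; rewrite w0 normr_le0 /phi /= w0 mul0r => /eqP <-.
    by case: (w).
  rewrite wE; apply: pmax; apply/mem_set; split=> //=; rewrite in_itv//=.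
  by rewrite lerN10 ler01.
have wp : 0 < al + be * Re w by rewrite lt_def w0 nn.
have -> : w = phi (Re w, Im w / (al + be * Re w)).
  by rewrite /phi /= mulrC divfK//; case: (w).
apply: pmax; apply/mem_set; split=> /=; rewrite in_itv//=.
by rewrite -ler_norml normrM normfV (gtr0_norm wp) ler_pdivrMr// mul1r.
Unshelve. all: by end_near. Qed.

Lemma ucont_nc (f : R[i] -> R[i]) : (forall z, ccont f z) -> ucont (fun z => nc (f z)).
Proof.
move=> cf z e /(cf z)[r r0 hr]; exists r => // w /hr; apply: le_trans.
have := ler_ncB (f w) (f z); have := ler_ncB (f z) (f w).
by rewrite [nc (f z - f w)]ncBC ler_norml => h1 h2; apply/andP; split; lra.
Qed.

Lemma exists_phase (z : R[i]) : exists2 v : R[i], nc v = 1 & Re (v * z) = nc z.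
Proof.
have [->|z0] := eqVneq z 0; first by exists 1; rewrite ?nc1// mulr0 nc0.
have nz : 0 < nc z by rewrite nc_gt0.
exists ((nc z)^-1%:C%C * conjc z).
  have cz : nc (conjc z) = nc z by case: (z) => a b; rewrite !nc_complex sqrrN.
  by rewrite ncM ncR cz ger0_norm ?invr_ge0 ?ltW// mulVf// gt_eqF.
have -> : Re ((nc z)^-1%:C%C * conjc z * z) = (nc z)^-1 * (nc z ^+ 2).
  rewrite nc_sqr; move: (nc z)^-1 => c; case: (z) => a b; simpc => /=; ring.
by rewrite expr2 mulrA mulVf ?mul1r// gt_eqF.
Qed.

(* Perturbing |f| by eta |z|^2 makes it strictly subharmonic: averaging the
   second-order Taylor expansion over z0 + {r, -r, ir, -ir} kills the linear and
   quadratic terms, so an interior maximum is impossible. *)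
Lemma maximum_principle (K : set R[i]) (f : R[i] -> R[i]) (B : R[i] -> Prop) (M : R) :
  evt_set K -> (forall z, ccont f z) ->
  (forall z, K z -> B z -> nc (f z) <= M) ->
  (forall z, K z -> ~ B z -> (exists2 rho : R, 0 < rho &
      forall w, nc (w - z) < rho -> K w) /\
    exists a b : R[i], forall e : R, 0 < e -> exists2 r : R, 0 < r &
    forall h, nc h < r -> nc (f (z + h) - (f z + a * h + b * h ^+ 2)) <= e * nc h ^+ 2) ->
  forall z, K z -> nc (f z) <= M.
Proof.
move=> evtK cf hB hI z1 Kz1; rewrite leNgt; apply/negP => Mz1.
have [zD KzD hD] := evtK _ (ucont_nc (@ccont_id R)).
pose D := nc zD ^+ 2 + 1; have D0 : 0 < D by rewrite ltr_wpDl ?sqr_ge0.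
have KD z : K z -> nc z ^+ 2 < D.
  move=> /hD h; apply: le_lt_trans (_ : nc zD ^+ 2 < _); last by rewrite ltrDl.
  by rewrite ler_sqr ?nnegrE ?nc_ge0.
(* With this size the perturbation stays below [|f z1| - M] on [K], so a boundary point, where
   [|f| <= M], cannot maximize [u]. *)
pose eta := (nc (f z1) - M) / D.
have eta0 : 0 < eta by rewrite divr_gt0// subr_gt0.
pose u z := nc (f z) + eta * nc z ^+ 2.
have cu : ucont u.
  have h2 : ucont (fun z => nc (eta%:C%C * (z * z))).
    apply: ucont_nc => z; apply: ccontM; first exact: ccont_cst.
    by apply: ccontM; exact: ccont_id.
  move=> z e e0; have e20 : 0 < e / 2 by rewrite divr_gt0.
  have [r r0 hr] := ucont_nc cf z e20; have [s s0 hs] := h2 z _ e20.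
  exists (Num.min r s) => [|w]; first by rewrite lt_min r0.
  rewrite lt_min => /andP[/hr w1 /hs]; rewrite !ncM !ncR (gtr0_norm eta0) -!expr2 => w2.
  rewrite /u opprD addrACA [leRHS]splitr; apply: le_trans (ler_normD _ _) _.
  exact: lerD.
have [z0 Kz0 umax] := evtK u cu.
have u1 := umax _ Kz1.
have [Bz0|nBz0] := pselect (B z0).
  have := hB _ Kz0 Bz0; have := KD _ Kz0.
  rewrite -(ltr_pM2l eta0) => h1 h2; move: u1; rewrite /u.
  have : 0 <= eta * nc z1 ^+ 2 by rewrite mulr_ge0 ?sqr_ge0// ltW.
  have : eta * D = nc (f z1) - M by rewrite /eta divfK// gt_eqF.
  lra.
have [[rho rho0 hrho] [a [b hab]]] := hI _ Kz0 nBz0.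
have [r r0 hr] := hab _ (divr_gt0 eta0 (ltr0n R 2)).
pose m := Num.min r rho / 2.
have mr0 : 0 < Num.min r rho by rewrite lt_min r0.
have m0 : 0 < m by rewrite divr_gt0.
have mlt : m < Num.min r rho by rewrite ltr_pdivrMr// ltr_pMr// ltr1n.
have [v v1 vE] := exists_phase (f z0).
(* Multiplying by the phase [v] of [f z0] replaces the modulus by a real part, which is linear in
   the Taylor polynomial. *)
have point h : nc h = m ->
    Re (v * (f z0 + a * h + b * h ^+ 2)) - eta / 2 * m ^+ 2 + eta * nc (z0 + h) ^+ 2
      <= u z0.
  move=> hm; have Kh : K (z0 + h).
    apply: hrho; rewrite addrC addKr hm; apply: lt_le_trans mlt _.
    by rewrite ge_min lexx orbT.
  apply: le_trans (umax _ Kh); rewrite /u lerD2r.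
  have mr : nc h < r by rewrite hm; apply: lt_le_trans mlt _; rewrite ge_min lexx.
  have := hr h mr; rewrite hm.
  set T := f z0 + _ + _ => hT.
  have h1 : Re (v * f (z0 + h)) <= nc (f (z0 + h)).
    apply: le_trans (ler_norm _) _; apply: le_trans (nc_Re _) _.
    by rewrite ncM v1 mul1r.
  have h2 : Re (v * T) - Re (v * f (z0 + h)) <= nc (f (z0 + h) - T).
    rewrite -ReN -ReD -mulrN -mulrDr; apply: le_trans (ler_norm _) _.
    by apply: le_trans (nc_Re _) _; rewrite ncM v1 mul1r ncBC.
  lra.
pose h1 : R[i] := m%:C%C; pose h3 : R[i] := 'i%C * m%:C%C.
have n1 : nc h1 = m by rewrite ncR gtr0_norm.
have n2 : nc (- h1) = m by rewrite ncN.
have n3 : nc h3 = m by rewrite ncM nc_i ncR mul1r gtr0_norm.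
have n4 : nc (- h3) = m by rewrite ncN.
have := point _ n1; have := point _ n2; have := point _ n3; have := point _ n4.
have ReS : Re (v * (f z0 + a * h1 + b * h1 ^+ 2)) + Re (v * (f z0 + a * - h1 + b * (- h1) ^+ 2))
  + Re (v * (f z0 + a * h3 + b * h3 ^+ 2)) + Re (v * (f z0 + a * - h3 + b * (- h3) ^+ 2))
  = 4 * nc (f z0).
  rewrite -!ReD -!mulrDr.
  have -> : f z0 + a * h1 + b * h1 ^+ 2 + (f z0 + a * - h1 + b * (- h1) ^+ 2) +
     (f z0 + a * h3 + b * h3 ^+ 2) + (f z0 + a * - h3 + b * (- h3) ^+ 2) =
     f z0 * 4 + (b * (h1 ^+ 2 + h3 ^+ 2)) * 2 by ring.
  have -> : h1 ^+ 2 + h3 ^+ 2 = 0 by rewrite /h3 /h1 exprMn sqr_i; ring.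
  rewrite mulr0 mul0r addr0 mulrA.
  have -> : (4 : R[i]) = (4 : R)%:C%C by rewrite rmorph_nat.
  by rewrite ReMr vE mulrC.
have ncS : nc (z0 + h1) ^+ 2 + nc (z0 - h1) ^+ 2 + nc (z0 + h3) ^+ 2 + nc (z0 - h3) ^+ 2
   = 4 * nc z0 ^+ 2 + 4 * m ^+ 2.
  rewrite !nc_sqr /h3 /h1; case: (z0) => x y; simpc => /=; ring.
(* Adding the four inequalities, the Taylor errors lose [2 eta m^2] while the squares of the moduli
   gain [4 eta m^2]. *)
have mm : 0 < eta * m ^+ 2 by rewrite mulr_gt0// exprn_gt0.
have e1 : eta * (nc (z0 + h1) ^+ 2 + nc (z0 - h1) ^+ 2 + nc (z0 + h3) ^+ 2 +
  nc (z0 - h3) ^+ 2) = 4 * (eta * nc z0 ^+ 2) + 4 * (eta * m ^+ 2).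
  by rewrite ncS; ring.
move: e1; rewrite !(mulrDr eta) /u; lra.
Qed.

End maximum_principle.

(** * Phragmen-Lindeloef in a narrow sector *)

Section phragmen_lindeloef.
Variable R : realType.

Definition entire2 (f : R[i] -> R[i]) := cdiff2 (fun=> True) f.

Lemma entire2_taylor f z : entire2 f ->
  exists a b : R[i], forall e : R, 0 < e -> exists2 r : R, 0 < r &
    forall h, nc h < r -> nc (f (z + h) - (f z + a * h + b * h ^+ 2)) <= e * nc h ^+ 2.
Proof. by move=> hf; apply: (cdiff2_taylor hf ltr01). Qed.

(** Used to remove the damping factor, by letting its strength [d] tend to 0. *)
Lemma exp_linear_le (y M X : R) : 0 < M -> 0 <= X ->
  (forall d, 0 < d -> y <= M * expR (d * X)) -> y <= M.
Proof.
move=> M0 X0 h; rewrite leNgt; apply/negP => My.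
have q1 : 1 < y / M by rewrite ltr_pdivlMr// mul1r.
have q0 : 0 < y / M by apply: lt_trans q1.
have l0 : 0 < ln (y / M) by rewrite ln_gt0.
have X1 : 0 < X + 1 by rewrite ltr_wpDl.
have := h (ln (y / M) / (X + 1)) (divr_gt0 l0 X1).
rewrite leNgt => /negP; apply; rewrite mulrC -ltr_pdivlMr//.
rewrite -[ltRHS]lnK// ltr_expR -mulrA gtr_pMr// mulrC ltr_pdivrMr// mul1r.
by rewrite ltrDl.
Qed.

Section sector.
Variable c : R.
Hypotheses (c0 : 0 < c) (c3 : 3 * c ^+ 2 < 1).

(** The left side bounds the real part of the cube of [x + i y]: the condition on [c] says that the
    half-angle is below pi/6, so cubing keeps the sector inside the right half-plane. *)
Lemma sector_cube (x y : R) : 0 <= x -> `|y| <= c * x ->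
  (1 - 3 * c ^+ 2) * x ^+ 3 <= x ^+ 3 - 3 * x * y ^+ 2.
Proof.
move=> x0 yx; have y2 : y ^+ 2 <= (c * x) ^+ 2.
  by rewrite -(real_normK (num_real y)) ler_sqr ?nnegrE ?mulr_ge0// ltW.
have : x * y ^+ 2 <= x * (c * x) ^+ 2 by rewrite ler_wpM2l.
rewrite exprMn; lra.
Qed.

(* The factor exp(-d w^3) decays like exp(-d' (Re w)^3) in the sector, which
   beats the growth of f. *)
Lemma sector_bound (f : R[i] -> R[i]) (A B M : R) : entire2 f -> 0 < A -> 0 <= B ->
  0 < M ->
  (forall w, `|Im w| <= c * Re w -> nc (f w) <= A * expR (B * Re w ^+ 2)) ->
  (forall w, 0 <= Re w -> `|Im w| = c * Re w -> nc (f w) <= M) ->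
  forall w, `|Im w| <= c * Re w -> nc (f w) <= M.
Proof.
move=> ef A0 B0 M0 hgrow hedge w hw.
have sec_pos z : `|Im z| <= c * Re z -> 0 <= Re z.
  by move=> h; rewrite -(pmulr_rge0 _ c0); apply: le_trans h.
have rew0 := sec_pos _ hw.
pose k := 1 - 3 * c ^+ 2; have k0 : 0 < k by rewrite subr_gt0.
have Re3 z : Re (z ^+ 3) = Re z ^+ 3 - 3 * Re z * Im z ^+ 2.
  by case: z => x y; rewrite !exprS !expr0; simpc => /=; ring.
have hcube z : `|Im z| <= c * Re z -> k * Re z ^+ 3 <= Re (z ^+ 3).
  by move=> h; rewrite Re3; apply: sector_cube => //; exact: sec_pos.
have X0 : 0 <= Re (w ^+ 3).
  by apply: le_trans (hcube _ hw); rewrite mulr_ge0 ?exprn_ge0// ltW.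
apply: (exp_linear_le M0 X0) => d d0.
pose F z := f z * cexp ((- d)%:C%C * z ^+ 3).
have ncF z : nc (F z) = nc (f z) * expR (- d * Re (z ^+ 3)).
  rewrite /F ncM nc_cexp; congr (_ * expR _).
  by rewrite mulrC ReMr mulrC.
have eF : entire2 F.
  apply: cdiff2M => //; apply: (@cdiff2_comp _ _ (@cexp R)); first exact: cdiff2_cexp.
  by apply: cdiff2M; [exact: cdiff2_cst|apply: cdiff2X; exact: cdiff2_id].
pose L := `|ln (M / A)|.
(* The truncation is far enough that on the edge [Re z = r] the exponent [B r^2 - d k r^3] is at
   most [- L r^2], hence at most [ln (M / A)]. *)
pose r := Num.max (Re w) (Num.max 1 ((B + L) / (d * k))).
have dk0 : 0 < d * k by rewrite mulr_gt0.
have rw : Re w <= r by rewrite le_max lexx.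
have r1 : 1 <= r by rewrite !le_max lexx !orbT.
have rB : B + L <= r * (d * k) by rewrite -ler_pdivrMr// !le_max lexx !orbT.
have r0 : 0 <= r by apply: le_trans r1.
have main : nc (F w) <= M.
  apply: (@maximum_principle R (trapezoid 0 r 0 c) F
    (fun z => Re z = r \/ `|Im z| = c * Re z)).
  - by apply: trapezoid_evt => // s /andP[s0 _]; rewrite add0r mulr_ge0// ltW.
  - by move=> z; apply: cdiff2_ccont eF _.
  - move=> z [/andP[z0 zr]]; rewrite add0r => zs [zE|zE]; rewrite ncF.
      have : nc (f z) * expR (- d * Re (z ^+ 3)) <=
          A * expR (B * r ^+ 2) * expR (- (d * (k * r ^+ 3))).
        apply: ler_pM; rewrite ?nc_ge0 ?expR_ge0//.
          by rewrite -zE; exact: hgrow.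
        by rewrite ler_expR mulNr lerN2 ler_wpM2l ?(ltW d0)// -zE hcube.
      move/le_trans; apply; rewrite -mulrA -expRD -ler_pdivlMl//.
      have MA : 0 < M / A by rewrite divr_gt0.
      rewrite [leRHS]mulrC -[leRHS]lnK// ler_expR.
      have -> : B * r ^+ 2 + - (d * (k * r ^+ 3)) = (B - r * (d * k)) * r ^+ 2 by ring.
      have Lle : - L <= ln (M / A) by rewrite lerNl /L -normrN ler_norm.
      apply: le_trans Lle; apply: le_trans (_ : - L * r ^+ 2 <= _).
        by rewrite ler_wpM2r ?sqr_ge0//; lra.
      rewrite mulNr lerN2 ler_peMr ?normr_ge0//; exact: exprn_ege1.
    rewrite -[leRHS]mulr1; apply: ler_pM; rewrite ?nc_ge0 ?expR_ge0//.
      exact: hedge.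
    rewrite -expR0 ler_expR mulNr oppr_le0 mulr_ge0 ?(ltW d0)//.
    by apply: le_trans (hcube _ zs); rewrite mulr_ge0 ?exprn_ge0 ?(ltW k0).
  - move=> z [/andP[z0 zr]]; rewrite add0r => zs nB; split; last exact: entire2_taylor.
    have zr' : Re z < r.
      by rewrite lt_neqAle zr andbT; apply/eqP => h; apply: nB; left.
    have zs' : `|Im z| < c * Re z.
      by rewrite lt_neqAle zs andbT; apply/eqP => h; apply: nB; right.
    have z0' : 0 < Re z by rewrite -(pmulr_rgt0 _ c0); apply: le_lt_trans zs'.
    pose rho := Num.min (Num.min (Re z) (r - Re z)) ((c * Re z - `|Im z|) / (1 + c)).
    have c1 : 0 < 1 + c by rewrite addr_gt0.
    exists rho; first by rewrite !lt_min z0' subr_gt0 zr' divr_gt0// subr_gt0.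
    move=> v; rewrite !lt_min ltr_pdivlMr// => /andP[/andP[v1 v2] v3].
    have hr : `|Re v - Re z| <= nc (v - z) by rewrite -ReN -ReD nc_Re.
    have hi : `|Im v - Im z| <= nc (v - z) by rewrite -ImN -ImD nc_Im.
    have hi' : `|Im v| <= nc (v - z) + `|Im z|.
      by rewrite -[Im v](subrK (Im z)); apply: le_trans (ler_normD _ _) _; rewrite lerD2r.
    move: hr; rewrite ler_norml => /andP[hr1 hr2].
    split; first by move: v1 v2 hr1 hr2; clear => *; apply/andP; split; lra.
    rewrite add0r; have : c * (- nc (v - z)) <= c * (Re v - Re z) by rewrite ler_wpM2l ?(ltW c0).
    by move: v3 hi'; clear => *; lra.
  - by split; [rewrite rew0 rw|rewrite add0r].
move: main; rewrite ncF mulNr expRN ler_pdivrMr ?expR_gt0//.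
Qed.

End sector.

(** [c] is the tangent of pi/8. The last equation is the double angle formula for pi/4: squaring
    opens the sector to [|Im z| <= Re z], and the fourth power to the right half-plane. *)
Lemma exists_sector_slope : exists c : R, [/\ 0 < c, 3 * c ^+ 2 < 1 & c ^+ 2 + 2 * c = 1].
Proof.
have s2 : Num.sqrt 2 ^+ 2 = 2 :> R by rewrite sqr_sqrtr.
have s0 : 0 <= Num.sqrt 2 :> R by exact: sqrtr_ge0.
set s := Num.sqrt 2 in s2 s0.
(* [3 (s - 1)^2 = 9 - 6 s], so the bound on the slope amounts to this inequality. *)
have s43 : 4 / 3 < s.
  rewrite ltNge; apply/negP => h.
  have : s * s <= 4 / 3 * (4 / 3) by apply: ler_pM.
  by rewrite -expr2 s2; lra.
by exists (s - 1); split; [lra|rewrite sqrrB expr1n s2; lra|rewrite sqrrB expr1n s2; lra].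
Qed.

Lemma Re_sqr (z : R[i]) : Re (z ^+ 2) = Re z ^+ 2 - Im z ^+ 2.
Proof. by case: z => x y; rewrite expr2; simpc. Qed.

Lemma Im_sqr (z : R[i]) : Im (z ^+ 2) = 2 * (Re z * Im z).
Proof. by case: z => x y; rewrite expr2; simpc => /=; ring. Qed.

Lemma exists_sqrt_right (z : R[i]) : 0 <= Re z -> exists2 v, v ^+ 2 = z & `|Im v| <= Re v.
Proof.
have [v0 v0E] : exists v, v ^+ 2 = z by exists (sqrtc z); exact: sqr_sqrtc.
have [v vE v_ge0] : exists2 v, v ^+ 2 = z & 0 <= Re v.
  have [h|h] := leP 0 (Re v0); first by exists v0.
  by exists (- v0); rewrite ?sqrrN// ReN oppr_ge0 ltW.
move=> z0; exists v => //; rewrite -(ger0_norm v_ge0) -ler_sqr ?nnegrE//.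
by rewrite !real_normK ?num_real// -subr_ge0; move: z0; rewrite -vE Re_sqr.
Qed.

Section slope.
Variable c : R.
Hypotheses (c0 : 0 < c) (c1 : c ^+ 2 + 2 * c = 1).

Lemma exists_sqrt_sector (z : R[i]) : `|Im z| <= Re z ->
  exists2 w, w ^+ 2 = z & `|Im w| <= c * Re w.
Proof.
move=> hz; have z0 : 0 <= Re z by apply: le_trans hz.
have [w wE hw] := exists_sqrt_right z0; exists w => //.
have x0 : 0 <= Re w by apply: le_trans hw.
move: hz hw x0; rewrite -wE Re_sqr Im_sqr; move: (Re w) (Im w) => x y yx0 yx x0.
move: yx0; have -> : x ^+ 2 - y ^+ 2 = x * x - `|y| * `|y|.
  by rewrite -!expr2 real_normK ?num_real.
rewrite !normrM (ger0_norm x0) ger0_norm// => h.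
rewrite leNgt; apply/negP => cy.
have y0 := normr_ge0 y.
have cx0 : 0 <= c * x by rewrite mulr_ge0// ltW.
(* The product equals [y^2 + 2 x |y| - x^2] by the equation for [c], and the hypothesis on [w ^+ 2]
   makes this nonpositive. *)
have : 0 < (`|y| - c * x) * (`|y| + c * x + 2 * x).
  by rewrite mulr_gt0 ?subr_gt0//; lra.
have -> : (`|y| - c * x) * (`|y| + c * x + 2 * x) =
    `|y| * `|y| + 2 * (x * `|y|) - (c ^+ 2 + 2 * c) * (x * x) by ring.
rewrite c1; lra.
Qed.

Lemma sector_sqr (w : R[i]) : `|Im w| <= c * Re w -> `|Im (w ^+ 2)| <= Re (w ^+ 2).
Proof.
move=> hw; have x0 : 0 <= Re w.
  by rewrite -(pmulr_rge0 _ c0); apply: le_trans hw.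
move: hw x0; rewrite Re_sqr Im_sqr; move: (Re w) (Im w) => x y yx x0.
have -> : x ^+ 2 - y ^+ 2 = x * x - `|y| * `|y|.
  by rewrite -!expr2 real_normK ?num_real.
rewrite !normrM (ger0_norm x0) ger0_norm//.
have y0 := normr_ge0 y.
have h1 : `|y| * `|y| <= c * x * (c * x) by apply: ler_pM.
have h2 : x * `|y| <= x * (c * x) by rewrite ler_wpM2l.
have : (c ^+ 2 + 2 * c) * (x * x) = x * x by rewrite c1 mul1r.
rewrite mulrDl expr2; lra.
Qed.

Lemma sector_pow4 (w : R[i]) : `|Im w| <= c * Re w -> 0 <= Re (w ^+ 4).
Proof.
move=> /sector_sqr; rewrite (_ : w ^+ 4 = (w ^+ 2) ^+ 2); last by rewrite -exprM.
move: (w ^+ 2) => v; rewrite Re_sqr subr_ge0; move: (Re _) (Im _) => x y yx.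
by rewrite -(real_normK (num_real y)) ler_sqr ?nnegrE//; apply: le_trans yx.
Qed.

End slope.
End phragmen_lindeloef.

(** * Quadrants and half-planes *)

Section half_plane.
Variable R : realType.

Lemma complex_eqP (z w : R[i]) : Re z = Re w -> Im z = Im w -> z = w.
Proof. by case: z => a b; case: w => a' b' /= -> ->. Qed.

Lemma ReM (z w : R[i]) : Re (z * w) = Re z * Re w - Im z * Im w.
Proof. by case: z => a b; case: w => a' b'; simpc. Qed.

Lemma ImM (z w : R[i]) : Im (z * w) = Re z * Im w + Im z * Re w.
Proof. by case: z => a b; case: w => a' b'; simpc. Qed.

Lemma sector_edge_sqr (c : R) (w : R[i]) : c ^+ 2 + 2 * c = 1 -> 0 <= c ->
  `|Im w| = c * Re w -> exists2 r : R, 0 <= r &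
    w ^+ 2 = r%:C%C * (1 + 'i%C) \/ w ^+ 2 = r%:C%C * (1 - 'i%C).
Proof.
move=> c1 c0 hw; exists (2 * c * Re w ^+ 2); first by apply: mulr_ge0; rewrite ?sqr_ge0 ?mulr_ge0//.
have x2 : Re w ^+ 2 - (c * Re w) ^+ 2 = 2 * c * Re w ^+ 2.
  have -> : Re w ^+ 2 - (c * Re w) ^+ 2 =
      (c ^+ 2 + 2 * c) * Re w ^+ 2 - (c * Re w) ^+ 2 by rewrite c1 mul1r.
  ring.
have [h|h] : Im w = c * Re w \/ Im w = - (c * Re w).
  by rewrite -hw; have [_|_] := ger0P (Im w); [left|right; rewrite opprK].
- left; apply: complex_eqP; rewrite ?Re_sqr ?Im_sqr ?ReM ?ImM ?ReD ?ImD /= h ?x2; ring.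
- right; apply: complex_eqP; rewrite ?Re_sqr ?Im_sqr ?ReM ?ImM ?ReD ?ImD ?ReN ?ImN /= h.
    by rewrite sqrrN x2; ring.
  by ring.
Qed.

(** The quadrant is [u (1 + i)] times the sector [|Im z| <= Re z]. Writing [z = w^2] halves the
    angle, so that cubic damping applies, and turns growth of order 1 into the order 2 allowed by
    [sector_bound]. *)
Lemma quadrant_bound (F : R[i] -> R[i]) (u : R[i]) (A B M : R) : entire2 F ->
  0 < A -> 0 <= B -> 0 < M -> nc u = 1 ->
  (forall z, nc (F z) <= A * expR (B * nc z)) ->
  (forall r : R, 0 <= r -> nc (F (u * r%:C%C)) <= M) ->
  (forall r : R, 0 <= r -> nc (F (u * ('i%C * r%:C%C))) <= M) ->
  forall z, `|Im z| <= Re z -> nc (F (u * ((1 + 'i%C) * z))) <= M.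
Proof.
move=> eF A0 B0 M0 u1 hgrow hr hi z hz.
have [c [c0 c3 c1]] := exists_sector_slope R.
have clt1 : c < 1 by have := sqr_ge0 c; lra.
have [w wE hw] := exists_sqrt_sector c0 c1 hz; rewrite -wE.
have B40 : 0 <= 4 * B by rewrite mulr_ge0.
apply: (@sector_bound R c c0 c3 (fun w => F (u * ((1 + 'i%C) * w ^+ 2))) A (4 * B) M) => //.
- apply: (@cdiff2_comp _ _ F) => //; apply: cdiff2M; first exact: cdiff2_cst.
  by apply: cdiff2M; [exact: cdiff2_cst|apply: cdiff2X; exact: cdiff2_id].
- move=> v hv; apply: le_trans (hgrow _) _.
  rewrite ler_wpM2l ?(ltW A0)// ler_expR.
  (* The 4 absorbs [|1 + i| <= 2] and [|v|^2 <= 2 (Re v)^2], as the slope is below 1. *)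
  have -> : 4 * B * Re v ^+ 2 = B * (4 * Re v ^+ 2) by ring.
  rewrite ler_wpM2l//.
  rewrite [v ^+ 2]expr2 !ncM u1 mul1r -[nc v * _]expr2 nc_sqr.
  have i2 : nc (1 + 'i%C : R[i]) <= 2.
    by apply: le_trans (ncD _ _) _; rewrite nc1 nc_i.
  have x0 : 0 <= Re v by rewrite -(pmulr_rge0 _ c0); apply: le_trans hv.
  have y2 : Im v ^+ 2 <= Re v ^+ 2.
    rewrite -(real_normK (num_real (Im v))) ler_sqr ?nnegrE//.
    by apply: le_trans hv _; rewrite ler_piMl// ltW.
  apply: le_trans (_ : 2 * (Re v ^+ 2 + Im v ^+ 2) <= _); last by lra.
  by rewrite ler_wpM2r ?addr_ge0 ?sqr_ge0.
- move=> v v0 /(sector_edge_sqr c1 (ltW c0))[r r0 [->|->]].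
    have -> : u * ((1 + 'i%C) * (r%:C%C * (1 + 'i%C))) = u * ('i%C * (2 * r)%:C%C).
      congr (_ * _); apply: complex_eqP; rewrite ?ReM ?ImM /=; ring.
    by apply: hi; rewrite mulr_ge0.
  have -> : u * ((1 + 'i%C) * (r%:C%C * (1 - 'i%C))) = u * (2 * r)%:C%C.
    congr (_ * _); apply: complex_eqP; rewrite ?ReM ?ImM /=; ring.
  by apply: hr; rewrite mulr_ge0.
Qed.

(** The two quadrants give the provisional bound [max M C]. Once [F] is bounded, the whole
    half-plane can be parametrized by fourth powers from the sector; its edges go to the real axis,
    so [C] disappears from the bound. *)
Lemma half_plane_bound (F : R[i] -> R[i]) (A B C M : R) : entire2 F ->
  0 < A -> 0 <= B -> 0 < M ->
  (forall z, nc (F z) <= A * expR (B * nc z)) ->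
  (forall x : R, nc (F x%:C%C) <= M) ->
  (forall y : R, 0 <= y -> nc (F ('i%C * y%:C%C)) <= C) ->
  forall z, 0 <= Im z -> nc (F z) <= M.
Proof.
move=> eF A0 B0 M0 hgrow hR hI z z0.
pose M1 := Num.max M C.
have M10 : 0 < M1 by rewrite lt_max M0.
have hR1 x : nc (F x%:C%C) <= M1 by rewrite le_max hR.
have hI1 (y : R) : 0 <= y -> nc (F ('i%C * y%:C%C)) <= M1.
  by move=> /hI h; rewrite le_max h orbT.
have ii : 'i%C * 'i%C = -1 :> R[i] by rewrite -expr2 sqr_i.
have hup v : 0 <= Im v -> nc (F v) <= M1.
  move=> v0; have [vr|/ltW vr] := leP 0 (Re v).
    have -> : v = 1 * ((1 + 'i%C) * ((Re v + Im v) / 2 +i* ((Im v - Re v) / 2))%C).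
      by rewrite mul1r; apply: complex_eqP; rewrite ?ReM ?ImM /=; field.
    apply: (quadrant_bound eF A0 B0 M10 (nc1 R) hgrow) => [r _|r r0|].
    - by rewrite mul1r.
    - by rewrite mul1r; exact: hI1.
    - by rewrite /= ler_norml; apply/andP; split; lra.
  have -> : v = 'i%C * ((1 + 'i%C) * ((Im v - Re v) / 2 +i* ((- Re v - Im v) / 2))%C).
    by apply: complex_eqP; rewrite ?ReM ?ImM /=; field.
  apply: (quadrant_bound eF A0 B0 M10 (nc_i R) hgrow) => [r r0|r r0|].
  - exact: hI1.
  - rewrite mulrA ii mulN1r (_ : - r%:C%C = (- r)%:C%C)//.
    by rewrite rmorphN.
  - by rewrite /= ler_norml; apply/andP; split; lra.
have [c [c0 c3 c1]] := exists_sector_slope R.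
have zr : 0 <= Re (- 'i%C * z) by rewrite ReM /=; lra.
have [v vE hv] := exists_sqrt_right zr.
have [w wE hw] := exists_sqrt_sector c0 c1 hv.
have zE : z = 'i%C * w ^+ 4.
  rewrite (_ : w ^+ 4 = (w ^+ 2) ^+ 2); last by rewrite -exprM.
  by rewrite wE vE mulrA mulrN ii opprK mul1r.
rewrite zE.
apply: (@sector_bound R c c0 c3 (fun w => F ('i%C * w ^+ 4)) M1 0 M) => //.
- apply: (@cdiff2_comp _ _ F) => //; apply: cdiff2M; first exact: cdiff2_cst.
  by apply: cdiff2X; exact: cdiff2_id.
- move=> t ht; rewrite mul0r expR0 mulr1; apply: hup.
  by have := sector_pow4 c0 c1 ht; rewrite ImM; move: (t ^+ 4) => p /=; lra.
- move=> t t0 /(sector_edge_sqr c1 (ltW c0))[r r0 h].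
  have -> : t ^+ 4 = (t ^+ 2) ^+ 2 by rewrite -exprM.
  case: h => ->.
    have -> : 'i%C * (r%:C%C * (1 + 'i%C)) ^+ 2 = (- (2 * r ^+ 2))%:C%C.
      by rewrite expr2; apply: complex_eqP; rewrite ?ReM ?ImM /=; ring.
    exact: hR.
  have -> : 'i%C * (r%:C%C * (1 - 'i%C)) ^+ 2 = (2 * r ^+ 2)%:C%C.
    by rewrite expr2; apply: complex_eqP; rewrite ?ReM ?ImM /=; ring.
  exact: hR.
Qed.

(** If [y < x], the powers of [x / y] would stay below [1 / x], against Bernoulli's inequality. *)
Lemma pow_ratio_le (x y : R) : 0 <= x -> 0 < y ->
  (forall n, x ^+ n.+1 <= y ^+ n) -> x <= y.
Proof.
move=> x0 y0 h; rewrite leNgt; apply/negP => yx.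
have xp : 0 < x by apply: lt_trans yx.
pose t := x / y - 1; have t0 : 0 < t by rewrite subr_gt0 ltr_pdivlMr// mul1r.
have bern n : 1 + t * n%:R <= (x / y) ^+ n.
  elim: n => [|n IH]; first by rewrite mulr0 addr0 expr0.
  rewrite exprS; apply: le_trans (_ : x / y * (1 + t * n%:R) <= _); last first.
    by rewrite ler_wpM2l// divr_ge0// ltW.
  have -> : x / y = 1 + t by rewrite /t addrC subrK.
  have : 0 <= t * (t * n%:R) by rewrite !mulr_ge0// ltW.
  by rewrite -natr1; lra.
pose n := (Num.truncn (x^-1 / t)).+1.
have hn : x^-1 < t * n%:R by rewrite mulrC -ltr_pdivrMr//; exact: truncnS_gt.
have := h n; rewrite exprS -ler_pdivlMr ?exprn_gt0//.
have yn : 0 < y ^+ n by rewrite exprn_gt0.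
rewrite leNgt => /negP; apply; rewrite ltr_pdivrMr ?exprn_gt0//.
have : x^-1 < (x / y) ^+ n by apply: lt_le_trans (bern n); lra.
rewrite expr_div_n ltr_pdivlMr// -(ltr_pM2l xp) mulrA divff ?gt_eqF// mul1r.
done.
Qed.

End half_plane.

(** * Cauchy's estimate *)

Section cauchy_estimate.
Variable R : realType.

(* Schwarz lemma for D h = Q (z0 + h) - Q z0 without removing the singularity of
   D h / h: the maximum principle is applied to D h ^ (n+1) / h ^ n, which
   vanishes at 0, and then n tends to infinity. *)
Lemma cauchy_bound (Q g : R[i] -> R[i]) (z0 : R[i]) (S : R) :
  entire2 Q -> cdiff Q z0 (g z0) -> 0 < S ->
  (forall h, `|Re h| <= 1 -> `|Im h| <= 1 -> nc (Q (z0 + h)) <= S) ->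
  nc (g z0) <= 2 * S.
Proof.
move=> eQ dQ S0 hS; pose D h := Q (z0 + h) - Q z0; pose M := 2 * S.
have M0 : 0 < M by rewrite mulr_gt0.
have D0 : D 0 = 0 by rewrite /D addr0 subrr.
have DM h : `|Re h| <= 1 -> `|Im h| <= 1 -> nc (D h) <= M.
  move=> h1 h2; apply: le_trans (ncB _ _) _; rewrite /M mulrDl mul1r lerD ?hS//.
  by rewrite -[z0]addr0 hS//= normr0.
have eD : entire2 D.
  apply: cdiff2D; last exact: cdiff2_cst.
  apply: (@cdiff2_comp _ _ Q) => //.
  by apply: cdiff2D; [exact: cdiff2_cst|exact: cdiff2_id].
have [rho rho0 hrho] : exists2 rho : R, 0 < rho &
    forall h, nc h < rho -> nc (D h) <= (nc (g z0) + 1) * nc h.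
  move/cdiffP: dQ => /(_ _ ltr01)[r r0 hr]; exists r => // h.
  have := hr (z0 + h); rewrite [z0 + h - z0]addrC addKr mul1r => hh /hh hD.
  have -> : D h = (Q (z0 + h) - Q z0 - g z0 * h) + g z0 * h by rewrite /D; ring.
  by apply: le_trans (ncD _ _) _; rewrite ncM mulrDl mul1r addrC lerD2l.
set G := nc (g z0) + 1 in hrho.
have G0 : 0 < G by rewrite ltr_wpDl ?nc_ge0.
have key n h : `|Re h| <= 1 -> `|Im h| <= 1 -> h != 0 ->
    nc (D h) ^+ n.+1 <= M ^+ n.+1 * nc h ^+ n.
  move=> h1 h2 h0; pose k v := D v ^+ n.+1 * v^-1 ^+ n.
  have k0 : k 0 = 0 by rewrite /k D0 exprS !mul0r.
  have ek : cdiff2 (fun v => v != 0) k.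
    apply: cdiff2M; apply: cdiff2X; last exact: cdiff2_inv.
    by case: eD => f1 [f2 hf]; exists f1, f2 => z _; exact: hf.
  have nk v : v != 0 -> nc (k v) = nc (D v) ^+ n.+1 / nc v ^+ n.
    by move=> v0; rewrite /k ncM !ncX ncV exprVn.
  suff : nc (k h) <= M ^+ n.+1.
    by rewrite nk// ler_pdivrMr// exprn_gt0// nc_gt0.
  apply: (@maximum_principle R (trapezoid (-1) 1 1 0) k
    (fun v => v = 0 \/ (`|Re v| = 1 \/ `|Im v| = 1))).
  - apply: trapezoid_evt => [|s _]; first lra.
    by rewrite mul0r addr0 ler01.
  (* Near 0, [|D w| <= G |w|] gives [|k w| <= G^(n+1) |w|]: the surplus factor [D] in the numerator
     makes [k] continuous there. *)
  - move=> z; have [->|z0'] := eqVneq z 0; last exact: cdiff2_ccont ek _.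
    move=> e e0; have Gn : 0 < G ^+ n.+1 by rewrite exprn_gt0.
    exists (Num.min rho (e / G ^+ n.+1)) => [|w]; first by rewrite lt_min rho0 divr_gt0.
    rewrite subr0 lt_min ltr_pdivlMr// k0 subr0 => /andP[/hrho w1 w2].
    have [->|w0] := eqVneq w 0; first by rewrite k0 nc0 ltW.
    have nw : 0 < nc w by rewrite nc_gt0.
    rewrite nk// ler_pdivrMr ?exprn_gt0//.
    apply: le_trans (_ : (G * nc w) ^+ n.+1 <= _).
      by rewrite lerXn2r ?nnegrE ?nc_ge0// mulr_ge0 ?nc_ge0// ltW.
    rewrite exprMn [nc w ^+ n.+1]exprS mulrA ler_wpM2r ?exprn_ge0 ?nc_ge0//.
    by rewrite mulrC ltW.
  - move=> v [v1]; rewrite mul0r addr0 => v2.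
    have v1' : `|Re v| <= 1 by rewrite ler_norml.
    have [->|v0] := eqVneq v 0; first by rewrite k0 nc0 exprn_ge0// ltW.
    move=> [v0'|hv]; first by rewrite v0' eqxx in v0.
    have nv : 1 <= nc v by case: hv => <-; rewrite ?nc_Re ?nc_Im.
    rewrite nk// ler_pdivrMr ?exprn_gt0 ?nc_gt0//.
    rewrite -[leLHS]mulr1; apply: ler_pM; rewrite ?exprn_ge0 ?nc_ge0 ?ler01//.
      by rewrite lerXn2r ?nnegrE ?nc_ge0 ?(ltW M0)// DM.
    exact: exprn_ege1.
  - move=> v [v1]; rewrite mul0r addr0 => v2 nB.
    have v1' : `|Re v| <= 1 by rewrite ler_norml.
    have v0 : v != 0 by apply/eqP => h'; apply: nB; left.
    have v1s : `|Re v| < 1.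
      by rewrite lt_neqAle v1' andbT; apply/eqP => h'; apply: nB; right; left.
    have v2s : `|Im v| < 1.
      by rewrite lt_neqAle v2 andbT; apply/eqP => h'; apply: nB; right; right.
    split; last first.
      have nv : 0 < nc v by rewrite nc_gt0.
      apply: (cdiff2_taylor ek nv) => w wv; apply/eqP => w0.
      by move: wv; rewrite w0 sub0r ncN ltxx.
    exists (Num.min (1 - `|Re v|) (1 - `|Im v|)); first by rewrite lt_min !subr_gt0 v1s.
    move=> w; rewrite lt_min => /andP[w1 w2].
    have hr : `|Re w - Re v| <= nc (w - v) by rewrite -ReN -ReD nc_Re.
    have hi : `|Im w - Im v| <= nc (w - v) by rewrite -ImN -ImD nc_Im.
    have wr : `|Re w| <= 1.
      rewrite -[Re w](subrK (Re v)); apply: le_trans (ler_normD _ _) _.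
      by move: hr w1; clear => *; lra.
    have wi : `|Im w| <= 1.
      rewrite -[Im w](subrK (Im v)); apply: le_trans (ler_normD _ _) _.
      by move: hi w2; clear => *; lra.
    by split; [rewrite -ler_norml|rewrite mul0r addr0].
  - by split; [rewrite -ler_norml|rewrite mul0r addr0].
have Dle h : `|Re h| <= 1 -> `|Im h| <= 1 -> nc (D h) <= M * nc h.
  move=> h1 h2; have [->|h0] := eqVneq h 0; first by rewrite D0 nc0 mulr0.
  have nh : 0 < nc h by rewrite nc_gt0.
  rewrite mulrC -ler_pdivrMr//; apply: pow_ratio_le => //.
    by rewrite divr_ge0 ?nc_ge0// ltW.
  move=> n; rewrite expr_div_n ler_pdivrMr ?exprn_gt0// mulrC; exact: key.
(* The difference quotient at a small real increment [m] transfers [|D m| <= M m] to the derivative,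
   up to [e]. *)
apply/ler_addgt0Pr => e e0.
move/cdiffP: dQ => /(_ _ e0)[r r0 hr].
pose m := Num.min r 1 / 2.
have mr0 : 0 < Num.min r 1 by rewrite lt_min r0 ltr01.
have m0 : 0 < m by rewrite divr_gt0.
have mlt : m < Num.min r 1 by rewrite ltr_pdivrMr// ltr_pMr// ltr1n.
move: mlt; rewrite lt_min => /andP[mr m1].
have := hr (z0 + m%:C%C); rewrite [z0 + m%:C%C - z0]addrC addKr ncR (gtr0_norm m0).
move=> /(_ mr) h1.
have hm1 : `|Re m%:C%C| <= 1 by rewrite /= (gtr0_norm m0) ltW.
have hm2 : `|Im m%:C%C| <= 1 by rewrite /= normr0.
have := Dle _ hm1 hm2; rewrite ncR (gtr0_norm m0) => h2.
rewrite -(ler_pM2r m0) mulrDl -[m in leLHS](gtr0_norm m0) -ncR -ncM.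
have -> : g z0 * m%:C%C = D m%:C%C - (Q (z0 + m%:C%C) - Q z0 - g z0 * m%:C%C).
  by rewrite /D; ring.
by apply: le_trans (ncB _ _) _; apply: lerD.
Qed.

End cauchy_estimate.

(** * Bounds for Paley-Wiener functions *)

Section paley_wiener_bound.
Variable R : realType.
Implicit Types g : R[i] -> R[i].

Lemma entire_cdiff g : entire g -> forall z, exists d, cdiff g z d.
Proof.
move=> eg z; have /cvg_ex[d /cvgrPdist_le hd] := eg z.
exists d; apply/cdiffP => e e0.
have e0' : 0 < e%:C%C :> R[i] by rewrite ltcR.
have [r /= r0 hr] := hd _ e0'.
have rE : r = (Re r)%:C%C by rewrite RRe_real// ger0_real// ltW.
have r0' : 0 < Re r by move: r0; rewrite rE ltcR.
exists (Re r) => // w wz.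
have [->|wz0] := eqVneq w z; first by rewrite !subrr mulr0 subr0 nc0 mulr0.
have h0 : w - z != 0 by rewrite subr_eq0.
have := hr (w - z); rewrite /= sub0r normrN => /(_ _ h0).
have nE (v : R[i]) : `|v| = (nc v)%:C%C by [].
rewrite !nE rE ltcR => /(_ wz); rewrite lecR.
have -> : (w - z)^-1 *: (g ((w - z) *: 1 + z) - g z) = (g w - g z) / (w - z).
  by rewrite [(w - z) *: 1]mulr1 subrK [LHS]mulrC.
move=> hle; have -> : g w - g z - d * (w - z) = (d - (g w - g z) / (w - z)) * - (w - z).
  by field.
by rewrite ncM ncN ler_wpM2r ?nc_ge0.
Qed.

Lemma lt_log_growth g (b y : R) : y != 0 -> (log_growth g y < b%:E)%E ->
  nc (g (0 +i* y)%C) <= expR (b * `|y|).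
Proof.
move=> y0; rewrite /log_growth; set r := nc _.
have yp : 0 < `|y| by rewrite normr_gt0.
have : 0 <= r by exact: nc_ge0.
rewrite le_eqVlt => /predU1P[<-|r0]; first by rewrite expR_ge0.
rewrite lne_EFin// -EFinM lte_fin ltr_pdivrMr// => h.
by rewrite -[leLHS]lnK ?posrE// ler_expR ltW.
Qed.

Lemma limf_esup_near (f : R -> \bar R) (F : set (set R)) (b : R) :
  (limf_esup f F <= b%:E)%E -> exists2 V, F V & forall y, V y -> (f y < (b + 1)%:E)%E.
Proof.
move=> h; have : (limf_esup f F < (b + 1)%:E)%E.
  by apply: le_lt_trans h _; rewrite lte_fin ltrDl.
move=> /ereal_inf_lt[_ [V FV <-] hV]; exists V => // y Vy.
by apply: le_lt_trans hV; apply: ereal_sup_ubound; exists y.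
Qed.

(** Far out, the upper limits give the exponent with slack 1; on the remaining bounded segment the
    crude exponential bound is a constant. *)
Lemma imaginary_growth g (b : R) (A B : R) : 0 <= b ->
  (forall z, nc (g z) <= A * expR (B * nc z)) ->
  (limf_esup (log_growth g) +oo%R <= b%:E)%E ->
  (limf_esup (log_growth g) -oo%R <= b%:E)%E ->
  exists2 C : R, 0 < C & forall y : R, nc (g (0 +i* y)%C) <= C * expR ((b + 1) * `|y|).
Proof.
move=> b0 hg /limf_esup_near[V [Y [Yr hY]] hV] /limf_esup_near[V' [Y' [Yr' hY']] hV'].
pose T := `|Y| + `|Y'| + 1.
pose C := Num.max 1 (`|A| * expR (`|B| * T)).
have C0 : 0 < C by rewrite lt_max ltr01.
exists C => // y.
have b1 : 0 <= b + 1 by rewrite addr_ge0.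
have [yT|yT] := leP (`|y|) T.
  apply: le_trans (_ : C <= _); last first.
    by rewrite ler_peMr ?(ltW C0)// -[leLHS]expR0 ler_expR mulr_ge0.
  rewrite le_max; apply/orP; right; apply: le_trans (hg _) _.
  have ny : nc (0 +i* y)%C = `|y| by rewrite nc_complex expr0n add0r sqrtr_sqr.
  apply: ler_pM; rewrite ?expR_ge0//.
  - have := nc_ge0 (g 0); have := hg 0; rewrite nc0 mulr0 expR0 mulr1 => h1 h2.
    exact: le_trans h2 h1.
  - exact: ler_norm.
  - rewrite ler_expR ny; apply: le_trans (_ : `|B| * `|y| <= _).
      by rewrite ler_wpM2r// ler_norm.
    by rewrite ler_wpM2l.
have yn0 : y != 0.
  rewrite -normr_gt0; apply: lt_trans yT; rewrite /T ltr_wpDl// addr_ge0//.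
have lg : (log_growth g y < (b + 1)%:E)%E.
  have [y0|y0] := leP 0 y.
    apply: hV; apply: hY; move: yT; rewrite (ger0_norm y0) /T.
    have := ler_norm Y; have := normr_ge0 Y'; lra.
  apply: hV'; apply: hY'; move: yT; rewrite (ltr0_norm y0) /T.
  have := ler_norm (- Y'); rewrite normrN; have := normr_ge0 Y; lra.
apply: le_trans (lt_log_growth yn0 lg) _.
by rewrite ler_peMl ?expR_ge0// le_max lexx.
Qed.

Lemma PW_norm_le1 g : (PW_norm g <= 1)%E ->
  (\int[@lebesgue_measure R]_x (real_modulus g x ^+ 2)%:E <= 1)%E.
Proof.
rewrite /PW_norm => h.
set p := (X in (X <= 1)%E) in h.
have p0 : p \in `[0%E, +oo%E] by rewrite in_itv/= Lnorm_ge0 leey.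
have o0 : 1%E \in `[0%E : \bar R, +oo%E] by rewrite in_itv/= lee01 leey.
have := gt0_ler_poweR (ler0n R 2) p0 o0 h.
rewrite poweR_Lnorm ?pnatr_eq0// poweR1r; apply: le_trans.
rewrite le_eqVlt; apply/orP; left; apply/eqP; apply: eq_integral => x _ /=.
rewrite powR_mulrn ?normr_ge0// ger0_norm//.
exact: nc_ge0.
Qed.

Lemma ftc_abs_le (F f G : R -> R) (a b : R) : a <= b ->
  (forall x : R, is_derive x 1 F (f x)) -> continuous f ->
  (forall x, `|f x| <= G x) -> continuous G ->
  (\int[@lebesgue_measure R]_x (G x)%:E <= 1)%E -> `|F b - F a| <= 1.
Proof.
rewrite le_eqVlt => /predU1P[->|ab] dF cf fG cG G1.
  by rewrite subrr normr0 ler01.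
have cF := continuous_is_derive dF.
have E := @continuous_FTC2 R f F a b ab (continuous_subspaceT cf).
have {}E : (\int[@lebesgue_measure R]_(x in `[a, b]) (f x)%:E = (F b)%:E - (F a)%:E)%E.
  apply: E.
    split=> [x _||].
    - exact: (@ex_derive _ _ _ _ _ _ _ (dF x)).
    - exact/cvg_at_right_filter/cF.
    - exact/cvg_at_left_filter/cF.
  move=> x _; rewrite derive1E; exact: (@derive_val _ _ _ _ _ _ _ (dF x)).
have mf : measurable_fun `[a, b] (EFin \o f).
  apply/measurable_EFinP; apply: measurable_funTS; exact: continuous_measurable_fun.
have mG : measurable_fun setT (EFin \o G).
  apply/measurable_EFinP; exact: continuous_measurable_fun.
rewrite -lee_fin; apply: le_trans G1.
have -> : (`|F b - F a|%:E = `| \int[@lebesgue_measure R]_(x in `[a, b]) (f x)%:E |)%E.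
  by rewrite E.
apply: le_trans (le_abse_integral (@lebesgue_measure R) (measurable_itv `[a, b]) mf) _.
have G0 x : 0 <= G x by apply: le_trans (fG x).
apply: (@le_trans _ _ (\int[@lebesgue_measure R]_(x in `[a, b]) (G x)%:E)%E).
  apply: ge0_le_integral; [exact: measurable_itv|by []|exact: measurableT_comp| |].
    exact: measurable_funTS.
  by move=> x _; rewrite /= lee_fin.
apply: ge0_subset_integral => //=.
by move=> x _; rewrite lee_fin.
Qed.

Lemma ucont_line (u : R[i] -> R) : ucont u -> continuous (fun t : R => u t%:C%C).
Proof.
move=> cu x; apply/cvgrPdist_le => e e0.
have [r r0 hr] := cu x%:C%C e e0; exists r => // y xy.
by rewrite distrC; apply: hr; rewrite -cRB ncR distrC.
Qed.

(* The antiderivative Q of g^2 is bounded by 2 on the real axis because the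
   integral of |g|^2 is at most 1; Phragmen-Lindeloef propagates this bound. *)
Theorem RPW_bound g (b : R) : 0 <= b -> RPW b g -> (PW_norm g <= 1)%E ->
  forall z, nc (g z) ^+ 2 <= 4 * expR ((2 * b + 3) * (`|Im z| + 1)).
Proof.
move=> b0 [eg [A [B hg]] [gy gNy] _ _] g1.
have {}hg z : nc (g z) <= (`|A| + 1) * expR (`|B| * nc z).
  apply: le_trans (hg z) _; apply: ler_pM; rewrite ?expR_ge0//.
  - have := nc_ge0 (g 0); have := hg 0; rewrite nc0 mulr0 expR0 mulr1 => h1 h2.
    exact: le_trans h2 h1.
  - by apply: le_trans (ler_norm _) _; rewrite lerDl.
  - by rewrite ler_expR ler_wpM2r ?nc_ge0// ler_norm.
have [C C0 hC] := imaginary_growth b0 hg gy gNy.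
have dg := entire_cdiff eg.
have cg z : ccont g z by have [d /cdiff_ccont] := dg z.
pose g2 z := g z * g z.
have dg2 z : exists d, cdiff g2 z d.
  by have [d hd] := dg z; exists (d * g z + g z * d); exact: cdiffM.
have [Q0 hQ0] := entire_primitive dg2.
pose Q z := Q0 z + - Q0 0.
have hQ z : cdiff Q z (g2 z).
  by rewrite -[g2 z]addr0; apply: cdiffD => //; exact: cdiff_cst.
have Q00 : Q 0 = 0 by rewrite /Q subrr.
have eQ : entire2 Q.
  have [d hd] := choice dg2; exists g2, d => z _; split => //.
pose A1 := `|A| + 1; have A10 : 0 < A1 by rewrite ltr_wpDl.
(* [Q] vanishes at 0, so it is estimated by integrating [g2] along the ray to [z]. *)
have Qray z (M : R) : (forall t : R, 0 <= t <= 1 -> nc (g (z * t%:C%C)) ^+ 2 <= M) ->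
    nc (Q z) <= 2 * M * nc z.
  move=> hM; have := @mean_value_ineq R (fun t => Q (0 + z * t%:C%C))
    (fun t => g2 (0 + z * t%:C%C) * z) 0 1 (M * nc z).
  rewrite mulr1 mulr0 !add0r Q00 !subr0 normr1 mulr1 mulrA; apply=> t.
    by move=> _; apply: rdiff_line.
  rewrite (min_idPl ler01) (max_idPr ler01) add0r => ht.
  by rewrite /g2 !ncM -expr2 ler_wpM2r ?nc_ge0// hM.
have growth z : nc (Q z) <= 2 * A1 ^+ 2 * expR ((2 * `|B| + 1) * nc z).
  apply: le_trans (@Qray z (A1 ^+ 2 * expR (2 * `|B| * nc z)) _) _.
    move=> t /andP[t0 t1].
    have nt : nc (z * t%:C%C) <= nc z by rewrite ncM ncR ger0_norm// ler_piMr ?nc_ge0.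
    have -> : A1 ^+ 2 * expR (2 * `|B| * nc z) = (A1 * expR (`|B| * nc z)) ^+ 2.
      by rewrite exprMn -mulrA expRM_natl.
    rewrite ler_sqr ?nnegrE ?nc_ge0 ?mulr_ge0 ?expR_ge0 ?(ltW A10)//.
    apply: le_trans (hg _) _; rewrite ler_wpM2l ?(ltW A10)// ler_expR.
    by rewrite ler_wpM2l.
  rewrite [(_ + 1) * nc z]mulrDl mul1r expRD !mulrA ler_wpM2l//.
    by rewrite !mulr_ge0 ?expR_ge0 ?(ltW A10).
  by apply: le_trans (expR_ge1Dx _); rewrite lerDr ler01.
(* The exponent is [2 (b + 1)] for the square of [g], and 1 more to absorb the length [|y|] of the
   ray. *)
have imag (y : R) : nc (Q ('i%C * y%:C%C)) <= 2 * C ^+ 2 * expR ((2 * b + 3) * `|y|).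
  apply: le_trans (@Qray _ (C ^+ 2 * expR (2 * (b + 1) * `|y|)) _) _.
    move=> t /andP[t0 t1].
    have -> : 'i%C * y%:C%C * t%:C%C = (0 +i* (y * t))%C.
      by apply: complex_eqP; rewrite ?ReM ?ImM /=; ring.
    have -> : C ^+ 2 * expR (2 * (b + 1) * `|y|) = (C * expR ((b + 1) * `|y|)) ^+ 2.
      by rewrite exprMn -mulrA expRM_natl.
    rewrite ler_sqr ?nnegrE ?nc_ge0 ?mulr_ge0 ?expR_ge0 ?(ltW C0)//.
    apply: le_trans (hC _) _; rewrite ler_wpM2l ?(ltW C0)// ler_expR.
    rewrite ler_wpM2l ?addr_ge0// normrM ler_piMr// ger0_norm//.
  rewrite ncM nc_i ncR mul1r.
  have -> : (2 * b + 3) * `|y| = 2 * (b + 1) * `|y| + `|y| by ring.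
  rewrite expRD !mulrA ler_wpM2l//.
    by rewrite !mulr_ge0 ?expR_ge0 ?(ltW C0).
  by apply: le_trans (expR_ge1Dx _); rewrite lerDr ler01.
(* The real and imaginary parts of [Q] are each bounded by the integral of [|g|^2], hence by 1. *)
have real (x : R) : nc (Q x%:C%C) <= 2.
  have g1' := PW_norm_le1 g1.
  have dQ (t : R) : rdiff (fun t => Q (0 + 1 * t%:C%C)) t (g2 t%:C%C).
    have := @rdiff_line R Q 0 1 (g2 (0 + 1 * t%:C%C)) t (hQ _).
    by rewrite mulr1 [in g2 _]add0r mul1r.
  have cg2 z : ccont g2 z by exact: ccontM.
  have cG : continuous (fun t : R => real_modulus g t ^+ 2).
    have := ucont_line (ucont_nc cg2).
    by under eq_fun do rewrite /g2 ncM -expr2.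
  have part (p : R[i] -> R) : (forall u v, p (u - v) = p u - p v) ->
      (forall u, `|p u| <= nc u) ->
      (forall t : R, is_derive t 1 (fun t => p (Q (0 + 1 * t%:C%C))) (p (g2 t%:C%C))) ->
      `|p (Q x%:C%C)| <= 1.
    move=> pB pn dp.
    have p0 : p 0 = 0 by rewrite -[0 in LHS](subrr 0) pB subrr.
    have cp : continuous (fun t : R => p (g2 t%:C%C)).
      apply: (@ucont_line (fun z => p (g2 z))) => z e e0; have [r r0 hr] := cg2 z e e0.
      exists r => // w /hr; rewrite -pB; apply: le_trans; exact: pn.
    have pG t : `|p (g2 t%:C%C)| <= real_modulus g t ^+ 2.
      by apply: le_trans (pn _) _; rewrite /g2 ncM expr2.
    have [x0|/ltW x0] := leP 0 x.
      have := ftc_abs_le x0 dp cp pG cG g1'.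
      by rewrite !mul1r !add0r Q00 p0 subr0.
    have := ftc_abs_le x0 dp cp pG cG g1'.
    by rewrite !mul1r !add0r Q00 p0 sub0r normrN.
  apply: le_trans (nc_le _) _; rewrite [leRHS](_ : _ = 1 + 1)//; apply: lerD.
    apply: part => [u v|u|t]; [by rewrite ReD ReN|exact: nc_Re|exact: rdiff_Re].
  apply: part => [u v|u|t]; [by rewrite ImD ImN|exact: nc_Im|exact: rdiff_Im].
pose be := 2 * b + 3; have be0 : 0 < be by rewrite ltr_wpDl// mulr_ge0.
(* The factor [exp (i be z)] has modulus 1 on the real axis and cancels the growth of [Q] up the
   imaginary axis; the sign [s] handles both half-planes. *)
have half (s : R) : `|s| = 1 -> forall z, 0 <= Im z ->
    nc (Q (s%:C%C * z)) <= 2 * expR (be * Im z).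
  move=> s1 z z0; pose F v := Q (s%:C%C * v) * cexp ('i%C * be%:C%C * v).
  have nF v : nc (F v) = nc (Q (s%:C%C * v)) * expR (- (be * Im v)).
    rewrite /F ncM nc_cexp; congr (_ * expR _).
    by rewrite !ReM !ImM /=; ring.
  suff : nc (F z) <= 2 by rewrite nF expRN ler_pdivrMr ?expR_gt0.
  apply: (@half_plane_bound R F (2 * A1 ^+ 2) (2 * `|B| + 1 + be) (2 * C ^+ 2)) => //.
  - apply: cdiff2M.
      apply: (@cdiff2_comp _ _ Q) => //.
      by apply: cdiff2M; [exact: cdiff2_cst|exact: cdiff2_id].
    apply: (@cdiff2_comp _ _ (@cexp R)); first exact: cdiff2_cexp.
    by apply: cdiff2M; [exact: cdiff2_cst|exact: cdiff2_id].
  - by rewrite mulr_gt0// exprn_gt0.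
  - by rewrite addr_ge0 ?(ltW be0)// addr_ge0// mulr_ge0.
  - move=> v; rewrite nF [(_ + be) * nc v]mulrDl expRD mulrA.
    apply: ler_pM; rewrite ?nc_ge0 ?expR_ge0//.
      by apply: le_trans (growth _) _; rewrite ncM ncR s1 mul1r.
    rewrite ler_expR -mulrN ler_wpM2l ?(ltW be0)//.
    by apply: le_trans (nc_Im v); rewrite -normrN ler_norm.
  - move=> x; rewrite nF /= mulr0 oppr0 expR0 mulr1 -cRM; exact: real.
  - move=> y y0; rewrite nF.
    have -> : Im ('i%C * y%:C%C) = y by rewrite ImM /=; ring.
    rewrite expRN ler_pdivrMr ?expR_gt0// mulrCA -cRM.
    by apply: le_trans (imag _) _; rewrite normrM s1 mul1r ger0_norm.
have QB z : nc (Q z) <= 2 * expR (be * `|Im z|).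
  have [z0|z0] := leP 0 (Im z).
    by have := half 1 (normr1 _) z z0; rewrite rmorph1 mul1r (ger0_norm z0).
  have Nz0 : 0 <= Im (- z) by rewrite ImN oppr_ge0 ltW.
  have := half (-1) (normrN1 _) (- z) Nz0.
  by rewrite rmorphN1 mulrNN mul1r ImN (ltr0_norm z0).
move=> z; rewrite expr2 -ncM.
have -> : 4 * expR (be * (`|Im z| + 1)) = 2 * (2 * expR (be * (`|Im z| + 1))) by ring.
(* On the square of half-side 1 about [z], the height is at most [|Im z| + 1]. *)
apply: (@cauchy_bound R Q g2 z) => //; first by rewrite mulr_gt0// expR_gt0.
move=> h _ h1; apply: le_trans (QB _) _.
rewrite ler_wpM2l// ler_expR ler_wpM2l ?(ltW be0)// ImD.
by apply: le_trans (ler_normD _ _) _; rewrite lerD2l.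
Qed.

End paley_wiener_bound.

(** * Hill equation with a square-integrable potential *)

Section potential.
Variable R : realType.
Local Notation mu := (@lebesgue_measure R).
Local Notation Rm := (measurableTypeR R).

Lemma measurable_itvR (i : interval R) : measurable ([set` i] : set Rm).
Proof. exact: measurable_itv. Qed.

Definition bounded_measurable (phi : R -> R) :=
  measurable_fun (setT : set Rm) phi /\ exists M, forall x, `|phi x| <= M.

Lemma bm_cst c : bounded_measurable (fun=> c).
Proof. by split; [exact: measurable_cst|exists `|c|]. Qed.

Lemma bmM f g : bounded_measurable f -> bounded_measurable g ->
  bounded_measurable (fun x => f x * g x).
Proof.
move=> [mf [M fM]] [mg [M' gM]]; split; first exact: measurable_funM.
by exists (M * M') => x; rewrite normrM ler_pM.
Qed.

Lemma bmD f g : bounded_measurable f -> bounded_measurable g ->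
  bounded_measurable (fun x => f x + g x).
Proof.
move=> [mf [M fM]] [mg [M' gM]]; split; first exact: measurable_funD.
by exists (M + M') => x; rewrite (le_trans (ler_normD _ _))// lerD.
Qed.

Lemma bmN f : bounded_measurable f -> bounded_measurable (fun x => - f x).
Proof.
move=> [mf [M fM]]; split; first exact: measurableT_comp.
by exists M => x; rewrite normrN.
Qed.

Lemma continuous_measurableT (f : R -> R) : continuous f -> measurable_fun (setT : set Rm) f.
Proof. exact: continuous_measurable_fun. Qed.

Lemma continuous_cosM (k : R) : continuous (fun x => cos (k * x)).
Proof.
move=> x; apply: continuous_comp; last exact: continuous_cos.
exact: mulrl_continuous.
Qed.

Lemma continuous_sinM (k : R) : continuous (fun x => sin (k * x)).
Proof.
move=> x; apply: continuous_comp; last exact: continuous_sin.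
exact: mulrl_continuous.
Qed.

Lemma cos_norm_le1 (x : R) : `|cos x| <= 1.
Proof. by rewrite ler_norml cos_geN1 cos_le1. Qed.

Lemma sin_norm_le1 (x : R) : `|sin x| <= 1.
Proof. by rewrite ler_norml sin_geN1 sin_le1. Qed.

Lemma bm_cos k : bounded_measurable (fun x => cos (k * x)).
Proof.
split; first by apply: continuous_measurableT; exact: continuous_cosM.
by exists 1 => x; exact: cos_norm_le1.
Qed.

Lemma bm_sin k : bounded_measurable (fun x => sin (k * x)).
Proof.
split; first by apply: continuous_measurableT; exact: continuous_sinM.
by exists 1 => x; exact: sin_norm_le1.
Qed.

Variables (v : R -> R) (L E : R).
Hypotheses (L0 : 0 <= L) (mv : measurable_fun (setT : set Rm) v).
Hypothesis vsupp : forall x, ~ (0 <= x < L) -> v x = 0.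
Hypothesis vE : (\int[mu]_x (v x ^+ 2)%:E <= E%:E)%E.

Let mv2 : measurable_fun (setT : set Rm) (fun x => (v x ^+ 2)%:E).
Proof. by apply/measurable_EFinP; exact: measurable_funX. Qed.

Let mnv : measurable_fun (setT : set Rm) (fun x => `|v x|%:E).
Proof. by apply/measurable_EFinP; exact: measurableT_comp. Qed.

Lemma E_ge0 : 0 <= E.
Proof.
rewrite -lee_fin; apply: le_trans vE; apply: integral_ge0 => x _.
by rewrite lee_fin sqr_ge0.
Qed.

(* AM-GM: |v| <= (c + v^2 / c) / 2 *)
Let amgm (D : set Rm) (c l : R) : measurable D -> 0 < c -> (mu D <= l%:E)%E ->
  (\int[mu]_(x in D) `|v x|%:E <= ((c * l + E / c) / 2)%:E)%E.
Proof.
move=> mD c0 Dl.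
apply: (@le_trans _ _ (\int[mu]_(x in D) ((c / 2)%:E + ((2 * c)^-1)%:E * (v x ^+ 2)%:E))%E).
  apply: ge0_le_integral => //.
  - exact: measurable_funTS.
  - apply: emeasurable_funD => //; apply: emeasurable_funM => //.
    exact: measurable_funTS.
  move=> x _; rewrite -EFinM -EFinD lee_fin.
  have : 0 <= (`|v x| - c) ^+ 2 / (2 * c) by rewrite divr_ge0 ?sqr_ge0// mulr_ge0// ltW.
  rewrite -[v x ^+ 2]real_normK ?num_real//.
  have -> : (`|v x| - c) ^+ 2 / (2 * c) = c / 2 + (2 * c)^-1 * `|v x| ^+ 2 - `|v x|.
    by field; rewrite gt_eqF.
  by rewrite subr_ge0.
have c20 : 0 <= (2 * c)^-1 by rewrite invr_ge0 mulr_ge0// ltW.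
rewrite ge0_integralD//; last 3 first.
- by move=> x _; rewrite lee_fin divr_ge0// ltW.
- by move=> x _; rewrite -EFinM lee_fin mulr_ge0// sqr_ge0.
- by apply: emeasurable_funM => //; exact: measurable_funTS.
rewrite integral_cst// ge0_integralZl//; last 2 first.
- exact: measurable_funTS.
- by move=> x _; rewrite lee_fin sqr_ge0.
have -> : ((c * l + E / c) / 2)%:E = ((c / 2)%:E * l%:E + (2 * c)^-1%:E * E%:E)%E.
  by rewrite -!EFinM -EFinD; congr _%:E; field; rewrite gt_eqF.
apply: leeD; apply: lee_wpmul2l; rewrite ?lee_fin ?divr_ge0 ?(ltW c0)//.
apply: le_trans vE; apply: ge0_subset_integral => //.
by move=> x _; rewrite lee_fin sqr_ge0.
Qed.

Lemma mu_itv_oc (a b : R) : a <= b -> mu `]a, b] = (b - a)%:E.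
Proof.
move=> ab; rewrite lebesgue_measure_itv/= lte_fin; case: ltP => // ba.
by rewrite (@le_anti _ _ a b) ?ab// subrr.
Qed.

Let Vbound := (L + E) / 2.

Let v_total : (\int[mu]_x `|v x|%:E <= Vbound%:E)%E.
Proof.
have -> : (\int[mu]_x `|v x|%:E = \int[mu]_(x in `[0%R, L[) `|v x|%:E)%E.
  rewrite [RHS]integral_mkcond; apply: eq_integral => x _.
  rewrite /patch; case: ifPn => // /negP xL; rewrite vsupp ?normr0//.
  by move=> h; apply: xL; apply/mem_set; rewrite /= in_itv.
apply: le_trans (@amgm `[0%R, L[ 1 L _ ltr01 _) _.
- exact: measurable_itv.
- rewrite lebesgue_measure_itv/= lte_fin; case: ltP => // _.
  by rewrite -EFinD subr0.
- by rewrite mul1r divr1.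
Qed.

Lemma v_integrable : mu.-integrable setT (EFin \o v).
Proof.
apply/integrableP; split; first exact/measurable_EFinP.
by apply: le_lt_trans v_total _; exact: ltry.
Qed.

Lemma vphi_integrable phi (D : set Rm) : measurable D -> bounded_measurable phi ->
  mu.-integrable D (EFin \o (fun x => v x * phi x)).
Proof.
move=> mD [mphi [M phiM]]; apply: (integrableS measurableT) => //.
apply: (@le_integrable _ _ _ mu setT measurableT _ (fun x => M%:E * (EFin \o v) x)%E).
- by apply/measurable_EFinP; exact: measurable_funM.
- move=> x _ /=; rewrite lee_fin !normrM mulrC ler_wpM2r//.
  by apply: le_trans (phiM x) _; exact: ler_norm.
- by apply: integrableZl => //; exact: v_integrable.
Qed.

(** The potential vanishes to the left of 0, so the lower limit [-oo] amounts to 0 for positive [x]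
    and needs no case distinction for negative [x]. *)
Definition cumulative (phi : R -> R) (x : R) : R :=
  \int[mu]_(s in `]-oo, x]) (v s * phi s).

Lemma int_vphi_le phi (D : set Rm) (M B : R) : measurable D -> bounded_measurable phi ->
  0 <= M -> (forall x, D x -> 0 <= x < L -> `|phi x| <= M) ->
  (\int[mu]_(x in D) `|v x|%:E <= B%:E)%E ->
  `|\int[mu]_(s in D) (v s * phi s)| <= M * B.
Proof.
move=> mD bphi M0 phiM hB.
apply: le_trans (le_normr_Rintegral mD (vphi_integrable mD bphi)) _.
rewrite /Rintegral; have nn : (0 <= \int[mu]_(x in D) `|v x * phi x|%:E)%E.
  by apply: integral_ge0 => x _; rewrite lee_fin.
have hle : (\int[mu]_(x in D) `|v x * phi x|%:E <= (M * B)%:E)%E.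
  apply: (@le_trans _ _ (M%:E * \int[mu]_(x in D) `|v x|%:E)%E).
    rewrite -ge0_integralZl//; last exact: measurable_funTS.
    apply: ge0_le_integral => //.
    - apply/measurable_EFinP; apply: measurableT_comp => //.
      by apply: measurable_funTS; apply: measurable_funM => //; case: bphi.
    - by apply: emeasurable_funM => //; exact: measurable_funTS.
    move=> x Dx; rewrite -EFinM lee_fin normrM mulrC.
    have [xL|xL] := pselect (0 <= x < L); first by rewrite ler_wpM2r// phiM.
    by rewrite vsupp// normr0 !mulr0.
  by rewrite EFinM lee_wpmul2l// lee_fin.
by rewrite -lee_fin fineK// ge0_fin_numE// (le_lt_trans hle)// ltry.
Qed.

Lemma cumulative_le phi (M x : R) : bounded_measurable phi -> 0 <= M ->
  (forall s, 0 <= s < L -> `|phi s| <= M) -> `|cumulative phi x| <= M * Vbound.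
Proof.
move=> bphi M0 phiM; apply: int_vphi_le => //; first by move=> s _; exact: phiM.
apply: le_trans v_total; apply: ge0_subset_integral => //.
Qed.

(** The Hoelder constant of exponent 1/2 for integrals of [|v|]: [amgm] with [c = 1 / sqrt (b - a)]
    makes both of its terms proportional to [sqrt (b - a)]. *)
Definition holder := (1 + E) / 2.

Lemma int_v_holder (a b : R) : a <= b ->
  (\int[mu]_(x in `]a, b]) `|v x|%:E <= (holder * Num.sqrt (b - a))%:E)%E.
Proof.
rewrite le_eqVlt => /predU1P[->|ab].
  by rewrite set_itv_ge ?bnd_simp// integral_set0 subrr sqrtr0 mulr0.
pose s := Num.sqrt (b - a); have s0 : 0 < s by rewrite sqrtr_gt0 subr_gt0.
have ss : s ^+ 2 = b - a by rewrite sqr_sqrtr// subr_ge0 ltW.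
apply: le_trans (@amgm `]a, b] s^-1 (b - a) _ _ _) _ => //.
- by rewrite invr_gt0.
- by rewrite mu_itv_oc// ltW.
- rewrite lee_fin -/s -ss /holder le_eqVlt; apply/orP; left; apply/eqP.
  by field; rewrite gt_eqF.
Qed.

Lemma cumulativeB phi (a b : R) : bounded_measurable phi -> a <= b ->
  cumulative phi b - cumulative phi a = \int[mu]_(s in `]a, b]) (v s * phi s).
Proof.
move=> bphi ab; rewrite /cumulative Rintegral_itvB// ?bnd_simp//.
by apply: vphi_integrable => //; exact: measurable_itv.
Qed.

Lemma cumulative_lin phi psi (c d x : R) : bounded_measurable phi ->
  bounded_measurable psi ->
  cumulative (fun s => c * phi s + d * psi s) x =
  c * cumulative phi x + d * cumulative psi x.
Proof.
move=> bphi bpsi; rewrite /cumulative -!RintegralZl//; try exact: vphi_integrable.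
rewrite -RintegralD//.
- by apply: eq_Rintegral => s _; ring.
- have := vphi_integrable (measurable_itvR `]-oo, x]) (bmM (bm_cst c) bphi).
  by apply: eq_integrable => // s _ /=; congr _%:E; ring.
- have := vphi_integrable (measurable_itvR `]-oo, x]) (bmM (bm_cst d) bpsi).
  by apply: eq_integrable => // s _ /=; congr _%:E; ring.
Qed.

Lemma cumulativeB_le phi (a b M : R) : bounded_measurable phi -> a <= b -> 0 <= M ->
  (forall s, a <= s <= b -> `|phi s| <= M) ->
  `|cumulative phi b - cumulative phi a| <= M * (holder * Num.sqrt (b - a)).
Proof.
move=> bphi ab M0 phiM; rewrite cumulativeB//; apply: int_vphi_le => //.
  by move=> s; rewrite /= in_itv/= => /andP[/ltW sa sb] _; apply: phiM; rewrite sa.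
exact: int_v_holder.
Qed.

Lemma cumulative0 phi (x : R) : bounded_measurable phi -> x <= 0 ->
  cumulative phi x = 0.
Proof.
move=> bphi x0; rewrite /cumulative -Rintegral_itv_bndo_bndc; last first.
  by apply: vphi_integrable => //; exact: measurable_itv.
rewrite (@eq_Rintegral _ _ _ _ _ (fun=> 0)).
  by rewrite Rintegral_cst ?mul0r//; exact: measurable_itv.
move=> s /set_mem; rewrite /= in_itv/= => sx; rewrite vsupp ?mul0r//.
by move=> /andP[s0 _]; have := lt_le_trans sx x0; rewrite ltNge s0.
Qed.

End potential.

(** * Geometric convergence *)

Section nested.
Variable R : realType.

(** The intervals of radius [2 C / 2^n] about [u n] are nested. *)
Lemma geometric_limit (u : nat -> R) (C : R) : 0 <= C ->
  (forall n, `|u n.+1 - u n| <= C * (2 ^+ n)^-1) ->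
  exists x, forall n, `|x - u n| <= 2 * C * (2 ^+ n)^-1.
Proof.
move=> C0 hu; pose s n := 2 * C * (2 ^+ n)^-1.
have s0 n : 0 <= s n by rewrite !mulr_ge0// invr_ge0 exprn_ge0.
have sS n : s n = 2 * s n.+1 by rewrite /s exprS; field; rewrite expf_neq0.
have su n : C * (2 ^+ n)^-1 = s n.+1 by rewrite /s exprS; field; rewrite expf_neq0.
have [|n|x hx] := @nested_intervals R (fun n => u n - s n) (fun n => 2 * s n).
- by move=> n; rewrite mulr_ge0.
- have := hu n; rewrite su ler_norml => /andP[h1 h2].
  by have := sS n; split; lra.
- exists x => n; have /andP[h1 h2] := hx n; rewrite -/(s n) ler_norml.
  by apply/andP; split; lra.
Qed.

Lemma le_geometric (x y C : R) : 0 <= C -> (forall n, x <= y + C * (2 ^+ n)^-1) -> x <= y.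
Proof.
move=> C0 h; apply/ler_addgt0Pr => e e0.
have C1 : 0 < C + 1 by rewrite ltr_wpDl.
have [n hn] := exists_half_pow (divr_gt0 e0 C1).
apply: le_trans (h n) _; rewrite lerD2l.
move: hn; rewrite ltr_pdivlMr ?ltr_wpDl// => hn; apply: le_trans (ltW hn).
by rewrite mulrC ler_wpM2l ?invr_ge0 ?exprn_ge0// lerDl.
Qed.

(** Iterating [M -> C + M / 2] from any a priori bound [D] tends to the fixed point [2 C]. The a
    priori bound then drops out of the estimate. *)
Lemma halving (I : R -> Prop) (d : R -> R) (C D : R) : 0 <= C -> 0 <= D ->
  (forall x, I x -> `|d x| <= D) ->
  (forall M, 0 <= M -> (forall x, I x -> `|d x| <= M) ->
     forall x, I x -> `|d x| <= C + M / 2) ->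
  forall x, I x -> `|d x| <= 2 * C.
Proof.
move=> C0 D0 hD h x Ix.
have dn n : forall x, I x -> `|d x| <= 2 * C + D * (2 ^+ n)^-1.
  elim: n => [y Iy|n IH y Iy].
    by rewrite expr0 invr1 mulr1 ler_wpDl ?hD// mulr_ge0.
  have M0 : 0 <= 2 * C + D * (2 ^+ n)^-1.
    by rewrite addr_ge0 ?mulr_ge0// invr_ge0 exprn_ge0.
  apply: le_trans (h _ M0 IH y Iy) _; rewrite exprS le_eqVlt; apply/orP; left; apply/eqP.
  by field; rewrite expf_neq0.
by apply: (le_geometric D0) => n; exact: dn.
Qed.

End nested.

(** * The Volterra equation *)

Section volterra.
Variable R : realType.
Local Notation mu := (@lebesgue_measure R).
Local Notation Rm := (measurableTypeR R).
Variables (v : R -> R) (L E : R).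
Hypotheses (L0 : 0 <= L) (mv : measurable_fun (setT : set Rm) v).
Hypothesis vsupp : forall x, ~ (0 <= x < L) -> v x = 0.
Hypothesis vE : (\int[mu]_x (v x ^+ 2)%:E <= E%:E)%E.

Local Notation J := (cumulative v).
Local Notation V := ((L + E) / 2).
Local Notation H := (holder E).

Let V0 : 0 <= V.
Proof. by rewrite divr_ge0// addr_ge0// (E_ge0 vE). Qed.

Let H0 : 0 <= H.
Proof. by rewrite /holder divr_ge0// addr_ge0// (E_ge0 vE). Qed.

Lemma cumulative_holder phi M a b : bounded_measurable phi ->
  (forall x, `|phi x| <= M) -> `|J phi b - J phi a| <= M * (H * Num.sqrt `|b - a|).
Proof.
move=> bphi phiM; have M0 : 0 <= M by apply: le_trans (phiM 0).
wlog ab : a b / a <= b => [wl|].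
  have /orP[|ba] := le_total a b; first exact: wl.
  by rewrite (distrC (J _ _)) (distrC b); exact: wl.
rewrite (ger0_norm (_ : 0 <= b - a)) ?subr_ge0//.
by apply: (cumulativeB_le L0 mv vsupp vE).
Qed.

Lemma cumulative_continuous phi : bounded_measurable phi -> continuous (J phi).
Proof.
move=> bphi x; have [_ [M phiM]] := bphi.
have M0 : 0 <= M by apply: le_trans (phiM 0).
apply/cvgrPdist_le => e e0.
pose K := M * H + 1; have K0 : 0 < K by rewrite ltr_wpDl// mulr_ge0.
exists ((e / K) ^+ 2) => /=; first by rewrite exprn_gt0// divr_gt0.
move=> y /= xy; rewrite distrC; apply: le_trans (cumulative_holder _ _ bphi phiM) _.
apply: le_trans (_ : M * (H * (e / K)) <= _).
  rewrite !ler_wpM2l// -[leRHS]ger0_norm ?divr_ge0 ?(ltW e0) ?(ltW K0)//.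
  by rewrite -[leRHS]sqrtr_sqr ler_sqrt ?sqr_ge0// distrC ltW.
rewrite mulrA mulrCA ler_piMr ?(ltW e0)// ler_pdivrMr// mul1r.
by rewrite /K lerDl.
Qed.

(** The integral of [sin (k (x - s)) v s y s / k] up to [x], split by the addition formula so that
    [x] leaves the integrands. *)
Definition volterra (k : R) (y : R -> R) (x : R) : R :=
  (sin (k * x) * J (fun s => cos (k * s) * y s) x
   - cos (k * x) * J (fun s => sin (k * s) * y s) x) / k.

Lemma bm_cumulative phi : bounded_measurable phi -> bounded_measurable (J phi).
Proof.
move=> bphi; split.
  by apply: continuous_measurableT; exact: cumulative_continuous.
have [_ [M phiM]] := bphi; exists (M * V) => x.
by apply: (cumulative_le L0 mv vsupp vE) => //; apply: le_trans (phiM 0).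
Qed.

Lemma bm_volterra k y : bounded_measurable y -> bounded_measurable (volterra k y).
Proof.
move=> by_; apply: bmM; last exact: bm_cst.
apply: bmD; first by apply: bmM; [exact: bm_sin|apply/bm_cumulative/bmM => //; exact: bm_cos].
by apply/bmN/bmM; [exact: bm_cos|apply/bm_cumulative/bmM => //; exact: bm_sin].
Qed.

Lemma continuous_volterra k y : bounded_measurable y -> continuous (volterra k y).
Proof.
move=> by_ x.
have cJc := cumulative_continuous (bmM (bm_cos k) by_).
have cJs := cumulative_continuous (bmM (bm_sin k) by_).
have h : {for x, continuous (fun x : R =>
    (sin (k * x) * J (fun s => cos (k * s) * y s) x
     - cos (k * x) * J (fun s => sin (k * s) * y s) x) * k^-1)}.
  apply: continuousM; last exact: cst_continuous.
  apply: continuousB; apply: continuousM.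
  - exact: continuous_sinM.
  - exact: cJc.
  - exact: continuous_cosM.
  - exact: cJs.
exact: h.
Qed.

Lemma cumulativeMB phi y z x : bounded_measurable phi -> bounded_measurable y ->
  bounded_measurable z ->
  J (fun s => phi s * y s) x - J (fun s => phi s * z s) x =
  J (fun s => phi s * (y s - z s)) x.
Proof.
move=> bp by_ bz.
have := cumulative_lin L0 mv vsupp vE 1 (-1) x (bmM bp by_) (bmM bp bz).
rewrite mul1r mulN1r => <-; congr (J _ x); apply/funext => s; ring.
Qed.

(** Two terms of size [M V] divided by [k >= 4 V] give one half of [M]. Only values on the support
    of the potential enter. *)
Lemma volterra_contract k y z M : bounded_measurable y -> bounded_measurable z ->
  0 < k -> 4 * V <= k -> 0 <= M -> (forall s, 0 <= s < L -> `|y s - z s| <= M) ->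
  forall x, `|volterra k y x - volterra k z x| <= M / 2.
Proof.
move=> by_ bz k0 Vk M0 yz x.
have byz : bounded_measurable (fun s => y s - z s) by apply/bmD/bmN.
have -> : volterra k y x - volterra k z x =
   (sin (k * x) * J (fun s => cos (k * s) * (y s - z s)) x
    - cos (k * x) * J (fun s => sin (k * s) * (y s - z s)) x) / k.
  rewrite -(cumulativeMB _ (bm_cos k))// -(cumulativeMB _ (bm_sin k))// /volterra; ring.
have hJ phi : bounded_measurable phi -> (forall s, `|phi s| <= 1) ->
    `|J (fun s => phi s * (y s - z s)) x| <= M * V.
  move=> bphi phi1; apply: (cumulative_le L0 mv vsupp vE) => //; first exact: bmM.
  move=> s hs; rewrite normrM -[M]mul1r; apply: ler_pM => //; exact: yz.
have h1 := hJ _ (bm_cos k) (fun s => cos_norm_le1 _).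
have h2 := hJ _ (bm_sin k) (fun s => sin_norm_le1 _).
rewrite normrM normfV (gtr0_norm k0) ler_pdivrMr//.
apply: le_trans (ler_normB _ _) _; rewrite !normrM.
apply: le_trans (_ : M * V + M * V <= _).
  by apply: lerD; rewrite -[leRHS]mul1r; apply: ler_pM => //; rewrite ?sin_norm_le1 ?cos_norm_le1.
have : M * (4 * V) <= M * k by rewrite ler_wpM2l.
by lra.
Qed.

Lemma volterra0 k x : volterra k (fun=> 0) x = 0.
Proof.
have z phi : bounded_measurable phi -> J (fun s => phi s * 0) x = 0.
  move=> bphi; apply/eqP; rewrite -normr_le0 -[leRHS](mul0r V).
  apply: (cumulative_le L0 mv vsupp vE) => //; first exact/bmM/bm_cst.
  by move=> s _; rewrite mulr0 normr0.
by rewrite /volterra !z ?mulr0 ?subrr ?mul0r//; [exact: bm_sin|exact: bm_cos].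
Qed.

(** Picard iteration: successive differences halve, so the limit exists with uniform error, and is
    therefore continuous and a fixed point. *)
Lemma volterra_solution k (y0 : R -> R) : continuous y0 -> (forall x, `|y0 x| <= 1) ->
  0 < k -> 4 * V <= k ->
  exists y, [/\ bounded_measurable y, forall x, `|y x| <= 2 &
    forall x, y x = y0 x + volterra k y x].
Proof.
move=> cy0 y01 k0 Vk.
have by0 : bounded_measurable y0.
  by split; [exact: continuous_measurableT|exists 1].
pose Y := fix Y n := if n is m.+1 then (fun x => y0 x + volterra k (Y m) x) else y0.
have bY n : bounded_measurable (Y n) by elim: n => //= n IH; apply/bmD/bm_volterra.
have Yd n : forall x, `|Y n.+1 x - Y n x| <= 1 * (2 ^+ n)^-1.
  elim: n => [|n IH] x.
    rewrite /= addrC addKr -[volterra k y0 x]subr0 -(volterra0 k x).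
    apply: le_trans (@volterra_contract k y0 (fun=> 0) 1 _ _ _ _ _ _ x) _ => //.
    - exact: bm_cst.
    - by move=> s _; rewrite subr0.
    - by rewrite expr0 invr1; lra.
  have -> : Y n.+2 x - Y n.+1 x = volterra k (Y n.+1) x - volterra k (Y n) x.
    by rewrite /=; ring.
  have M0 : 0 <= 1 * (2 ^+ n)^-1 :> R by rewrite mul1r invr_ge0 exprn_ge0.
  apply: le_trans (volterra_contract (bY n.+1) (bY n) k0 Vk M0 (fun s _ => IH s) x) _.
  by rewrite !mul1r exprS invfM mulrC.
have cY n : continuous (Y n).
  elim: n => //= n IH x; apply: continuousD; first exact: cy0.
  exact: continuous_volterra.
have [y hy] := choice (fun x => geometric_limit ler01 (fun n => Yd n x)).
have small n : 0 <= 2 * 1 * (2 ^+ n)^-1 :> R.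
  by rewrite mulr1 mulr_ge0// invr_ge0 exprn_ge0.
(* A crude bound, 1 from [y0] and 2 from the error at stage 0; it makes [y] admissible and feeds
   [halving], which lowers it to 2. *)
have y2 x : `|y x| <= 3.
  rewrite -[y x](subrK (y0 x)); apply: le_trans (ler_normD _ _) _.
  have := hy x 0%N; rewrite expr0 invr1 !mulr1 /=; have := y01 x; lra.
have cy : continuous y.
  move=> x; apply/cvgrPdist_le => e e0.
  have e40 : 0 < e / 5 by rewrite divr_gt0.
  have [n hn] := exists_half_pow e40.
  have /cvgrPdist_le/(_ _ e40) h := cY n x.
  near=> t; have h1 : `|Y n x - Y n t| <= e / 5 by near: t.
  have -> : y x - y t = (y x - Y n x) + (Y n x - Y n t) - (y t - Y n t) by ring.
  apply: le_trans (ler_normB _ _) _; apply: le_trans (lerD (ler_normD _ _) (lexx _)) _.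
  have := hy x n; have := hy t n; rewrite mulr1 => h2 h3.
  by move: h1 h2 h3 hn; clear => *; lra.
have by_ : bounded_measurable y.
  by split; [exact: continuous_measurableT|exists 3].
have yE x : y x = y0 x + volterra k y x.
  apply/eqP; rewrite -subr_eq0 -normr_le0.
  apply: (@le_geometric R _ 0 2) => // n; rewrite add0r.
  have -> : y x - (y0 x + volterra k y x) =
    (y x - Y n.+1 x) + (volterra k (Y n) x - volterra k y x) by rewrite /=; ring.
  apply: le_trans (ler_normD _ _) _.
  have h1 := hy x n.+1.
  have yY s : 0 <= s < L -> `|Y n s - y s| <= 2 * 1 * (2 ^+ n)^-1.
    by move=> _; rewrite distrC.
  apply: le_trans (lerD h1 (volterra_contract (bY n) by_ k0 Vk (small n) yY x)) _.
  rewrite exprS le_eqVlt; apply/orP; left; apply/eqP; field.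
  by rewrite expf_neq0.
exists y; split => // x.
suff : forall x, True -> `|y x| <= 2 * 1 by rewrite mulr1 => /(_ x I).
apply: (@halving R _ y 1 3) => // M M0 yM z _.
rewrite yE; apply: le_trans (ler_normD _ _) _; apply: lerD => //.
rewrite -[volterra k y z]subr0 -(volterra0 k z).
apply: volterra_contract => //; first exact: bm_cst.
by move=> s _; rewrite subr0 yM.
Unshelve. all: by end_near. Qed.

End volterra.

(** * Derivatives of trigonometric functions and perturbed derivatives *)

Section trigonometric_lipschitz.
Variable R : realType.

Lemma is_derive_cosM (k x : R) : is_derive x 1 (fun t => cos (k * t)) (- k * sin (k * x)).
Proof.
have dk : is_derive x 1 (fun t : R => k * t) k.
  by apply: is_derive_eq; rewrite [LHS]mulr1.
by apply: is_derive_eq (is_derive1_comp (is_derive_cos (k * x)) dk) _; ring.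
Qed.

Lemma is_derive_sinM (k x : R) : is_derive x 1 (fun t => sin (k * t)) (k * cos (k * x)).
Proof.
have dk : is_derive x 1 (fun t : R => k * t) k.
  by apply: is_derive_eq; rewrite [LHS]mulr1.
by apply: is_derive_eq (is_derive1_comp (is_derive_sin (k * x)) dk) _; ring.
Qed.

Lemma sin_lipschitz (a b : R) : `|sin b - sin a| <= `|b - a|.
Proof.
rewrite -[leRHS]mul1r; apply: (@real_mean_value R sin cos) => x _.
exact: cos_norm_le1.
Qed.

Lemma cos_lipschitz (a b : R) : `|cos b - cos a| <= `|b - a|.
Proof.
rewrite -[leRHS]mul1r; apply: (@real_mean_value R cos (fun x => - sin x)) => x _.
by rewrite normrN sin_norm_le1.
Qed.

(** The substitute for differentiating integrals against the potential: [g] has them frozen at [a],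
    and a discrepancy of order 3/2 does not affect the derivative. *)
Lemma derive_perturb (f g : R -> R) (a d C : R) : is_derive a 1 g d ->
  (forall b, `|f b - f a - (g b - g a)| <= C * (`|b - a| * Num.sqrt `|b - a|)) ->
  is_derive a 1 f d.
Proof.
move=> /is_deriveP hg hf; apply/is_deriveP => e e0.
have e20 : 0 < e / 2 by rewrite divr_gt0.
have [r r0 hr] := hg _ e20.
pose K := `|C| + 1; have K0 : 0 < K by rewrite ltr_wpDl.
have q0 : 0 < e / 2 / K by rewrite divr_gt0.
exists (Num.min r ((e / 2 / K) ^+ 2)) => [|h].
  by rewrite lt_min r0 exprn_gt0.
rewrite lt_min => /andP[hr1 hr2].
have := hf (a + h); rewrite [a + h - a]addrC addKr => h1.
have h2 := hr h hr1.
have s1 : Num.sqrt `|h| <= e / 2 / K.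
  by rewrite -[leRHS]ger0_norm ?(ltW q0)// -[leRHS]sqrtr_sqr ler_sqrt ?sqr_ge0// ltW.
have h3 : C * (`|h| * Num.sqrt `|h|) <= e / 2 * `|h|.
  apply: le_trans (_ : K * (`|h| * (e / 2 / K)) <= _); last first.
    by rewrite le_eqVlt; apply/orP; left; apply/eqP; field; rewrite gt_eqF.
  apply: le_trans (_ : K * (`|h| * Num.sqrt `|h|) <= _).
    rewrite ler_wpM2r ?mulr_ge0 ?sqrtr_ge0//.
    by apply: le_trans (ler_norm _) _; rewrite /K lerDl.
  by rewrite !ler_wpM2l// ltW.
have -> : f (a + h) - f a - d * h =
   (f (a + h) - f a - (g (a + h) - g a)) + (g (a + h) - g a - d * h) by ring.
apply: le_trans (ler_normD _ _) _; rewrite [e in leRHS]splitr mulrDl.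
by apply: lerD => //; exact: le_trans h3.
Qed.

End trigonometric_lipschitz.

(** * Differentiating solutions of the Volterra equation *)

Section hill_solution_on_line.
Variable R : realType.
Local Notation mu := (@lebesgue_measure R).
Local Notation Rm := (measurableTypeR R).
Variables (v : R -> R) (L E : R).
Hypotheses (L0 : 0 <= L) (mv : measurable_fun (setT : set Rm) v).
Hypothesis vsupp : forall x, ~ (0 <= x < L) -> v x = 0.
Hypothesis vE : (\int[mu]_x (v x ^+ 2)%:E <= E%:E)%E.

Local Notation J := (cumulative v).
Local Notation H := (holder E).

Lemma cumulative_between phi (a b M : R) : bounded_measurable phi -> 0 <= M ->
  (forall s, `|s - b| <= `|b - a| -> `|phi s| <= M) ->
  `|J phi b - J phi a| <= M * (H * Num.sqrt `|b - a|).
Proof.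
move=> bphi M0 hM; have [ab|/ltW ba] := leP a b.
  move: hM; rewrite (ger0_norm (_ : 0 <= b - a)) ?subr_ge0// => hM.
  apply: (cumulativeB_le L0 mv vsupp vE) => // s /andP[sa sb]; apply: hM.
  by rewrite distrC ger0_norm ?subr_ge0// lerD2l lerN2.
move: hM; rewrite (distrC b a) (distrC (J _ b)) (ger0_norm (_ : 0 <= a - b)) ?subr_ge0// => hM.
apply: (cumulativeB_le L0 mv vsupp vE) => // s /andP[sa sb]; apply: hM.
by rewrite ger0_norm ?subr_ge0// lerD2r.
Qed.

Variables (k : R) (y0 z0 y : R -> R).
Hypotheses (k0 : 0 < k) (dy0 : forall x : R, is_derive x 1 y0 (z0 x)).
Hypothesis dz0 : forall x : R, is_derive x 1 z0 (- k ^+ 2 * y0 x).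
Hypotheses (bmy : bounded_measurable y) (y2 : forall x, `|y x| <= 2).
Hypothesis yE : forall x, y x = y0 x + volterra v k y x.

Let A := J (fun s => cos (k * s) * y s).
Let B := J (fun s => sin (k * s) * y s).

(** The formal derivative of [y]; the terms from differentiating the two integrals cancel. *)
Definition velocity (x : R) : R := z0 x + cos (k * x) * A x + sin (k * x) * B x.

Let bmc : bounded_measurable (fun s => cos (k * s) * y s).
Proof. exact: bmM (bm_cos k) bmy. Qed.

Let bms : bounded_measurable (fun s => sin (k * s) * y s).
Proof. exact: bmM (bm_sin k) bmy. Qed.

(** The discrepancy is the integral of [sin (k (b - s)) v y / k] between [x] and [b]: the sine is of
    order [|b - x|], the integral of [|v|] of order 1/2. *)
Lemma solution_derive (x : R) : is_derive x 1 y (velocity x).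
Proof.
pose g b := y0 b + (sin (k * b) * A x - cos (k * b) * B x) / k.
apply: (@derive_perturb R y g x _ (2 * H)).
  have ds := is_derive_sinM k x; have dc := is_derive_cosM k x.
  rewrite /g /velocity; apply: is_derive_eq.
  rewrite ?scaler0 ?addr0 ?scaleNr -?[_ *: _]/(_ * _); field.
  exact: lt0r_neq0.
move=> b; pose phi s := sin (k * b) * (cos (k * s) * y s) + - cos (k * b) * (sin (k * s) * y s).
have -> : y b - y x - (g b - g x) = (J phi b - J phi x) / k.
  rewrite !(cumulative_lin L0 mv vsupp vE)// !yE /g /volterra -/A -/B; ring.
have bphi : bounded_measurable phi.
  by apply: bmD; apply: bmM => //; exact: bm_cst.
have phiE s : phi s = sin (k * b - k * s) * y s.
  by rewrite /phi sinB; ring.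
rewrite normrM normfV (gtr0_norm k0) ler_pdivrMr//.
apply: le_trans (@cumulative_between phi x b (2 * (k * `|b - x|)) bphi _ _) _.
- by rewrite !mulr_ge0// ltW.
- move=> s hs; rewrite phiE normrM mulrC; apply: ler_pM => //.
  have := sin_lipschitz 0 (k * b - k * s); rewrite sin0 !subr0 => /le_trans; apply.
  by rewrite -mulrBr normrM (gtr0_norm k0) ler_wpM2l ?(ltW k0)// distrC.
- by rewrite le_eqVlt; apply/orP; left; apply/eqP; ring.
Qed.

(** [velocity] itself contains an indefinite integral of [v y], with no pointwise derivative in
    general. Subtracting it leaves a quasi-derivative, whose discrepancy has the small factor
    [cos (k (b - s)) - 1]. *)
Lemma solution_derive2 (x : R) :
  is_derive x 1 (fun t => velocity t - J y t) (- k ^+ 2 * y x).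
Proof.
pose g b := z0 b + cos (k * b) * A x + sin (k * b) * B x.
apply: (@derive_perturb R _ g x _ (2 * k * H)).
  have ds := is_derive_sinM k x; have dc := is_derive_cosM k x.
  rewrite /g; apply: is_derive_eq.
  rewrite ?scaler0 ?add0r ?addr0 yE /volterra -/A -/B -?[_ *: _]/(_ * _); field.
  exact: lt0r_neq0.
move=> b; pose phi s := cos (k * b) * (cos (k * s) * y s) + sin (k * b) * (sin (k * s) * y s).
pose psi s := 1 * phi s + -1 * y s.
have bphi : bounded_measurable phi.
  by apply: bmD; apply: bmM => //; exact: bm_cst.
have -> : velocity b - J y b - (velocity x - J y x) - (g b - g x) = J psi b - J psi x.
  rewrite !(cumulative_lin L0 mv vsupp vE)// /velocity /g -/A -/B; ring.
have bpsi : bounded_measurable psi.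
  by apply: bmD; apply: bmM => //; exact: bm_cst.
have psiE s : psi s = (cos (k * b - k * s) - 1) * y s.
  by rewrite /psi /phi cosB; ring.
apply: le_trans (@cumulative_between psi x b (2 * (k * `|b - x|)) bpsi _ _) _.
- by rewrite !mulr_ge0// ltW.
- move=> s hs; rewrite psiE normrM mulrC; apply: ler_pM => //.
  have := cos_lipschitz 0 (k * b - k * s); rewrite cos0 subr0 => /le_trans; apply.
  by rewrite -mulrBr normrM (gtr0_norm k0) ler_wpM2l ?(ltW k0)// distrC.
- by rewrite le_eqVlt; apply/orP; left; apply/eqP; ring.
Qed.

Lemma solution_continuous : continuous y.
Proof. exact: continuous_is_derive solution_derive. Qed.

Lemma continuous_scaled (c : R) (f : R -> R) : continuous f -> continuous (fun s => c * f s).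
Proof. by move=> cf x; apply: cvgM; [exact: cvg_cst|exact: cf]. Qed.

Lemma solution_integrable a b :
  mu.-integrable `[a, b] (EFin \o (fun s => (v s - k ^+ 2) * y s)).
Proof.
have i1 := vphi_integrable L0 mv vsupp vE (measurable_itvR `[a, b]) bmy.
have i2 : mu.-integrable `[a, b] (EFin \o (fun s => - k ^+ 2 * y s)).
  by apply: continuous_integrable; apply: continuous_scaled; exact: solution_continuous.
have := integrableD (measurable_itvR `[a, b]) i1 i2.
by apply: eq_integrable => // s _ /=; rewrite -EFinD; congr _%:E; ring.
Qed.

Lemma solution_integral a b : a <= b -> velocity b - velocity a =
  \int[mu]_(s in `[a, b]) ((v s - k ^+ 2) * y s).
Proof.
rewrite le_eqVlt => /predU1P[->|ab]; first by rewrite subrr set_itv1 Rintegral_set1.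
pose u t := velocity t - J y t.
have cu : continuous u := continuous_is_derive solution_derive2.
have cky : continuous (fun s => - k ^+ 2 * y s).
  by apply: continuous_scaled; exact: solution_continuous.
have Eu : \int[mu]_(s in `[a, b]) (- k ^+ 2 * y s) = u b - u a.
  have := @continuous_FTC2 R (fun s => - k ^+ 2 * y s) u a b ab (continuous_subspaceT cky).
  rewrite /Rintegral => ->//.
    split=> [x _||].
    - exact: (@ex_derive _ _ _ _ _ _ _ (solution_derive2 x)).
    - exact/cvg_at_right_filter/cu.
    - exact/cvg_at_left_filter/cu.
  move=> x _; rewrite derive1E; exact: (@derive_val _ _ _ _ _ _ _ (solution_derive2 x)).
have i1 := vphi_integrable L0 mv vsupp vE (measurable_itvR `[a, b]) bmy.
have i2 : mu.-integrable `[a, b] (EFin \o (fun s => - k ^+ 2 * y s)).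
  exact: continuous_integrable.
have -> : velocity b - velocity a = (J y b - J y a) + (u b - u a) by rewrite /u; ring.
rewrite (cumulativeB L0 mv vsupp vE bmy (ltW ab)) Rintegral_itv_obnd_cbnd; last first.
  exact: (vphi_integrable L0 mv vsupp vE (measurable_itvR `]a, b]) bmy).
rewrite -Eu -RintegralD//; apply: eq_Rintegral => s _; ring.
Qed.

End hill_solution_on_line.

(** * Constancy of the Wronskian *)

Section wronskian.
Variable R : realType.
Local Notation mu := (@lebesgue_measure R).
Local Notation Rm := (measurableTypeR R).
Variables (v : R -> R) (L E : R).
Hypotheses (L0 : 0 <= L) (mv : measurable_fun (setT : set Rm) v).
Hypothesis vsupp : forall x, ~ (0 <= x < L) -> v x = 0.
Hypothesis vE : (\int[mu]_x (v x ^+ 2)%:E <= E%:E)%E.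
Local Notation J := (cumulative v).
Variables (k Z : R) (y1 z1 y2 z2 : R -> R).
Hypotheses (bm1 : bounded_measurable y1) (bm2 : bounded_measurable y2).
Hypotheses (b1 : forall x, `|y1 x| <= 2) (b2 : forall x, `|y2 x| <= 2).
Hypotheses (c1 : forall x, `|z1 x| <= Z) (c2 : forall x, `|z2 x| <= Z).
Hypotheses (d1 : forall x : R, is_derive x 1 y1 (z1 x))
  (d2 : forall x : R, is_derive x 1 y2 (z2 x)).
Hypotheses
  (e1 : forall x : R, is_derive x 1 (fun t => z1 t - J y1 t) (- k ^+ 2 * y1 x))
  (e2 : forall x : R, is_derive x 1 (fun t => z2 t - J y2 t) (- k ^+ 2 * y2 x)).

Let wr x := y1 x * z2 x - y2 x * z1 x.

Let Z0 : 0 <= Z. Proof. by apply: le_trans (c1 0). Qed.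

(** With the integrals frozen, the quasi-derivatives give derivative 0. The discrepancy integrates
    [v] against [phi], which vanishes at [s = b] and is Lipschitz, so it has order 3/2. *)
Let wr_derive (x : R) : is_derive x 1 wr 0.
Proof.
pose g b := y1 b * ((z2 b - J y2 b) + J y2 x) - y2 b * ((z1 b - J y1 b) + J y1 x).
apply: (@derive_perturb R wr g x _ (4 * Z * holder E)).
  have D1 := d1 x; have D2 := d2 x; have E1 := e1 x; have E2 := e2 x.
  have F1 : is_derive x 1 (fun b => (z1 b - J y1 b) + J y1 x) (- k ^+ 2 * y1 x).
    by apply: is_derive_eq; rewrite addr0.
  have F2 : is_derive x 1 (fun b => (z2 b - J y2 b) + J y2 x) (- k ^+ 2 * y2 x).
    by apply: is_derive_eq; rewrite addr0.
  rewrite /g; apply: is_derive_eq.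
  by rewrite -?[_ *: _]/(_ * _); ring.
move=> b; pose phi s := y1 b * y2 s + - y2 b * y1 s.
have bphi : bounded_measurable phi.
  by apply: bmD; apply: bmM => //; exact: bm_cst.
have -> : wr b - wr x - (g b - g x) = J phi b - J phi x.
  rewrite !(cumulative_lin L0 mv vsupp vE)// /wr /g; ring.
apply: le_trans (cumulative_between L0 mv vsupp vE (M := 4 * Z * `|b - x|) bphi _ _) _.
- by rewrite !mulr_ge0.
- move=> s hs.
  have lip (y z : R -> R) : (forall x : R, is_derive x 1 y (z x)) -> (forall x, `|z x| <= Z) ->
      `|y s - y b| <= Z * `|b - x|.
    move=> dy zZ; apply: le_trans (_ : Z * `|s - b| <= _); last by rewrite ler_wpM2l.
    exact: (@real_mean_value R y z b s Z (fun x _ => dy x) (fun x _ => zZ x)).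
  have l1 := lip _ _ d1 c1; have l2 := lip _ _ d2 c2.
  have -> : phi s = y1 b * (y2 s - y2 b) - y2 b * (y1 s - y1 b) by rewrite /phi; ring.
  apply: le_trans (ler_normB _ _) _; rewrite !normrM.
  apply: le_trans (_ : 2 * (Z * `|b - x|) + 2 * (Z * `|b - x|) <= _).
    by apply: lerD; apply: ler_pM.
  by rewrite le_eqVlt; apply/orP; left; apply/eqP; ring.
- by rewrite le_eqVlt; apply/orP; left; apply/eqP; ring.
Qed.

Lemma wronskian_constant a b :
  y1 b * z2 b - y2 b * z1 b = y1 a * z2 a - y2 a * z1 a.
Proof.
apply/eqP; rewrite -subr_eq0 -normr_le0 -[leRHS](mul0r `|b - a|).
by apply: (@real_mean_value R wr (fun=> 0)) => x _; [exact: wr_derive|rewrite normr0].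
Qed.

End wronskian.

(** * Fundamental solutions *)

Section fundamental_solutions.
Variable R : realType.
Local Notation mu := (@lebesgue_measure R).
Local Notation Rm := (measurableTypeR R).
Variables (v : R -> R) (L E : R).
Hypotheses (L0 : 0 <= L) (mv : measurable_fun (setT : set Rm) v).
Hypothesis vsupp : forall x, ~ (0 <= x < L) -> v x = 0.
Hypothesis vE : (\int[mu]_x (v x ^+ 2)%:E <= E%:E)%E.
Local Notation J := (cumulative v).
Local Notation V := ((L + E) / 2).

Let V0 : 0 <= V.
Proof. by rewrite divr_ge0// addr_ge0// (E_ge0 vE). Qed.

(* Free solution with initial data (p, q) for the position and the velocity
   divided by k; only (1, 0) and (0, 1) are used. *)
Definition free (p q k x : R) : R := p * cos (k * x) + q * sin (k * x).
Definition free' (p q k x : R) : R := - p * sin (k * x) + q * cos (k * x).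

Lemma free_derive p q k (x : R) : is_derive x 1 (free p q k) (k * free' p q k x).
Proof.
have ds := is_derive_sinM k x; have dc := is_derive_cosM k x.
rewrite /free; apply: is_derive_eq; rewrite ?scaler0 ?addr0 /free'.
by rewrite -?[_ *: _]/(_ * _); ring.
Qed.

Lemma free'_derive p q k (x : R) :
  is_derive x 1 (fun t => k * free' p q k t) (- k ^+ 2 * free p q k x).
Proof.
have ds := is_derive_sinM k x; have dc := is_derive_cosM k x.
rewrite /free'; apply: is_derive_eq; rewrite ?scaler0 ?addr0 /free.
by rewrite -?[_ *: _]/(_ * _); ring.
Qed.

Definition unit_data (p q : R) := (p = 1 /\ q = 0) \/ (p = 0 /\ q = 1).

Lemma free_le1 p q k x : unit_data p q -> `|free p q k x| <= 1.
Proof.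
case=> -[-> ->]; rewrite /free !(mul1r, mul0r, addr0, add0r).
  exact: cos_norm_le1.
exact: sin_norm_le1.
Qed.

Lemma free'_le1 p q k x : unit_data p q -> `|free' p q k x| <= 1.
Proof.
case=> -[-> ->]; rewrite /free' !(mul1r, mulN1r, mul0r, oppr0, addr0, add0r).
  by rewrite normrN sin_norm_le1.
exact: cos_norm_le1.
Qed.

Definition is_fundamental (p q k : R) (y : R -> R) := [/\ bounded_measurable y,
  forall x, `|y x| <= 2 & forall x, y x = free p q k x + volterra v k y x].

Lemma exists_fundamental p q k : unit_data p q -> 0 < k -> 4 * V <= k ->
  exists y, is_fundamental p q k y.
Proof.
move=> pq k0 Vk; apply: (volterra_solution L0 mv vsupp vE) => //.
  exact: continuous_is_derive (free_derive p q k).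
by move=> x; exact: free_le1.
Qed.

(* velocity divided by k *)
Definition speed (p q k : R) (y : R -> R) (x : R) : R :=
  velocity v k (fun t => k * free' p q k t) y x / k.

Section one_solution.
Variables (p q k : R) (y : R -> R).
Hypotheses (pq : unit_data p q) (k0 : 0 < k) (Vk : 4 * V <= k).
Hypothesis fy : is_fundamental p q k y.

Lemma speedE x : speed p q k y x = free' p q k x +
  (cos (k * x) * J (fun s => cos (k * s) * y s) x
   + sin (k * x) * J (fun s => sin (k * s) * y s) x) / k.
Proof. by rewrite /speed /velocity; field; exact: lt0r_neq0. Qed.

Lemma cumulative_trig_le x : `|J (fun s => cos (k * s) * y s) x| <= 2 * V /\
  `|J (fun s => sin (k * s) * y s) x| <= 2 * V.
Proof.
have [by_ y2 _] := fy.
split; apply: (cumulative_le L0 mv vsupp vE) => //.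
- exact: bmM (bm_cos _) by_.
- move=> s _; rewrite normrM -[2]mul1r.
  by apply: ler_pM => //; exact: cos_norm_le1.
- exact: bmM (bm_sin _) by_.
- move=> s _; rewrite normrM -[2]mul1r.
  by apply: ler_pM => //; exact: sin_norm_le1.
Qed.

Let trig_bound (a b A B : R) : `|a| <= 1 -> `|b| <= 1 -> `|A| <= 2 * V -> `|B| <= 2 * V ->
  `|(a * A + b * B) / k| <= 4 * V / k.
Proof.
move=> a1 b1 A1 B1; rewrite normrM normfV (gtr0_norm k0) ler_wpM2r ?invr_ge0 ?(ltW k0)//.
apply: le_trans (ler_normD _ _) _; rewrite !normrM.
apply: le_trans (_ : 1 * (2 * V) + 1 * (2 * V) <= _).
  by apply: lerD; apply: ler_pM.
by rewrite !mul1r; lra.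
Qed.

Lemma fundamental_close x : `|y x - free p q k x| <= 4 * V / k.
Proof.
have [_ _ yE] := fy; rewrite yE addrC addKr /volterra -mulNr.
have [hA hB] := cumulative_trig_le x.
apply: trig_bound => //; first exact: sin_norm_le1.
by rewrite normrN cos_norm_le1.
Qed.

Lemma speed_close x : `|speed p q k y x - free' p q k x| <= 4 * V / k.
Proof.
rewrite speedE addrC addKr; have [hA hB] := cumulative_trig_le x.
by apply: trig_bound => //; [exact: cos_norm_le1|exact: sin_norm_le1].
Qed.

Lemma fundamental_derive (x : R) : is_derive x 1 y (k * speed p q k y x).
Proof.
have [by_ y2 yE] := fy.
have := solution_derive L0 mv vsupp vE k0 (free_derive p q k) by_ y2 yE x.
by rewrite /speed mulrC divfK// lt0r_neq0.
Qed.

Lemma speed_le x : `|speed p q k y x| <= 2.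
Proof.
rewrite -(subrK (free' p q k x) (speed p q k y x)).
apply: le_trans (ler_normD _ _) _.
have h1 := speed_close x; have h2 := free'_le1 k x pq.
have h3 : 4 * V / k <= 1 by rewrite ler_pdivrMr// mul1r.
by apply: le_trans (lerD h1 h2) _; rewrite [leRHS](_ : _ = 1 + 1)// lerD2r.
Qed.

Lemma fundamental_derive2 (x : R) :
  is_derive x 1 (fun t => k * speed p q k y t - J y t) (- k ^+ 2 * y x).
Proof.
have [by_ y2 yE] := fy.
have := solution_derive2 L0 mv vsupp vE k0 (free'_derive p q k) by_ y2 yE x.
congr (is_derive _ _ _ _); apply/funext => t.
by rewrite /speed mulrCA divff ?mulr1// lt0r_neq0.
Qed.

Lemma fundamental_integral a b : a <= b ->
  k * speed p q k y b - k * speed p q k y a =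
  \int[mu]_(s in `[a, b]) ((v s - k ^+ 2) * y s).
Proof.
have [by_ y2 yE] := fy => ab.
rewrite -(solution_integral L0 mv vsupp vE k0 (free_derive p q k)
  (free'_derive p q k) by_ y2 yE ab).
by rewrite /speed ![k * (_ / k)]mulrCA divff ?mulr1// lt0r_neq0.
Qed.

Lemma fundamental_integrable a b :
  mu.-integrable `[a, b] (EFin \o (fun s => (v s - k ^+ 2) * y s)).
Proof.
have [by_ y2 yE] := fy.
exact: (solution_integrable L0 mv vsupp vE k0 (free_derive p q k) by_ y2 yE).
Qed.

Lemma fundamental0 : y 0 = p.
Proof.
have [by_ y2 ->] := fy; rewrite /volterra /free mulr0 cos0 sin0.
rewrite (cumulative0 L0 mv vsupp vE)//; last exact: bmM (bm_cos _) by_.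
rewrite (cumulative0 L0 mv vsupp vE)//; last exact: bmM (bm_sin _) by_.
by rewrite !mulr0 subrr mul0r mulr1 !addr0.
Qed.

Lemma speed0 : speed p q k y 0 = q.
Proof.
have [by_ y2 _] := fy; rewrite speedE /free' mulr0 cos0 sin0.
rewrite (cumulative0 L0 mv vsupp vE)//; last exact: bmM (bm_cos _) by_.
rewrite (cumulative0 L0 mv vsupp vE)//; last exact: bmM (bm_sin _) by_.
by rewrite !mulr0 addr0 mul0r mulr1 addr0 add0r.
Qed.

End one_solution.

Lemma fundamental_det k y1 y2 x : 0 < k -> 4 * V <= k ->
  is_fundamental 1 0 k y1 -> is_fundamental 0 1 k y2 ->
  y1 x * speed 0 1 k y2 x - y2 x * speed 1 0 k y1 x = 1.
Proof.
move=> k0 Vk f1 f2.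
have u1 : unit_data 1 0 by left.
have u2 : unit_data 0 1 by right.
have [bm1 b1 _] := f1; have [bm2 b2 _] := f2.
have ks p q y t : unit_data p q -> is_fundamental p q k y ->
    `|k * speed p q k y t| <= k * 2.
  move=> u f; rewrite normrM (gtr0_norm k0) ler_wpM2l ?(ltW k0)//.
  exact: speed_le u k0 Vk f t.
have := @wronskian_constant R v L E L0 mv vsupp vE k (k * 2) y1
  (fun t => k * speed 1 0 k y1 t) y2 (fun t => k * speed 0 1 k y2 t)
  bm1 bm2 b1 b2 (fun t => ks _ _ _ t u1 f1) (fun t => ks _ _ _ t u2 f2)
  (fundamental_derive k0 f1) (fundamental_derive k0 f2)
  (fundamental_derive2 k0 f1) (fundamental_derive2 k0 f2) 0 x.
rewrite (fundamental0 f1) (fundamental0 f2) (speed0 k0 f1) (speed0 k0 f2).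
move=> h; apply: (mulfI (lt0r_neq0 k0)); rewrite mulr1.
have -> : k * (y1 x * speed 0 1 k y2 x - y2 x * speed 1 0 k y1 x) =
  y1 x * (k * speed 0 1 k y2 x) - y2 x * (k * speed 1 0 k y1 x) by ring.
by rewrite h; ring.
Qed.

End fundamental_solutions.

(** * Dependence on the frequency and the discriminant *)

Section floquet.
Variable R : realType.
Local Notation mu := (@lebesgue_measure R).
Local Notation Rm := (measurableTypeR R).
Variables (v : R -> R) (E : R).
Local Notation L := (2 * pi : R).
Hypothesis mv : measurable_fun (setT : set Rm) v.
Hypothesis vsupp : forall x, ~ (0 <= x < L) -> v x = 0.
Hypothesis vE : (\int[mu]_x (v x ^+ 2)%:E <= E%:E)%E.
Local Notation J := (cumulative v).
Local Notation V := ((L + E) / 2).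

Let L0 : 0 <= L. Proof. exact/ltW/twopi_gt0. Qed.

Let V0 : 0 <= V.
Proof. by rewrite divr_ge0// addr_ge0// (E_ge0 vE). Qed.

Lemma trig_dist (k k' x : R) : 0 <= x <= L ->
  `|cos (k * x) - cos (k' * x)| <= L * `|k - k'| /\
  `|sin (k * x) - sin (k' * x)| <= L * `|k - k'|.
Proof.
move=> /andP[x0 xL].
have h : `|k * x - k' * x| <= L * `|k - k'|.
  by rewrite -mulrBl normrM mulrC ler_wpM2r// ger0_norm.
by split; apply: le_trans h; [exact: cos_lipschitz|exact: sin_lipschitz].
Qed.

(** Two terms from [term_dist] contribute [4 L V + 2 V] each, and the free solution contributes
    [L]. *)
Let C := 8 * L * V + 4 * V + L.

Let C0 : 0 <= C.
Proof.
have LV := mulr_ge0 L0 V0; rewrite /C -mulrA; have := V0; have := L0; lra.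
Qed.

Section two_frequencies.
Variables (p q k k' : R) (y y' : R -> R).
Hypotheses (pq : unit_data p q) (k1 : 1 <= k) (k1' : 1 <= k').
Hypothesis Vk : 4 * V <= k.
Hypotheses (fy : is_fundamental v p q k y) (fy' : is_fundamental v p q k' y').

Let k0 : 0 < k. Proof. exact: lt_le_trans k1. Qed.
Let k0' : 0 < k'. Proof. exact: lt_le_trans k1'. Qed.

Let LD0 : 0 <= 2 * L * `|k - k'|.
Proof. by apply: mulr_ge0 => //; apply: mulr_ge0. Qed.

Let cumulative_dist M (t : R -> R -> R) : 0 <= M ->
  (forall c, bounded_measurable (t c)) -> (forall c s, `|t c s| <= 1) ->
  (forall s, 0 <= s <= L -> `|t k s - t k' s| <= L * `|k - k'|) ->
  (forall s, 0 <= s <= L -> `|y s - y' s| <= M) -> forall x,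
  `|J (fun s => t k s * y s) x - J (fun s => t k' s * y' s) x| <=
    (2 * L * `|k - k'| + M) * V.
Proof.
move=> M0 bt t1 tL yM x; have [by_ y2 _] := fy; have [by' y2' _] := fy'.
have := cumulative_lin L0 mv vsupp vE 1 (-1) x (bmM (bt k) by_) (bmM (bt k') by').
rewrite mul1r mulN1r => <-; apply: (cumulative_le L0 mv vsupp vE).
- by apply: bmD; apply: bmM => //; [exact: bm_cst|exact: bmM|exact: bm_cst|exact: bmM].
- by rewrite addr_ge0.
- move=> s /andP[s0 sL]; have hs : 0 <= s <= L by rewrite s0 ltW.
  have -> : 1 * (t k s * y s) + -1 * (t k' s * y' s) =
     (t k s - t k' s) * y s + t k' s * (y s - y' s) by ring.
  apply: le_trans (ler_normD _ _) _; rewrite !normrM; apply: lerD.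
    apply: le_trans (_ : (L * `|k - k'|) * 2 <= _); first by apply: ler_pM => //; exact: tL.
    by rewrite le_eqVlt; apply/orP; left; apply/eqP; ring.
  by rewrite -[M]mul1r; apply: ler_pM => //; exact: yM.
Qed.

Let inv_dist : `|k^-1 - k'^-1| <= `|k - k'|.
Proof.
have -> : k^-1 - k'^-1 = - (k - k') * (k^-1 * k'^-1).
  by field; rewrite !gt_eqF.
rewrite normrM normrN ler_piMr// normrM !normfV (gtr0_norm k0) (gtr0_norm k0').
by rewrite mulr_ile1 ?invr_ge0 ?(ltW k0) ?(ltW k0')// invf_le1.
Qed.

(** The contribution [M / 4] uses [V / k <= 1/4]. With two such terms [step] reaches [M / 2], as
    [halving] wants. *)
Let term_dist (a a' A A' M : R) : 0 <= M -> `|a'| <= 1 ->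
  `|a - a'| <= L * `|k - k'| -> `|A| <= 2 * V -> `|A'| <= 2 * V ->
  `|A - A'| <= (2 * L * `|k - k'| + M) * V ->
  `|a * A / k - a' * A' / k'| <= (4 * L * V + 2 * V) * `|k - k'| + M / 4.
Proof.
move=> M0 a1 aa hA hA' AA.
have ki : k^-1 <= 1 by rewrite invf_le1.
have ki0 : 0 <= k^-1 by rewrite invr_ge0 ltW.
have -> : a * A / k - a' * A' / k' =
  (a - a') * A * k^-1 + a' * (A - A') * k^-1 + a' * A' * (k^-1 - k'^-1) by ring.
apply: le_trans (ler_normD _ _) _; apply: le_trans (lerD (ler_normD _ _) (lexx _)) _.
rewrite !normrM (ger0_norm ki0).
have h1 : `|a - a'| * `|A| * k^-1 <= (L * `|k - k'|) * (2 * V) * 1.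
  by apply: ler_pM => //; apply: ler_pM.
have h2 : `|a'| * `|A - A'| * k^-1 <= 1 * ((2 * L * `|k - k'| + M) * V) * k^-1.
  by rewrite ler_wpM2r//; apply: ler_pM.
have h3 : `|a'| * `|A'| * `|k^-1 - k'^-1| <= 1 * (2 * V) * `|k - k'|.
  by apply: ler_pM => //; apply: ler_pM.
have h4 : V * k^-1 <= 4^-1.
  by rewrite ler_pdivrMr// ler_pdivlMl.
have h5 : M * (V * k^-1) <= M * 4^-1 by rewrite ler_wpM2l.
have h6 : 2 * L * `|k - k'| * V * k^-1 <= 2 * L * `|k - k'| * V.
  by apply: ler_piMr => //; apply: mulr_ge0.
apply: le_trans (lerD (lerD h1 h2) h3) _.
have -> : 1 * ((2 * L * `|k - k'| + M) * V) * k^-1 =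
  2 * L * `|k - k'| * V * k^-1 + M * (V * k^-1) by ring.
apply: le_trans (lerD (lerD (lexx _) (lerD h6 h5)) (lexx _)) _.
by rewrite le_eqVlt; apply/orP; left; apply/eqP; ring.
Qed.

Let step M : 0 <= M -> (forall s, 0 <= s <= L -> `|y s - y' s| <= M) ->
  forall x, 0 <= x <= L -> `|y x - y' x| <= C * `|k - k'| + M / 2 /\
    `|speed v p q k y x - speed v p q k' y' x| <= C * `|k - k'| + M / 2.
Proof.
move=> M0 yM x hx; have [_ _ yE] := fy; have [_ _ yE'] := fy'.
have [cx sx] := trig_dist k k' hx.
have [A2 B2] := cumulative_trig_le L0 mv vsupp vE fy x.
have [A2' B2'] := cumulative_trig_le L0 mv vsupp vE fy' x.
have dA := @cumulative_dist M (fun c s => cos (c * s)) M0 (@bm_cos R)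
  (fun c s => cos_norm_le1 _) (fun s hs => (trig_dist k k' hs).1) yM x.
have dB := @cumulative_dist M (fun c s => sin (c * s)) M0 (@bm_sin R)
  (fun c s => sin_norm_le1 _) (fun s hs => (trig_dist k k' hs).2) yM x.
set A := J (fun s => cos (k * s) * y s) x in A2 dA.
set B := J (fun s => sin (k * s) * y s) x in B2 dB.
set A' := J (fun s => cos (k' * s) * y' s) x in A2' dA.
set B' := J (fun s => sin (k' * s) * y' s) x in B2' dB.
have tsA := term_dist M0 (sin_norm_le1 (k' * x)) sx A2 A2' dA.
have tcB := term_dist M0 (cos_norm_le1 (k' * x)) cx B2 B2' dB.
have tcA := term_dist M0 (cos_norm_le1 (k' * x)) cx A2 A2' dA.
have tsB := term_dist M0 (sin_norm_le1 (k' * x)) sx B2 B2' dB.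
have f1 : `|free p q k x - free p q k' x| <= L * `|k - k'|.
  by case: pq => -[-> ->]; rewrite /free !(mul1r, mul0r, addr0, add0r).
have f2 : `|free' p q k x - free' p q k' x| <= L * `|k - k'|.
  case: pq => -[-> ->]; rewrite /free' !(mul1r, mulN1r, mul0r, oppr0, addr0, add0r)//.
  by rewrite -opprD normrN.
split.
  have -> : y x - y' x = (free p q k x - free p q k' x) +
     ((sin (k * x) * A / k - sin (k' * x) * A' / k') -
      (cos (k * x) * B / k - cos (k' * x) * B' / k')).
    by rewrite yE yE' /volterra -/A -/A' -/B -/B'; ring.
  apply: le_trans (ler_normD _ _) _.
  apply: le_trans (lerD f1 (le_trans (ler_normB _ _) (lerD tsA tcB))) _.
  by rewrite le_eqVlt /C; apply/orP; left; apply/eqP; field.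
rewrite !speedE// -/A -/A' -/B -/B'.
have -> : free' p q k x + (cos (k * x) * A + sin (k * x) * B) / k -
    (free' p q k' x + (cos (k' * x) * A' + sin (k' * x) * B') / k') =
  (free' p q k x - free' p q k' x) +
     ((cos (k * x) * A / k - cos (k' * x) * A' / k') +
      (sin (k * x) * B / k - sin (k' * x) * B' / k')) by ring.
apply: le_trans (ler_normD _ _) _.
apply: le_trans (lerD f2 (le_trans (ler_normD _ _) (lerD tcA tsB))) _.
by rewrite le_eqVlt /C; apply/orP; left; apply/eqP; field.
Qed.

(** [halving] applied to [step], starting from the trivial bound 4 on [y - y']; one more [step]
    transfers the result to the speeds. *)
Lemma fundamental_lipschitz x : 0 <= x <= L ->
  `|y x - y' x| <= 2 * C * `|k - k'| /\
  `|speed v p q k y x - speed v p q k' y' x| <= 2 * C * `|k - k'|.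
Proof.
have [_ y2 _] := fy; have [_ y2' _] := fy'.
have Ck0 : 0 <= C * `|k - k'| by rewrite mulr_ge0.
have hy s : 0 <= s <= L -> `|y s - y' s| <= 2 * (C * `|k - k'|).
  apply: (@halving R (fun s => 0 <= s <= L) (fun s => y s - y' s) _ 4) => //.
    move=> t _; apply: le_trans (ler_normB _ _) _.
    by apply: le_trans (lerD (y2 t) (y2' t)) _; rewrite -natrD.
  by move=> M M0 hM t ht; have [] := step M0 hM ht.
move=> hx; split; first by rewrite -mulrA hy.
have [_] := step (mulr_ge0 (ler0n R 2) Ck0) hy hx.
move=> /le_trans; apply.
by rewrite le_eqVlt; apply/orP; left; apply/eqP; field.
Qed.

End two_frequencies.

(** 16 makes the distance [4 V / k] to the free solutions at most 1/4; 1 makes inversion of the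
    frequency 1-Lipschitz. *)
Let kmin := Num.max 1 (16 * V).

Let fund p q k := xget (fun=> 0) [set y | is_fundamental v p q k y].

Let fundP p q k : unit_data p q -> kmin <= k -> is_fundamental v p q k (fund p q k).
Proof.
move=> u; rewrite ge_max => /andP[k1 Vk].
have ex : exists y, is_fundamental v p q k y.
  apply: (exists_fundamental L0 mv vsupp vE) => //; first exact: lt_le_trans k1.
  by apply: le_trans Vk; rewrite ler_wpM2r// ler_nat.
exact: (@xgetPex _ (fun=> 0) [set y | is_fundamental v p q k y] ex).
Qed.

Let max_lip (a b c : R) : `|Num.max a c - Num.max b c| <= `|a - b|.
Proof.
case: (leP a c) => ac; case: (leP b c) => bc //.
- by rewrite subrr normr0.
- rewrite ler_norml; apply/andP; split.
    by have := ler_norm (b - a); rewrite distrC; lra.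
  by apply: le_trans (normr_ge0 _); lra.
- rewrite ler_norml; apply/andP; split.
    by apply: le_trans (_ : 0 <= _); [rewrite oppr_le0|lra].
  by have := ler_norm (a - b); lra.
Qed.

Let lip_continuous (f : R -> R) (K : R) : (forall a b, `|f a - f b| <= K * `|a - b|) ->
  continuous f.
Proof.
move=> hf x; apply/cvgrPdist_le => e e0.
have K0 : 0 < `|K| + 1 by rewrite ltr_wpDl.
exists (e / (`|K| + 1)) => /=; first by rewrite divr_gt0.
move=> y /=; rewrite ltr_pdivlMr// => xy; apply: le_trans (hf _ _) _.
apply: le_trans (ltW xy); rewrite mulrC ler_wpM2l//.
by apply: le_trans (ler_norm _) _; rewrite lerDl.
Qed.

(** Clamping the frequency at [kmin] yields functions continuous on the whole line, to which the
    intermediate value theorem applies directly. *)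
Let fund_continuous p q : unit_data p q ->
  continuous (fun k => fund p q (Num.max k kmin) L) /\
  continuous (fun k => speed v p q (Num.max k kmin) (fund p q (Num.max k kmin)) L).
Proof.
move=> u.
have hL : 0 <= L <= L by rewrite L0 lexx.
have hk k : kmin <= Num.max k kmin by rewrite le_max lexx orbT.
have h1 k : kmin <= k -> 1 <= k by move=> /(le_trans _); apply; rewrite le_max lexx.
have h4 k : kmin <= k -> 4 * V <= k.
  move=> /(le_trans _); apply; apply: le_trans (_ : 16 * V <= _).
    by rewrite ler_wpM2r// ler_nat.
  by rewrite le_max lexx orbT.
have key a b := fundamental_lipschitz u (h1 _ (hk a)) (h1 _ (hk b))
  (h4 _ (hk a)) (fundP u (hk a)) (fundP u (hk b)) hL.
have C20 : 0 <= 2 * C by rewrite mulr_ge0.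
split; apply: (@lip_continuous _ (2 * C)) => a b; have [e1 e2] := key a b.
  by apply: le_trans e1 _; rewrite ler_wpM2l.
by apply: le_trans e2 _; rewrite ler_wpM2l.
Qed.

Lemma trig_periodic (x : R) (n : nat) :
  cos (x + 2 * pi * n%:R) = cos x /\ sin (x + 2 * pi * n%:R) = sin x.
Proof.
elim: n => [|n [IHc IHs]]; first by rewrite mulr0 addr0.
have -> : x + 2 * pi * n.+1%:R = (x + 2 * pi * n%:R) + pi *+ 2.
  by rewrite -natr1 -mulr_natl; ring.
by rewrite cosD2pi sinD2pi IHc IHs.
Qed.

(* Where y2 L = 0 the Wronskian identity reads y1 L * y2' L = 1, so the discriminant
   y1 L + y2' L is at least 2 in modulus; it is small at k = j - 1/4, and y2 L changes
   sign between j - 1/4 and j + 1/4, as sin (k L) does. *)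
Lemma exists_floquet_frequency (j : nat) : kmin + 1 <= j%:R ->
  exists k y1 y2, [/\ kmin <= k, j%:R - 4^-1 <= k <= j%:R + 4^-1,
    is_fundamental v 1 0 k y1, is_fundamental v 0 1 k y2 &
    (y1 L + speed v 0 1 k y2 L) ^+ 2 = 4].
Proof.
move=> jk; pose a : R := j%:R - 4^-1; pose b : R := j%:R + 4^-1.
have q0 : (0 : R) < 4^-1 by rewrite invr_gt0.
have q1 : (4^-1 : R) < 1 by rewrite invf_lt1// ltr1n.
have ka : kmin <= a by rewrite /a; move: jk q1; move: kmin => K; lra.
have ab : a <= b by rewrite /a /b; lra.
have kb : kmin <= b by apply: le_trans ka ab.
have u1 : unit_data (1 : R) 0 by left.
have u2 : unit_data (0 : R) 1 by right.
pose S k := fund 0 1 (Num.max k kmin) L.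
pose D k := fund 1 0 (Num.max k kmin) L +
  speed v 0 1 (Num.max k kmin) (fund 0 1 (Num.max k kmin)) L.
have cS : continuous S by have [] := fund_continuous u2.
have cD : continuous (fun k => D k ^+ 2).
  have [c1 _] := fund_continuous u1; have [_ c2] := fund_continuous u2.
  have cD1 : continuous D by move=> x; exact: (cvgD (c1 x) (c2 x)).
  by move=> x; exact: (cvgM (cD1 x) (cD1 x)).
have maxk k : kmin <= k -> Num.max k kmin = k by move=> h; apply/max_idPl.
have k_gt0 k : kmin <= k -> 0 < k.
  by move=> h; apply: lt_le_trans (le_trans _ h); [exact: ltr01|rewrite le_max lexx].
have Vk k : kmin <= k -> 16 * V <= k.
  by move=> h; apply: le_trans h; rewrite le_max lexx orbT.
have Vk4 k : kmin <= k -> 4 * V <= k.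
  by move=> /Vk; apply: le_trans; rewrite ler_wpM2r// ler_nat.
have small k : kmin <= k -> 4 * V / k <= 4^-1.
  move=> h; rewrite ler_pdivrMr ?k_gt0// ler_pdivlMl//.
  rewrite (_ : 4 * (4 * V) = 16 * V); last by ring.
  exact: Vk.
have close p q k : unit_data p q -> kmin <= k ->
    `|fund p q k L - free p q k L| <= 4^-1 /\
    `|speed v p q k (fund p q k) L - free' p q k L| <= 4^-1.
  move=> u hk; split; apply: le_trans (small _ hk).
    exact: (fundamental_close L0 mv vsupp vE (k_gt0 _ hk) (fundP u hk)).
  exact: (speed_close L0 mv vsupp vE (k_gt0 _ hk) (fundP u hk)).
(* A quarter unit of frequency is a quarter turn over the period, so at both ends cos is 0 and sin
   is -1 or 1, well beyond the error 1/4. *)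
have aE : a * L = - (pi / 2) + 2 * pi * j%:R by rewrite /a; field.
have bE : b * L = pi / 2 + 2 * pi * j%:R by rewrite /b; field.
have [ca sa] := trig_periodic (- (pi / 2)) j.
have [cb sb] := trig_periodic (pi / 2) j.
have Sa : S a <= 0.
  rewrite /S (maxk _ ka); have [h _] := close _ _ _ u2 ka.
  move: h; rewrite /free mul0r add0r mul1r aE sa sinN sin_pihalf ler_norml.
  by move=> /andP[_]; move: (fund 0 1 a L) q1 => t; lra.
have Sb : 0 <= S b.
  rewrite /S (maxk _ kb); have [h _] := close _ _ _ u2 kb.
  move: h; rewrite /free mul0r add0r mul1r bE sb sin_pihalf ler_norml.
  by move=> /andP[+ _]; move: (fund 0 1 b L) q1 => t; lra.
have S0 : Num.min (S a) (S b) <= 0 <= Num.max (S a) (S b).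
  by rewrite ge_min le_max Sa Sb orbT.
have [c + Sc0] := IVT ab (continuous_subspaceT cS) S0.
rewrite in_itv/= => /andP[ac cb'].
have kc : kmin <= c by apply: le_trans ac.
have Da : D a ^+ 2 <= 4.
  rewrite /D (maxk _ ka).
  have [h1 _] := close _ _ _ u1 ka; have [_ h2] := close _ _ _ u2 ka.
  move: h1 h2; rewrite /free /free' oppr0 !mul0r !mul1r addr0 add0r aE ca.
  rewrite cosN cos_pihalf !subr0; set s := fund 1 0 a L; set t := speed _ _ _ _ _ _.
  move=> h1 h2; have h : `|s + t| <= 2.
    by apply: le_trans (ler_normD _ _) _; move: q1; lra.
  have -> : (4 : R) = 2 ^+ 2 by rewrite expr2 -natrM.
  by rewrite -(real_normK (num_real _)) ler_sqr ?nnegrE.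
have Dc : 4 <= D c ^+ 2.
  move: Sc0; rewrite /S /D (maxk _ kc).
  have := fundamental_det L0 mv vsupp vE L (k_gt0 _ kc) (Vk4 _ kc) (fundP u1 kc) (fundP u2 kc).
  set s := fund 1 0 c L; set t := speed v 0 1 _ _ _.
  move=> + s0; rewrite s0 mul0r subr0 => st1.
  have : 0 <= (s - t) ^+ 2 by exact: sqr_ge0.
  have -> : (s - t) ^+ 2 = (s + t) ^+ 2 - 4 * (s * t) by ring.
  by rewrite st1 mulr1 subr_ge0.
(* A second use of the intermediate value theorem, between [a], where the discriminant is small, and
   the zero [c] of [S]. *)
have D4 : Num.min (D a ^+ 2) (D c ^+ 2) <= 4 <= Num.max (D a ^+ 2) (D c ^+ 2).
  by rewrite ge_min le_max Da Dc orbT.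
have [k + Dk] := IVT ac (continuous_subspaceT cD) D4.
rewrite in_itv/= => /andP[ak kc'].
have kk : kmin <= k by apply: le_trans ak.
exists k, (fund 1 0 k), (fund 0 1 k); split => //.
- by apply/andP; split=> //; exact: le_trans cb'.
- exact: fundP.
- exact: fundP.
- by move: Dk; rewrite /D (maxk _ kk).
Qed.

(** With determinant 1 and trace [2 s], [s = 1] or [-1], the characteristic polynomial is
    [(X - s)^2]. The pair [(b, s - a)] is an eigenvector unless [b = 0], when both diagonal entries
    equal [s] and [(0, 1)] serves. *)
Lemma multiplier_eigenvector (a b c d : R) : a * d - b * c = 1 -> (a + d) ^+ 2 = 4 ->
  exists s u w : R, [/\ s ^+ 2 = 1, (u != 0) || (w != 0),
    u * a + w * b = s * u & u * c + w * d = s * w].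
Proof.
move=> det tr; pose s := (a + d) / 2.
have s2 : s ^+ 2 = 1 by rewrite /s expr_div_n tr -natrX divff// pnatr_eq0.
have sE : a + d = 2 * s by rewrite /s; field.
have [b0|b0] := eqVneq b 0; last first.
  exists s, b, (s - a); split => //; first by rewrite b0.
    by ring.
  have -> : b * c + (s - a) * d = s * (a + d) - (a * d - b * c) - s * a by ring.
  by rewrite det sE mulrCA -expr2 s2; rewrite mulrBr -expr2 s2; ring.
move: det; rewrite b0 mul0r subr0 => ad.
have ads : a = d.
  apply/eqP; rewrite -subr_eq0 -sqrf_eq0.
  have -> : (a - d) ^+ 2 = (a + d) ^+ 2 - 4 * (a * d) by ring.
  by rewrite tr ad mulr1 subrr.
have ds : d = s by apply: (mulfI (_ : 2 != 0 :> R)); rewrite ?pnatr_eq0// -sE ads; ring.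
by exists s, 0, 1; split; rewrite ?oner_eq0 ?orbT// ?mul0r ?mulr0 ?add0r ?mul1r ?mulr1.
Qed.

Lemma exists_floquet_solution (j : nat) : kmin + 1 <= j%:R ->
  exists (k s : R) (f z : R -> R),
  [/\ j%:R - 4^-1 <= k <= j%:R + 4^-1, s ^+ 2 = 1,
   (forall x : R, is_derive x 1 f (z x)),
   (forall a b, a <= b ->
     mu.-integrable `[a, b] (EFin \o (fun t => (v t - k ^+ 2) * f t)) /\
     z b - z a = \int[mu]_(t in `[a, b]) ((v t - k ^+ 2) * f t)) &
   [/\ f L = s * f 0, z L = s * z 0 & (f 0 != 0) || (z 0 != 0)]].
Proof.
move=> /exists_floquet_frequency[k [y1 [y2 [kk kj f1 f2 tr]]]].
have k0 : 0 < k by apply: lt_le_trans (le_trans _ kk); [exact: ltr01|rewrite le_max lexx].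
have Vk : 4 * V <= k.
  apply: le_trans kk; apply: le_trans (_ : 16 * V <= _); last by rewrite le_max lexx orbT.
  by rewrite ler_wpM2r// ler_nat.
have det := fundamental_det L0 mv vsupp vE L k0 Vk f1 f2.
have [s [u [w [s2 uw h1 h2]]]] := multiplier_eigenvector det tr.
pose z1 x := k * speed v 1 0 k y1 x; pose z2 x := k * speed v 0 1 k y2 x.
exists k, s, (fun x => u * y1 x + w * y2 x), (fun x => u * z1 x + w * z2 x); split => //.
- move=> x; have D1 := fundamental_derive L0 mv vsupp vE k0 f1 x.
  have D2 := fundamental_derive L0 mv vsupp vE k0 f2 x.
  by apply: is_derive_eq; rewrite ?scaler0 ?addr0.
- move=> a b ab.
  have i1 := fundamental_integrable L0 mv vsupp vE k0 f1 a b.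
  have i2 := fundamental_integrable L0 mv vsupp vE k0 f2 a b.
  have j1 := integrableZl (measurable_itvR `[a, b]) u i1.
  have j2 := integrableZl (measurable_itvR `[a, b]) w i2.
  split.
    have := integrableD (measurable_itvR `[a, b]) j1 j2.
    by apply: eq_integrable => // t _ /=; rewrite -!EFinM -EFinD; congr _%:E; ring.
  have -> : u * z1 b + w * z2 b - (u * z1 a + w * z2 a) =
    u * (z1 b - z1 a) + w * (z2 b - z2 a) by ring.
  rewrite (fundamental_integral L0 mv vsupp vE k0 f1 ab).
  rewrite (fundamental_integral L0 mv vsupp vE k0 f2 ab).
  rewrite -!RintegralZl// -RintegralD//.
  by apply: eq_Rintegral => t _; ring.
- rewrite (fundamental0 L0 mv vsupp vE f1) (fundamental0 L0 mv vsupp vE f2).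
  rewrite /z1 /z2 (speed0 L0 mv vsupp vE k0 f1) (speed0 L0 mv vsupp vE k0 f2).
  rewrite !mulr0 !mulr1 addr0 add0r; split => //.
    by rewrite mulrCA [w * (k * _)]mulrCA -mulrDr h2 mulrCA [k * w]mulrC.
  by case/orP: uw => [->//|w0]; rewrite mulf_neq0 ?orbT// lt0r_neq0.
Qed.

End floquet.

(** * The periodic spectrum *)

Section translation.
Variable R : realType.
Local Notation mu := (@lebesgue_measure R).
Local Notation Rm := (measurableTypeR R).

Let shiftN (c : R) : Rm -> Rm := fun x => x - c.

Let mshiftN c : measurable_fun (setT : set Rm) (shiftN c).
Proof. exact: measurable_funB. Qed.

Lemma lebesgue_measure_shift (c : R) (A : set Rm) : measurable A ->
  pushforward mu (shiftN c) A = mu A.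
Proof.
move=> mA; apply/esym/lebesgue_measure_unique => //= _ [[a b]] _ <-.
rewrite /pushforward.
have -> : shiftN c @^-1` `]a, b]%classic = `]a + c, b + c]%classic.
  apply/seteqP; split => x /=; rewrite !in_itv/= /shiftN.
    by rewrite ltrBrDr lerBlDr.
  by rewrite ltrBrDr lerBlDr.
rewrite !lebesgue_measure_itv/= !lte_fin ltrD2r.
by case: ifP => // _; rewrite -!EFinB opprD addrACA subrr addr0.
Qed.

Lemma preimage_shift (c a b : R) :
  shiftN c @^-1` `[a, b]%classic = `[a + c, b + c]%classic.
Proof.
by apply/seteqP; split => x /=; rewrite !in_itv/= /shiftN lerBrDr lerBlDr.
Qed.

Lemma ge0_integral_preimage_shift (g : R -> \bar R) (c : R) (D : set Rm) :
  measurable D -> measurable_fun (setT : set Rm) g -> (forall x, (0 <= g x)%E) ->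
  (\int[mu]_(x in shiftN c @^-1` D) g (x - c)%R = \int[mu]_(x in D) g x)%E.
Proof.
move=> mD mg g0.
rewrite -[LHS](@ge0_integral_pushforward _ _ Rm Rm R (shiftN c) (mshiftN c) mu D g)//;
  first last.
  exact: measurable_funTS.
apply: eq_measure_integral => A mA _; exact: lebesgue_measure_shift.
Qed.

Lemma ge0_integralT_shift (g : R -> \bar R) (c : R) :
  measurable_fun (setT : set Rm) g -> (forall x, (0 <= g x)%E) ->
  (\int[mu]_x g (x - c)%R = \int[mu]_x g x)%E.
Proof. by move=> mg g0; rewrite -(ge0_integral_preimage_shift c measurableT mg g0). Qed.

Lemma ge0_integral_shift (g : R -> \bar R) (c a b : R) :
  measurable_fun (setT : set Rm) g -> (forall x, (0 <= g x)%E) ->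
  (\int[mu]_(x in `[(a + c)%R, (b + c)%R]) g (x - c)%R = \int[mu]_(x in `[a, b]) g x)%E.
Proof.
by move=> mg g0; rewrite -preimage_shift ge0_integral_preimage_shift//; exact: measurable_itvR.
Qed.

Lemma integrable_shift (g : R -> R) (c a b : R) : measurable_fun (setT : set Rm) g ->
  mu.-integrable `[a, b] (EFin \o g) ->
  mu.-integrable `[a + c, b + c] (EFin \o (fun x => g (x - c))).
Proof.
move=> mg /integrableP[_ ig]; apply/integrableP; split.
  apply/measurable_EFinP; apply: measurable_funTS.
  exact: (measurableT_comp mg (mshiftN c)).
rewrite (@ge0_integral_shift (fun x => `|g x|%:E))//.
by apply/measurable_EFinP; exact: measurableT_comp.
Qed.

Lemma Rintegral_shift (g : R -> R) (c a b : R) : measurable_fun (setT : set Rm) g ->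
  mu.-integrable `[a, b] (EFin \o g) ->
  \int[mu]_(x in `[a + c, b + c]) g (x - c) = \int[mu]_(x in `[a, b]) g x.
Proof.
move=> mg ig; have := integrable_shift c mg ig; rewrite /Rintegral -preimage_shift => ig'.
have mg' : measurable_fun (setT : set Rm) (EFin \o g) by exact/measurable_EFinP.
rewrite -(integral_pushforward (mshiftN c) mg' ig' (measurable_itvR `[a, b])).
by congr fine; apply: eq_measure_integral => A mA _; exact: lebesgue_measure_shift.
Qed.

End translation.

(** * Floquet extension of a solution from one period *)

Section periodic_gluing.
Variable R : realType.
Local Notation mu := (@lebesgue_measure R).
Local Notation Rm := (measurableTypeR R).
Local Notation L := (2 * pi : R).

Let Lgt0 : 0 < L. Proof. exact: twopi_gt0. Qed.

Definition cell (x : R) : int := Num.floor (x / L).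

Lemma cellP x : L * (cell x)%:~R <= x < L * (cell x)%:~R + L.
Proof.
have := floor_itv (x / L); rewrite -/(cell x) => /andP[h1 h2]; apply/andP; split.
  by rewrite mulrC -ler_pdivlMr.
by rewrite -[X in _ + X]mulr1 -mulrDr mulrC -ltr_pdivrMr// -intrD1.
Qed.

Lemma cell_eq x (j : int) : L * j%:~R <= x < L * j%:~R + L -> cell x = j.
Proof.
move=> /andP[h1 h2]; apply: floor_def; apply/andP; split.
  by rewrite ler_pdivlMr// mulrC.
by rewrite ltr_pdivrMr// mulrC intrD1 mulrDr mulr1.
Qed.

Lemma cellD x (j : int) : cell (x + L * j%:~R) = cell x + j.
Proof.
apply: cell_eq; have /andP[h1 h2] := cellP x; rewrite intrD mulrDr.
by rewrite lerD2r h1 /= addrAC ltrD2r.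
Qed.

Lemma periodizeE (h : R -> R) x : periodize h x = h (x - L * (cell x)%:~R).
Proof. by []. Qed.

Definition restrict_cell (h : R -> R) (x : R) : R := if 0 <= x < L then h x else 0.

Lemma periodize_cell (h : R -> R) x (j : int) : L * j%:~R <= x < L * j%:~R + L ->
  periodize h x = restrict_cell h (x - L * j%:~R).
Proof.
move=> hx; rewrite periodizeE (cell_eq hx) /restrict_cell.
by move: hx => /andP[h1 h2]; rewrite subr_ge0 h1 ltrBlDl h2.
Qed.

Variables (h : R -> R) (t s : R) (f z : R -> R).
Local Notation v := (restrict_cell h).
Hypothesis mv : measurable_fun (setT : set Rm) v.
Hypothesis s2 : s ^+ 2 = 1.
Hypothesis df : forall x : R, is_derive x 1 f (z x).
Hypothesis fz : forall a b, a <= b ->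
  mu.-integrable `[a, b] (EFin \o (fun x => (v x - t) * f x)) /\
  z b - z a = \int[mu]_(x in `[a, b]) ((v x - t) * f x).
Hypotheses (fL : f L = s * f 0) (zL : z L = s * z 0).

Let s0 : s != 0.
Proof. by apply/eqP => h0; move: s2; rewrite h0 expr0n /= => /eqP; rewrite eq_sym oner_eq0. Qed.

Definition glue (u : R -> R) (x : R) : R := s ^ cell x * u (x - L * (cell x)%:~R).

(** Also valid at the right end of the cell, which belongs to the next one: there [u L = s * u 0]
    makes the two formulas agree. *)
Lemma glue_cell (u : R -> R) x (j : int) : u L = s * u 0 ->
  L * j%:~R <= x <= L * j%:~R + L -> glue u x = s ^ j * u (x - L * j%:~R).
Proof.
move=> uL /andP[h1]; rewrite le_eqVlt => /predU1P[xE|h2]; last first.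
  by rewrite /glue (@cell_eq x j)// h1.
have -> : x - L * j%:~R = L by rewrite xE addrC addKr.
have xj : x = 0 + L * (j + 1)%:~R by rewrite xE intrD1; ring.
have c0 : cell 0 = 0 by apply: cell_eq; rewrite mulr0 lexx add0r.
rewrite /glue xj cellD c0 add0r addrK uL.
by rewrite expfzDr// expr1z mulrA.
Qed.

Lemma glue_periodic (u : R -> R) x : glue u (x + L) = s * glue u x.
Proof.
have -> : x + L = x + L * 1%:~R by rewrite mulr1.
rewrite /glue cellD expfzDr// expr1z [LHS]mulrAC [LHS]mulrC; congr (_ * (_ * u _)).
by rewrite intrD; ring.
Qed.

(** Inside a cell a single formula applies. At a junction the formulas of the two adjacent cells
    both hold up to the point, and [zL] says that their derivatives there coincide. *)
Lemma glue_derive (x : R) : is_derive x 1 (glue f) (glue z x).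
Proof.
pose j := cell x; have /andP[jx xj] := cellP x.
have dG (i : int) : L * i%:~R <= x <= L * i%:~R + L ->
    is_derive x 1 (fun y => s ^ i * f (y - L * i%:~R)) (glue z x).
  move=> hx; rewrite (glue_cell zL hx).
  have dsh : is_derive x 1 (fun y : R => y - L * i%:~R) 1.
    by apply: is_derive_eq; rewrite subr0.
  have dc := @is_derive1_comp R f (fun y : R => y - L * i%:~R) x _ _ (df (x - L * i%:~R)) dsh.
  rewrite mulr1 in dc.
  by apply: is_derive_eq; rewrite ?scaler0 ?addr0.
apply/is_deriveP => e e0.
have local (i : int) : L * i%:~R <= x <= L * i%:~R + L -> exists2 r : R, 0 < r &
    forall y, `|y| < r -> L * i%:~R <= x + y <= L * i%:~R + L ->
      `|glue f (x + y) - glue f x - glue z x * y| <= e * `|y|.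
  move=> hx; have /is_deriveP/(_ e e0)[r r0 hr] := dG i hx.
  exists r => // y /hr + hy; rewrite -(glue_cell fL hy) -(glue_cell fL hx).
  by apply.
have [r r0 hr] : exists2 r : R, 0 < r &
    forall y, `|y| < r -> L * j%:~R <= x + y <= L * j%:~R + L ->
      `|glue f (x + y) - glue f x - glue z x * y| <= e * `|y|.
  by apply: local; rewrite jx ltW.
have ry (y r' : R) : `|y| < r' -> y < r' /\ - r' < y.
  by rewrite ltr_norml => /andP[].
have [xjE|xjN] := eqVneq x (L * j%:~R); last first.
  have xj' : L * j%:~R < x by rewrite lt_neqAle eq_sym xjN.
  exists (Num.min r (Num.min (x - L * j%:~R) (L * j%:~R + L - x))) => [|y].
    by rewrite !lt_min r0 !subr_gt0 xj' xj.
  rewrite !lt_min => /and3P[yr /ry[_ y1] /ry[y2 _]]; apply: hr => //.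
  by apply/andP; split; lra.
(* [x] is the left end of cell [j], hence also the closed right end of cell [j - 1]. *)
have hx1 : L * (j - 1)%:~R <= x <= L * (j - 1)%:~R + L.
  by rewrite xjE intrB mulrBr mulr1 subrK lexx gerBl ltW.
have [r' r0' hr'] := local _ hx1.
exists (Num.min (Num.min r r') L) => [|y]; first by rewrite !lt_min r0 r0' Lgt0.
rewrite !lt_min => /andP[/andP[yr yr'] /ry[y1 y2]].
have [y0|y0] := leP 0 y.
  by apply: hr => //; apply/andP; split; lra.
by apply: hr' => //; rewrite intrB mulrBr mulr1; apply/andP; split; lra.
Qed.

Let rhs (x : R) : R := (periodize h x - t) * glue f x.

Let good a b := mu.-integrable `[a, b] (EFin \o rhs) /\
  glue z b - glue z a = \int[mu]_(x in `[a, b]) rhs x.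

Let continuous_f : continuous f.
Proof. exact: continuous_is_derive df. Qed.

Let measurable_rhs0 : measurable_fun (setT : set Rm) (fun x => (v x - t) * f x).
Proof.
apply: measurable_funM; last exact: continuous_measurableT.
by apply: measurable_funB => //; exact: measurable_cst.
Qed.

(* The integrands differ at the right end point of the cell only. *)
Let good_cell (j : int) a b : a <= b -> L * j%:~R <= a -> b <= L * j%:~R + L -> good a b.
Proof.
move=> ab ja bj; pose c := L * j%:~R.
pose g x := s ^ j * ((v x - t) * f x).
have mg : measurable_fun (setT : set Rm) g.
  by apply: measurable_funM => //; exact: measurable_cst.
have ab' : a - c <= b - c by rewrite lerD2r.
have [if0 fzE] := fz ab'.
have ig : mu.-integrable `[a - c, b - c] (EFin \o g).
  have := integrableZl (measurable_itvR `[a - c, b - c]) (s ^ j) if0.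
  by apply: eq_integrable => //; exact: measurable_itvR.
have igs := integrable_shift c mg ig; rewrite !subrK in igs.
have Egs := Rintegral_shift c mg ig; rewrite !subrK in Egs.
have eqg : {in `[a, b[%classic, (fun x => g (x - c)) =1 rhs}.
  move=> x /set_mem; rewrite /= in_itv/= => /andP[ax xb].
  have hx : L * j%:~R <= x < L * j%:~R + L.
    by rewrite (le_trans ja ax) (lt_le_trans xb bj).
  rewrite /g /rhs (periodize_cell _ hx) (glue_cell fL (j := j)).
    by rewrite /c; ring.
  by move: hx => /andP[-> /ltW ->].
have igo : mu.-integrable `[a, b[ (EFin \o (fun x => g (x - c))).
  apply: integrableS igs; [exact: measurable_itvR|exact: measurable_itvR|].
  by apply: subset_itvl; rewrite bnd_simp.
have iro : mu.-integrable `[a, b[ (EFin \o rhs).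
  apply: eq_integrable igo; first exact: measurable_itvR.
  by move=> x hx /=; rewrite -eqg.
have irc : mu.-integrable `[a, b] (EFin \o rhs).
  move/integrableP: iro => [m1 i1]; apply/integrableP.
  split; first exact/emeasurable_fun_itv_bndo_bndcP.
  by rewrite -integral_itv_bndo_bndc//; exact: measurableT_comp.
split=> //.
have -> : \int[mu]_(x in `[a, b]) rhs x = \int[mu]_(x in `[a, b]) g (x - c).
  rewrite -(@Rintegral_itv_bndo_bndc _ _ _ rhs)//.
  rewrite -(@Rintegral_itv_bndo_bndc _ _ _ (fun x => g (x - c)))//.
  by apply/esym; exact: eq_Rintegral.
rewrite Egs /g RintegralZl//.
rewrite -fzE mulrBr !(glue_cell zL (j := j))//.
  by rewrite ja (le_trans ab bj).
by rewrite (le_trans ja ab) bj.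
Qed.

Let good_trans a b c : a <= b -> b <= c -> good a b -> good b c -> good a c.
Proof.
move=> ab bc [i1 e1] [i2 e2].
have i2o : mu.-integrable `]b, c] (EFin \o rhs).
  apply: integrableS i2; [exact: measurable_itvR|exact: measurable_itvR|].
  by apply: subset_itvr; rewrite bnd_simp.
have U : `[a, b] `|` `]b, c] = `[a, c]%classic.
  by rewrite -itv_bndbnd_setU// bnd_simp.
have disj : [disjoint `[a, b]%classic & `]b, c]%classic].
  apply/disj_setPS => x [/=]; rewrite !in_itv/= => /andP[_ xb] /andP[bx _].
  by move: (lt_le_trans bx xb); rewrite ltxx.
have i3 : mu.-integrable `[a, c] (EFin \o rhs).
  rewrite -U; move: i1 i2o => /integrableP[m1 j1] /integrableP[m2 j2].
  have mm : measurable_fun (`[a, b] `|` `]b, c]) (EFin \o rhs).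
    by apply/measurable_funU; [exact: measurable_itvR|exact: measurable_itvR|].
  apply/integrableP; split => //.
  rewrite ge0_integral_setU//=; first exact: lte_add_pinfty.
  exact: (measurableT_comp (@abse_measurable R setT) mm).
split=> //.
have -> : glue z c - glue z a = (glue z b - glue z a) + (glue z c - glue z b) by ring.
rewrite e1 e2 -U Rintegral_setU ?U//.
by rewrite Rintegral_itv_obnd_cbnd.
Qed.

Lemma glue_integral a b : a <= b -> glue z b - glue z a =
  \int[mu]_(x in `[a, b]) ((periodize h x - t) * glue f x).
Proof.
move=> ab; suff [] : good a b by [].
pose j := cell a; have /andP[ja aj] := cellP a.
have key (m : nat) : forall b, a <= b -> b <= L * (j + m%:Z)%:~R + L -> good a b.
  elim: m => [|m IH] c ac cm.
    by apply: (good_cell (j := j)) => //; rewrite addr0 in cm.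
  have [cm'|/ltW mc] := leP c (L * (j + m%:Z)%:~R + L); first exact: IH.
  have aM : a <= L * (j + m%:Z)%:~R + L.
    apply: le_trans (ltW aj) _; rewrite lerD2r ler_wpM2l ?(ltW Lgt0)// ler_int.
    by rewrite lerDl.
  apply: (good_trans aM mc); first exact: IH.
  apply: (good_cell (j := j + m.+1%:Z)) => //.
  by rewrite -[m.+1]addn1 PoszD addrA intrD1 mulrDr mulr1.
(* This many cells beyond that of [a] are enough to cover [b]. *)
apply: (key (Num.truncn ((b - a) / L)).+1 b ab).
have := truncnS_gt ((b - a) / L); set m := (Num.truncn _).+1 => hm.
move: hm; rewrite ltr_pdivrMr// => hm.
rewrite intrD mulrDr -pmulrn.
by move: hm ja aj; rewrite [_ * L]mulrC; lra.
Qed.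

End periodic_gluing.

(** * Lower bound for the spectrum *)

Section spectrum_lower_bound.
Variable R : realType.
Local Notation mu := (@lebesgue_measure R).
Local Notation Rm := (measurableTypeR R).

Lemma nondecreasing_is_derive (f df : R -> R) (a b : R) : a <= b ->
  (forall x : R, is_derive x 1 f (df x)) ->
  (forall x, a <= x <= b -> 0 <= df x) -> f a <= f b.
Proof.
move=> ab dfx df0.
have [|c + E] := @MVT_segment _ f df a b ab (fun x _ => dfx x).
  exact/continuous_subspaceT/(continuous_is_derive dfx).
by rewrite in_itv/= => /df0 c0; rewrite -subr_ge0 E mulr_ge0// subr_ge0.
Qed.

Lemma Rintegral_ge_cst (f : R -> R) (a b c : R) : a <= b -> continuous f ->
  (forall x, a <= x <= b -> c <= f x) -> c * (b - a) <= \int[mu]_(x in `[a, b]) f x.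
Proof.
move=> ab cf cle.
have mE : mu `[a, b] = (b - a)%:E.
  rewrite lebesgue_measure_itv/= lte_fin; case: ltP => // ba.
  by rewrite (@le_anti _ _ a b) ?ab// subrr.
have <- : \int[mu]_(x in `[a, b]) c = c * (b - a).
  transitivity (c * fine (mu `[a, b])); last by rewrite mE.
  by apply: Rintegral_cst; exact: measurable_itvR.
apply: le_Rintegral; first exact: measurable_itvR.
- by apply: continuous_integrable; exact: cst_continuous.
- exact: continuous_integrable.
by move=> x /=; rewrite in_itv/=; exact: cle.
Qed.

Variables (v : R -> R) (L E t m x0 : R) (f z : R -> R).
Hypotheses (L1 : (2 : R) <= L) (mv : measurable_fun (setT : set Rm) v).
Hypothesis vsupp : forall x : R, ~ (0 <= x < L) -> v x = 0.
Hypothesis vE : (\int[mu]_x (v x ^+ 2)%:E <= E%:E)%E.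
Hypothesis df : forall x : R, is_derive x 1 f (z x).
Hypothesis fz : forall a b : R, 0 <= a -> a <= b -> b < L ->
  z b - z a = \int[mu]_(x in `[a, b]) ((v x - t) * f x).
Hypotheses (m0 : 0 < m) (fm : forall x : R, `|f x| <= m).
Hypotheses (x00 : 0 <= x0) (x0L : x0 + 1 < L) (fx0 : f x0 = m) (zx0 : z x0 = 0).

Local Notation K := (holder E).

Let L0 : 0 <= L. Proof. exact: le_trans L1. Qed.

Let K0 : 0 <= K.
Proof. by have := E_ge0 vE; rewrite /holder; lra. Qed.

Let cf : continuous f. Proof. exact: continuous_is_derive df. Qed.

Let bmf : bounded_measurable f.
Proof. by split; [exact: continuous_measurableT|exists m]. Qed.

Let if_ a b : mu.-integrable `[a, b] (EFin \o f).
Proof. exact: continuous_integrable. Qed.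

(** The derivative vanishes at [x0], so integrating the equation from there leaves the contribution
    of [v], at most [m K] over a length at most 1. *)
Lemma derive_near_max x : x0 <= x <= x0 + 1 ->
  `|z x + t * \int[mu]_(y in `[x0, x]) f y| <= m * K.
Proof.
move=> /andP[x0x xx0]; have h := fz x00 x0x (le_lt_trans xx0 x0L).
have iv := vphi_integrable L0 mv vsupp vE (measurable_itvR `[x0, x]) bmf.
rewrite zx0 subr0 in h; rewrite h.
have -> : \int[mu]_(y in `[x0, x]) ((v y - t) * f y) =
    \int[mu]_(y in `[x0, x]) (v y * f y) - t * \int[mu]_(y in `[x0, x]) f y.
  rewrite -RintegralZl// -RintegralB//; last first.
    exact: (integrableZl (measurable_itvR `[x0, x]) t (if_ x0 x)).
  by apply: eq_Rintegral => y _; rewrite mulrBl.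
rewrite subrK -Rintegral_itv_obnd_cbnd; last first.
  exact: (vphi_integrable L0 mv vsupp vE (measurable_itvR `]x0, x]) bmf).
apply: (int_vphi_le L0 mv vsupp vE (measurable_itvR `]x0, x]) bmf (ltW m0)) => //.
apply: le_trans (int_v_holder mv vE x0x) _.
rewrite lee_fin ler_piMr// -[leRHS]sqrtr1 ler_sqrt//; lra.
Qed.

(* If t were very negative, f would stay above m / 2 on an interval of length
   1 / (2 sqrt (- t)) to the right of x0, be convex there up to an error controlled
   by v, and so exceed its maximum m at the end of that interval. *)
Lemma spectrum_ge_near_max : - (64 * (K + 1) ^+ 2) <= t.
Proof.
have K0' := K0; have m0' := m0.
rewrite leNgt; apply/negP => tlt.
have s0 : 0 < - t by rewrite oppr_gt0 (lt_le_trans tlt)// oppr_le0 mulr_ge0 ?sqr_ge0.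
pose r := Num.sqrt (- t); have r0 : 0 < r by rewrite sqrtr_gt0.
have rr : r ^+ 2 = - t by rewrite sqr_sqrtr// ltW.
have rK : 8 * (K + 1) < r.
  rewrite -(@ltr_pXn2r _ 2)// ?nnegrE ?(ltW r0)//; last by apply: mulr_ge0 => //; lra.
  by rewrite rr exprMn; lra.
(* With this step [t d^2 = -1/4], and [r > 8 (K + 1)] keeps [K d] strictly below 1/16. *)
pose d := (2 * r)^-1; have d0 : 0 < d by rewrite invr_gt0 mulr_gt0.
have dr : d * r = 2^-1 by rewrite /d; field; rewrite gt_eqF.
have d1 : d <= 1 by rewrite invf_le1 ?mulr_gt0//; lra.
have Kd : K * d <= 16^-1 - d / 2.
  have : 8 * (K + 1) * d <= r * d by rewrite ler_wpM2r// ltW.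
  by rewrite [r * d]mulrC dr; lra.
have td : t * d ^+ 2 = - 4^-1.
  by rewrite -[t]opprK -rr mulNr -exprMn mulrC dr; lra.
have tm : t * m <= 0 by rewrite mulr_le0_ge0// ltW; lra.
have zlow x c : x0 <= x <= x0 + d -> (forall y, x0 <= y <= x -> c <= f y) ->
    - (m * K) - t * (c * (x - x0)) <= z x.
  move=> /andP[h1 h2] hc.
  have := @Rintegral_ge_cst f _ _ c h1 cf hc.
  have := @derive_near_max x; rewrite h1 (le_trans h2) ?lerD2l// => /(_ isT).
  rewrite ler_norml => /andP[+ _].
  set I := \int[mu]_(y in _) f y => hz hI.
  have : 0 <= (- t) * (I - c * (x - x0)) by rewrite mulr_ge0 ?subr_ge0// ltW.
  by lra.
(* First pass, with only [f >= -m]: the loss up to [x] is at most [m (K d + 1/4)], which is below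
   [m / 2]. *)
have flow x : x0 <= x <= x0 + d -> m / 2 <= f x.
  move=> /andP[h1 h2].
  pose phi y := f y + (m * K - t * m * d) * (y - x0).
  have : phi x0 <= phi x.
    apply: (@nondecreasing_is_derive _ (fun y => z y + (m * K - t * m * d))) => // [y|y].
      rewrite /phi; have dy := df y.
      by apply: is_derive_eq; rewrite ?scaler0 ?addr0 ?add0r ?subr0 /GRing.scale /= ?mulr1.
    move=> /andP[y1 y2]; have yd : y - x0 <= d by lra.
    have := @zlow y (- m); rewrite y1 (le_trans y2 h2) => /(_ isT).
    have h u : x0 <= u <= y -> - m <= f u by move=> _; have := fm u; rewrite ler_norml => /andP[].
    move=> /(_ h).
    have : 0 <= - (t * m) * (d - (y - x0)) by rewrite mulr_ge0 ?oppr_ge0 ?subr_ge0.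
    by lra.
  rewrite /phi subrr mulr0 addr0 fx0 => h.
  have xd : x - x0 <= d by lra.
  have : (m * K - t * m * d) * (x - x0) <= (m * K - t * m * d) * d.
    have tmd : t * m * d <= 0 by rewrite mulr_le0_ge0// ltW.
    by rewrite ler_wpM2l// subr_ge0 (le_trans tmd)// mulr_ge0// ltW.
  have -> : (m * K - t * m * d) * d = m * (K * d) - m * (t * d ^+ 2) by ring.
  rewrite td => h'.
  have : m * (K * d) <= m * (16^-1 - d / 2) by rewrite ler_wpM2l// ltW.
  have : 0 < m * d by rewrite mulr_gt0.
  by lra.
(* Second pass, now with [f >= m / 2]: the gain at [x0 + d] is [m / 16], more than the loss
   [m K d]. *)
pose phi x := f x + m * K * (x - x0) + (t * m / 4) * (x - x0) ^+ 2.
have : phi x0 <= phi (x0 + d).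
  apply: (@nondecreasing_is_derive _ (fun x => z x + m * K + (t * m / 4) * (2 * (x - x0)))).
  - by rewrite lerDl ltW.
  - move=> x; rewrite /phi; have dx := df x.
    by apply: is_derive_eq; rewrite /GRing.scale /=; ring.
  move=> x /andP[x1 x2]; have := @zlow x (m / 2); rewrite x1 x2 => /(_ isT).
  have h u : x0 <= u <= x -> m / 2 <= f u.
    by move=> /andP[u1 u2]; apply: flow; rewrite u1 (le_trans u2 x2).
  by move=> /(_ h); lra.
rewrite /phi subrr fx0 (addrC x0 d) addrK expr0n /= !mulr0 !addr0.
have := fm (d + x0); rewrite ler_norml => /andP[_ h].
have -> : t * m / 4 * d ^+ 2 = m * (t * d ^+ 2) / 4 by ring.
have -> : m * K * d = m * (K * d) by ring.
rewrite td.
have : m * (K * d) <= m * (16^-1 - d / 2) by rewrite ler_wpM2l// ltW.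
have : 0 < m * d by rewrite mulr_gt0.
by lra.
Qed.

End spectrum_lower_bound.

(** * The potential of a class in [Omega_ N] *)

Section potential_of_class.
Variable R : realType.
Local Notation mu := (@lebesgue_measure R).
Local Notation Rm := (measurableTypeR R).
Local Notation L := (2 * pi : R).

Lemma restrict_cellE (h : R -> R) : restrict_cell h = h \_ `[0, L[.
Proof.
apply/funext => x; rewrite /restrict_cell patchE.
by rewrite (_ : (x \in `[0, L[%classic) = (0 <= x < L))// mem_setE in_itv.
Qed.

Lemma measurable_restrict_cell (h : R -> R) : measurable_fun (setT : set Rm) h ->
  measurable_fun (setT : set Rm) (restrict_cell h).
Proof.
move=> mh; rewrite restrict_cellE.
apply/(measurable_restrict _ (measurable_itvR `[0, L[) measurableT).
exact: measurable_funTS.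
Qed.

Lemma L2T_measurable (q : L2T R) : measurable_fun (setT : set Rm) (q : R -> R).
Proof. exact: (measurable_funP (repr (LebesgueSpace.sort q))). Qed.

Lemma restrict_cell_energy (q : L2T R) (N : R) : Omega_ N q ->
  (\int[mu]_x (restrict_cell q x ^+ 2)%:E <= (L * N)%:E)%E.
Proof.
rewrite /Omega_ /= => hN.
have mq2 : measurable_fun (setT : set Rm) (fun x => ((q : R -> R) x ^+ 2)%:E).
  apply/measurable_EFinP; apply: measurable_funX; exact: L2T_measurable.
have L0 : 0 < L := twopi_gt0 R.
rewrite integral_uniform// in hN; last by move=> x; rewrite lee_fin sqr_ge0.
move: hN; rewrite subr0 lee_pdivrMl// -EFinM; apply: le_trans.
rewrite [leRHS]integral_mkcond; apply: ge0_le_integral => //.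
- by move=> x _; rewrite lee_fin sqr_ge0.
- apply/measurable_EFinP; apply: measurable_funX.
  by apply: measurable_restrict_cell; exact: L2T_measurable.
- apply/(measurable_restrict _ (measurable_itvR `[0, L]) measurableT).
  exact: measurable_funTS.
move=> x _; rewrite patchE mem_setE in_itv/= /restrict_cell.
case: ifPn => [/andP[-> /ltW ->]//|_]; rewrite expr0n /=.
by case: ifP => // _; rewrite lee_fin sqr_ge0.
Qed.

Section bounded_below.
Variables (h : R -> R) (E : R).
Local Notation v := (restrict_cell h).
Hypothesis mv : measurable_fun (setT : set Rm) v.
Hypothesis vE : (\int[mu]_x (v x ^+ 2)%:E <= E%:E)%E.

(** Two periods of the potential, so that a maximum in the first period has an interval of length 1
    to its right inside the support. *)
Let v2 x := v x + v (x - L).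

Lemma restrict_cell_out (g : R -> R) x : ~ (0 <= x < L) -> restrict_cell g x = 0.
Proof. by rewrite /restrict_cell; case: ifP. Qed.

Let mvL : measurable_fun (setT : set Rm) (fun x => v (x - L)).
Proof. by apply: (measurableT_comp mv); exact: measurable_funB. Qed.

Let mv2 : measurable_fun (setT : set Rm) v2.
Proof. exact: measurable_funD. Qed.

Let v2supp (x : R) : ~ (0 <= x < 2 * L) -> v2 x = 0.
Proof.
have := twopi_gt0 R => L0 hx.
by rewrite /v2 !restrict_cell_out ?addr0// => /andP[h1 h2]; apply: hx; apply/andP; split; lra.
Qed.

Let v2_cells x : 0 <= x < 2 * L -> periodize h x = v2 x.
Proof.
move=> /andP[x0 x2]; rewrite /v2; have [xL|xL] := ltP x L.
  rewrite (@periodize_cell _ h x 0) ?mulr0 ?add0r ?x0// subr0.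
  by rewrite [X in _ = _ + X]restrict_cell_out ?addr0// => /andP[]; lra.
rewrite (@periodize_cell _ h x 1) ?mulr1; last by apply/andP; split; lra.
by rewrite [X in _ = X + _]restrict_cell_out ?add0r// => /andP[]; lra.
Qed.

Let v2E : (\int[mu]_x (v2 x ^+ 2)%:E <= (2 * E)%:E)%E.
Proof.
have mE : measurable_fun (setT : set Rm) (fun x => (v x ^+ 2)%:E).
  by apply/measurable_EFinP; exact: measurable_funX.
have -> : (\int[mu]_x (v2 x ^+ 2)%:E =
    \int[mu]_x (v x ^+ 2)%:E + \int[mu]_x (v (x - L)%R ^+ 2)%:E)%E.
  rewrite -ge0_integralD//.
  - apply: eq_integral => x _; rewrite -EFinD /v2; congr _%:E.
    have [x0|x0] := pselect (0 <= x < L); last by rewrite restrict_cell_out// expr0n !add0r.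
    by rewrite [v (_ - _)]restrict_cell_out ?expr0n ?addr0// => /andP[]; lra.
  - by move=> x _; rewrite lee_fin sqr_ge0.
  - by move=> x _; rewrite lee_fin sqr_ge0.
  - by apply/measurable_EFinP; exact: measurable_funX.
rewrite (@ge0_integralT_shift _ (fun x => (v x ^+ 2)%:E))//; last first.
  by move=> x; rewrite lee_fin sqr_ge0.
by rewrite (mulr_natl E 2) mulr2n EFinD leeD.
Qed.

Variables (t : R) (f z : R -> R).
Hypothesis df : forall x : R, is_derive x 1 f (z x).
Hypothesis fz : forall a b : R, a <= b ->
  z b - z a = \int[mu]_(x in `[a, b]) ((periodize h x - t) * f x).
Hypothesis fper : forall x, `|f (x + L)| = `|f x|.

Let norm_period x (j : int) : `|f (x + L * j%:~R)| = `|f x|.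
Proof.
have key y n : `|f (y + L * n%:R)| = `|f y|.
  elim: n => [|n IH]; first by rewrite mulr0 addr0.
  by rewrite -[n.+1%:R]natr1 mulrDr mulr1 addrA fper.
case: j => n; first exact: key.
rewrite NegzE -(key _ n.+1); congr `|f _|.
by rewrite mulrNz mulrN subrK.
Qed.

(** [|f|] is periodic, so its maximum over one period is global and the derivative vanishes there; a
    sign makes the value of [f] positive at that point. *)
Lemma spectrum_lower_bound x1 : f x1 != 0 -> - (64 * (holder (2 * E) + 1) ^+ 2) <= t.
Proof.
move=> fx1; have L0 := twopi_gt0 R; have pi2 := pi_ge2 R.
have cf := continuous_is_derive df.
have cnf : continuous (fun x => `|f x|).
  by move=> x; apply: cvg_norm; exact: cf.
have [x0 + x0max] := EVT_max (ltW L0) (continuous_subspaceT cnf).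
rewrite in_itv/= => /andP[x00 x0L].
have fm x : `|f x| <= `|f x0|.
  have /andP[j1 j2] := cellP x.
  have := norm_period (x - L * (cell x)%:~R) (cell x); rewrite subrK => ->.
  by apply: x0max; rewrite in_itv/=; apply/andP; split; lra.
have m0 : 0 < `|f x0| by rewrite (lt_le_trans _ (fm x1))// normr_gt0.
have [s s2 fs] : exists2 s : R, s ^+ 2 = 1 & s * f x0 = `|f x0|.
  have [f0|f0] := leP 0 (f x0); first by exists 1; rewrite ?expr1n ?mul1r ?ger0_norm.
  by exists (- 1); rewrite ?sqrrN ?expr1n// mulN1r ltr0_norm.
have sn : `|s| = 1 by apply/eqP; rewrite -(@eqrXn2 _ 2)// real_normK ?num_real// s2 expr1n.
pose F x := s * f x; pose Z x := s * z x.
have dF (x : R) : is_derive x 1 F (Z x).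
  exact: is_derive_eq (is_deriveZ s (df x)) _.
have Fm x : `|F x| <= `|f x0| by rewrite normrM sn mul1r.
have bmf : bounded_measurable f.
  by split; [exact: continuous_measurableT|exists `|f x0|].
have L2 : 0 <= 2 * L by lra.
apply: (@spectrum_ge_near_max _ v2 (2 * L) (2 * E) t `|f x0| x0 F Z) => //.
- lra.
- move=> a b a0 ab bL; have -> : Z b - Z a = s * (z b - z a) by rewrite /Z mulrBr.
  have iv := vphi_integrable L2 mv2 v2supp v2E (measurable_itvR `[a, b]) bmf.
  have itf := integrableZl (measurable_itvR `[a, b]) t (continuous_integrable a b cf).
  have ivt := integrableB (measurable_itvR `[a, b]) iv itf.
  rewrite fz// -[LHS](_ : s * \int[mu]_(x in `[a, b]) (v2 x * f x - t * f x) = _); last first.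
    congr (_ * _); apply: eq_Rintegral => x /set_mem; rewrite /= in_itv/= => /andP[ax xb].
    by rewrite v2_cells ?(le_trans a0 ax) ?(le_lt_trans xb bL)// mulrBl.
  rewrite -RintegralZl//; first by apply: eq_Rintegral => x _; rewrite /F; ring.
- lra.
- have : is_derive x0 1 F 0.
    apply: (@derive1_at_max _ F (x0 - 1) (x0 + 1)).
    - lra.
    - by move=> y _; exact: (@ex_derive _ _ _ _ _ _ _ (dF y)).
    - by rewrite in_itv/=; apply/andP; split; lra.
    by move=> y _; rewrite [F x0]fs; apply: le_trans (Fm y); exact: ler_norm.
  by move=> [_ <-]; have [_ <-] := dF x0.
Qed.

End bounded_below.

End potential_of_class.

(** * Bounds for the listed eigenvalues *)

Section listed_eigenvalues.
Variable R : realType.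
Local Notation L := (2 * pi : R).

(** The index [n] itself shows that the multiplicity of [lam n] is positive, and a member of an
    independent family is not the zero function. *)
Lemma listed_spectral_function (q : L2T R) (lam : nat -> R) (n : nat) :
  spectrum_listing q lam -> exists2 f, spectral_function q (lam n) f & exists x, f x != 0.
Proof.
move=> [_ /(_ (lam n))[[|k] [hk nhk] card]].
  by move: card; rewrite II0 card_eq0 => /eqP/seteqP[/(_ n)]; case.
case: hk => f ind sf; exists (f ord0) => //.
apply: contrapT => nx; have f0 x : f ord0 x = 0.
  by apply/eqP/negP => /negP fx; apply: nx; exists x.
suff /ind/(_ ord0)/eqP : forall x, \sum_i (i == ord0)%:R * f i x = 0.
  by rewrite eqxx oner_eq0.
move=> x; rewrite (bigD1 ord0)//= f0 mulr0 add0r big1// => i /negPf ->.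
by rewrite mul0r.
Qed.

(** An unlisted [t] would have multiplicity 0, which a single nonzero solution contradicts. *)
Lemma spectral_function_listed (q : L2T R) (lam : nat -> R) (t : R) (f : R -> R) (x : R) :
  spectrum_listing q lam -> spectral_function q t f -> f x != 0 -> exists n, lam n = t.
Proof.
move=> [_ /(_ t)[k [_ nk] card]] sf fx; apply: contrapT => nl.
have k0 : k = 0%N.
  have S0 : [set n | lam n = t] = set0 by apply/seteqP; split=> // n hn; apply: nl; exists n.
  move: card; rewrite S0 => /card_esym; rewrite card_eq0 => /eqP/seteqP[+ _].
  by case: k {nk} => // k /(_ 0%N)/(_ (ltn0Sn _)).
apply: nk; rewrite k0; exists (fun=> f) => // c hc i; rewrite ord1.
have := hc x; rewrite big_ord1 => /eqP; rewrite mulf_eq0 (negPf fx) orbF => /eqP.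
by rewrite ord1.
Qed.

(** The multiplier of the glued solution is 1 or -1, giving the periodic or the antiperiodic case.
    If the function vanished, so would both its value and its derivative at 0. *)
Lemma eigenvalue_near_square (q : L2T R) (N : R) (j : nat) : Omega_ N q ->
  Num.max 1 (16 * ((2 * pi + L * N) / 2)) + 1 <= j%:R ->
  exists k f x, [/\ j%:R - 4^-1 <= k <= j%:R + 4^-1, spectral_function q (k ^+ 2) f
    & f x != 0].
Proof.
move=> hq hj; have mv := measurable_restrict_cell (L2T_measurable q).
have vE := restrict_cell_energy hq.
have [k [s [f [z [hk s2 df fz [fL zL nz]]]]]] :=
  @exists_floquet_solution R _ _ mv (@restrict_cell_out R q) vE j hj.
have dg := glue_derive s2 df fL zL.
have dg1 x : derive1 (glue s f) x = glue s z x.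
  by rewrite derive1E; have [_ ->] := dg x.
have sp : spectral_function q (k ^+ 2) (glue s f).
  split; first split.
  - by move=> x; exact: (@ex_derive _ _ _ _ _ _ _ (dg x)).
  - move=> x y xy; rewrite !dg1.
    exact: (glue_integral mv s2 df fz fL zL xy).
  have : (s - 1) * (s + 1) = 0 by rewrite -subr_sqr_1 s2 subrr.
  move/eqP; rewrite mulf_eq0 subr_eq0 addr_eq0 => /orP[/eqP s1|/eqP s1].
    by left => x; rewrite -[RHS]mul1r -[in RHS]s1 (glue_periodic s2).
  by right => x; rewrite (glue_periodic s2) {1}s1 mulN1r.
have g0 u : glue s u 0 = u 0.
  rewrite /glue (_ : cell 0 = 0) ?mulr0 ?subr0 ?expr0z ?mul1r//.
  by apply: cell_eq; rewrite mulr0 lexx add0r twopi_gt0.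
apply: contrapT => nx; have f0 x : glue s f x = 0.
  by apply/eqP/negP => /negP fx; apply: nx; exists k, (glue s f), x.
move: nz; rewrite -(g0 f) -(g0 z) f0 eqxx -dg1.
rewrite (_ : glue s f = cst 0) ?derive1_cst ?eqxx//.
by apply/funext => x; exact: f0.
Qed.

(** The upper bound is a count: [n + 1] distinct eigenvalues below [D] force the [n]-th entry of a
    nondecreasing listing below [D]. *)
Lemma periodic_spectrum_bound (N : R) (n : nat) : exists B : R,
  forall q : L2T R, Omega_ N q -> `|periodic_spectrum q n| <= B.
Proof.
set j0 := (Num.truncn (Num.max 1 (16 * ((2 * pi + L * N) / 2)) + 1)).+1.
have hj0 i : Num.max 1 (16 * ((2 * pi + L * N) / 2)) + 1 <= (j0 + i)%:R.
  apply: ltW; apply: lt_le_trans (truncnS_gt _) _.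
  by rewrite ler_nat leq_addr.
pose C := 64 * (holder (2 * (L * N)) + 1) ^+ 2.
pose D := ((j0 + n)%:R + 1) ^+ 2 : R.
(* If a class has no listing, [get] returns the default sequence, whose [n]-th entry is then the one
   to be bounded. *)
pose P : R := `|(point : nat -> R) n|.
have C0 : 0 <= C by rewrite mulr_ge0 ?sqr_ge0.
have D0 : 0 <= D by rewrite sqr_ge0.
exists (C + D + P) => q hq.
rewrite /periodic_spectrum.
have [[lam hlam]|nl] := pselect (exists lam, spectrum_listing q lam); last first.
  rewrite getPN; last by move=> lam hlam; apply: nl; exists lam.
  by rewrite lerDr addr_ge0.
move: (get _) (getPex (ex_intro [set lam | spectrum_listing q lam] lam hlam)) => {hlam}.
move=> lam' /= hlam'.
have mv := measurable_restrict_cell (L2T_measurable q).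
have vE := restrict_cell_energy hq.
have low : - C <= lam' n.
  have [f [[df fz] per] [x fx]] := listed_spectral_function n hlam'.
  apply: (@spectrum_lower_bound _ q _ mv vE (lam' n) f (derive1 f) _ fz _ x fx).
    by move=> y; apply: DeriveDef; rewrite ?derive1E.
  by case: per => per y; rewrite per ?normrN.
(* The windows of radius 1/4 about consecutive integers are disjoint, so the eigenvalues increase
   strictly and monotonicity of the listing makes their indices increase too. *)
have key i : exists2 l, (i <= l)%N & exists2 k, (j0 + i)%:R - 4^-1 <= k <= (j0 + i)%:R + 4^-1
    & lam' l = k ^+ 2.
  elim: i => [|i [l il [k /andP[k1 k2] lk]]].
    have [k [f [x [hk sf fx]]]] := eigenvalue_near_square hq (hj0 0%N).
    have [l hl] := spectral_function_listed hlam' sf fx.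
    by exists l => //; exists k.
  have [k' [f [x [hk' sf fx]]]] := eigenvalue_near_square hq (hj0 i.+1).
  have [l' hl'] := spectral_function_listed hlam' sf fx.
  exists l'; last by exists k'.
  rewrite (leq_ltn_trans il)// ltnNge; apply/negP => ll.
  have := hlam'.1 _ _ ll; rewrite hl' lk.
  move: hk' => /andP[k1' _]; rewrite addnS -natr1 in k1'.
  have j1 : 1 <= (j0 + i)%:R :> R by rewrite ler1n.
  rewrite leNgt => /negP; apply.
  by rewrite ltr_pXn2r// ?nnegrE; lra.
have up : lam' n <= D.
  have [l nl [k /andP[k1 k2] lk]] := key n.
  apply: le_trans (hlam'.1 _ _ nl) _; rewrite lk.
  have j1 : 1 <= (j0 + n)%:R :> R by rewrite ler1n.
  by rewrite ler_pXn2r// ?nnegrE; lra.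
have P0 : 0 <= P by exact: normr_ge0.
by rewrite ler_norml; apply/andP; split; lra.
Qed.

End listed_eigenvalues.

(** * Uniform bound for the linear statistic *)

Section bounded_statistic.
Variable R : realType.

Lemma nc_sum (I : Type) (r : seq I) (u : I -> R[i]) :
  nc (\sum_(i <- r) u i) <= \sum_(i <- r) nc (u i).
Proof.
elim/big_rec2: _ => [|i y x _ h]; first by rewrite nc0.
by apply: le_trans (ncD _ _) _; rewrite lerD2l.
Qed.

Lemma nc_le_sqr (x : R[i]) (A : R) : nc x ^+ 2 <= A -> nc x <= 1 + A.
Proof. by have := nc_ge0 x; have := sqr_ge0 (nc x - 2^-1); rewrite sqrrB; lra. Qed.

(** The modulus of [tau] squared is twice that of a sum of two eigenvalues, whatever its sign;
    imaginary values thus lie in the same disc as real ones. *)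
Lemma tau_bound (N : R) (j : int) : exists T : R,
  forall q : L2T R, Omega_ N q -> nc (tau q j) <= T.
Proof.
have pos n : exists T : R, forall q : L2T R, Omega_ N q -> nc (tau_pos q n) <= T.
  have [B hB] := periodic_spectrum_bound N (2 * n).
  have [B' hB'] := periodic_spectrum_bound N (2 * n - 1).
  exists (1 + 2 * (B + B')) => q hq; apply: nc_le_sqr.
  rewrite -ncX sqrtCK ncR normrM ger0_norm// ler_wpM2l//.
  by apply: le_trans (ler_normD _ _) _; rewrite lerD// ?hB ?hB'.
case: j => [[|n]|n].
- by exists 0 => q _; rewrite nc0.
- exact: pos.
- by have [T hT] := pos n.+1; exists T => q hq; rewrite /= ncN hT.
Qed.

(** [G] is chosen before [g]: only the type pi and the norm bound enter it. *)
Lemma RPW_bounded_on_strips (T : R) : exists G : R, forall g : R[i] -> R[i],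
  RPW pi g -> (PW_norm g <= 1)%E -> forall z, nc z <= T -> nc (g z) <= G.
Proof.
exists (1 + 4 * expR ((2 * pi + 3) * (T + 1))) => g hg g1 z zT.
apply: nc_le_sqr; apply: le_trans (RPW_bound (pi_ge0 R) hg g1 z) _.
rewrite ler_wpM2l// ler_expR ler_wpM2l//.
  by rewrite addr_ge0// mulr_ge0// pi_ge0.
by rewrite lerD2r (le_trans (nc_Im z)).
Qed.

Lemma linear_statistic_bounded (N : R) (m : nat) : exists2 M : R, 0 < M &
  forall g : R[i] -> R[i], RPW pi g -> (PW_norm g <= 1)%E ->
  forall q : L2T R, Omega_ N q -> `|linear_statistic g m q| <= M.
Proof.
have term (i : int) : exists B : R, forall g : R[i] -> R[i], RPW pi g ->
    (PW_norm g <= 1)%E -> forall q : L2T R, Omega_ N q ->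
    nc (g (tau q i) - g i%:~R) <= B.
  have [T hT] := tau_bound N i; have [G hG] := RPW_bounded_on_strips T.
  have [G' hG'] := RPW_bounded_on_strips (nc (i%:~R : R[i])).
  exists (G + G') => g hg g1 q hq; apply: le_trans (ncD _ _) _.
  by rewrite ncN lerD// ?hG ?hG' ?hT.
have [B hB] := choice term.
exists (1 + `|\sum_(i < (2 * m).+1) B (i%:Z - m%:Z)|) => [|g hg g1 q hq].
  by rewrite ltr_pwDl.
rewrite /linear_statistic; apply: le_trans (nc_Re _) _.
apply: le_trans (nc_sum _ _) _; apply: le_trans (_ : \sum_(i < (2 * m).+1) B (i%:Z - m%:Z) <= _).
  by apply: ler_sum => i _; exact: hB.
by rewrite (le_trans (ler_norm _))// lerDr.
Qed.

End bounded_statistic.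

Theorem corollary5p3 (R : realType) (beta N : R) (m : nat)
    (beta_gt0 : 0 < beta) (N_gt0 : 0 < N) :
  exists2 kappa : R, 0 < kappa &
    forall gamma : probability (L2Tb R) R, is_loop_law gamma ->
    forall g : R[i] -> R[i], RPW pi g -> (PW_norm g <= 1)%E ->
    forall eps : R, 0 < eps ->
      let nu := gibbs gamma N beta in
      let F := linear_statistic g m in
      let mean := fine (\int[nu]_(q in Omega_ N) (F q)%:E)%E in
      (nu [set q | Omega_ N q /\ (eps < F q - mean)%R]
         <= (expR (- kappa * eps ^+ 2))%:E)%E.
Proof.
have [M M0 hM] := linear_statistic_bounded N m.
exists (8 * M ^+ 2)^-1; first by rewrite invr_gt0 mulr_gt0// exprn_gt0.
move=> gamma _ g hg g1 eps eps0 /=.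
apply: weighted_bounded_tail M0 eps0 _ _ => //; last by move=> q; exact: hM.
by move=> q; rewrite /gibbs_weight mulr_ge0 ?expR_ge0.
Qed.
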